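(* For any integer $\ell \geq 1$, \begin{align*} S(\overline{2}, \{1\}_{2\ell-1}, \overline{1}) = {} & \sum_{\substack{ p + r + 2k = 2\ell-1 \\ k, r \geq 0 ,\, p \geq 1}} 2 (-1)^{k+p} \beta(r+1) \, (1 - 2^{-p})(2 - 2^{-p}) \zeta(p+1) \, \frac{1}{(2k+1)!} \Big( \frac{\pi}{2} \Big)^{2k+1} \\ & + \sum_{\substack{p+r = 2\ell \\ p,r \geq 0}} 2(-1)^p \beta(r+1)\beta(p+1) \\ & + \sum_{\substack{p+q = 2\ell+2 \\ p, q \geq 2}} (-1)^{p} (1 - 2^{1-p})(3 - 2^{1-p} - 2^{1-q}) \zeta(p)\zeta(q) \\ & + \sum_{\substack{r+2k = 2\ell-1 \\ r, k \geq 0}} 2 \log(2) \beta(r+1) \, \frac{(-1)^k}{(2k+1)!} \Big( \frac{\pi}{2} \Big)^{2k+1} \\ & + (3\cdot2^{-2\ell-1} - 2) (1 - 2^{-2\ell-1}) \zeta(2\ell+2) + (2^{1-2\ell} - 3) \log(2) \zeta(2\ell+1) \\ & + (2 - 2^{-2\ell}) \zeta(\overline{2\ell+1},1) + 2 \cdot \sum_{\substack{p + q = 2\ell + 2 \\ p, q \geq 1}} \frac{1}{2^p} \zeta(\overline{p}, q) . \end{align*}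
   Context: $\zeta$ is the Riemann zeta function and $\beta(s)=\sum_{n\ge1}(-1)^{n-1}(2n-1)^{-s}$ is the Dirichlet beta function. For integers $a,b\ge1$, $\zeta(\overline a,b)=\sum_{n>m>0}\frac{(-1)^n}{n^am^b}$ (limit of partial sums over $n\le N$). $\{1\}_n$ denotes $1$ repeated $n$ times. The multiple $S$ value in question is $$S(\overline2,\{1\}_{2\ell-1},\overline1)=2^{2\ell+1}\sum_{\substack{n_1>n_2>\cdots>n_{2\ell+1}>0\\ n_1,n_3,\ldots,n_{2\ell+1}\text{ even}\\ n_2,n_4,\ldots,n_{2\ell}\text{ odd}}}\frac{(-1)^{n_1/2}(-1)^{n_{2\ell+1}/2}}{n_1^2n_2\cdots n_{2\ell+1}}.$$ *)

(* Defs.v *)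
(* Stdlib reals with Coquelicot limits; finite sums and index sets are those of
   MathComp, with [Rplus] and [Rmult] as the iterated operations. *)
From Stdlib Require Import ZArith Reals.
From mathcomp Require Import all_boot.
From Coquelicot Require Import Coquelicot.

Set Implicit Arguments.
Unset Strict Implicit.
Unset Printing Implicit Defensive.

Open Scope R_scope.

Infix "^Z" := powerRZ (at level 30, right associativity) : R_scope.

Notation "\Rsum_ ( m <= i < n | P ) F" :=
  (\big[Rplus/R0]_(m%N <= i < n%N | P%N) F)
  (at level 41, F at level 41, i, m, n at level 50) : R_scope.
Notation "\Rsum_ ( m <= i < n ) F" :=
  (\big[Rplus/R0]_(m%N <= i < n%N) F)
  (at level 41, F at level 41, i, m, n at level 50) : R_scope.

(* Values at integers only; the series converges for [2 <= s]. *)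
Definition zeta (s : nat) : R := Series (fun n => / INR n.+1 ^ s).

(* Values at integers only, indexed from [n = 0]; the series converges for
   [1 <= s] (conditionally when [s = 1]). *)
Definition beta (s : nat) : R := Series (fun n => (-1) ^ n / INR (2 * n + 1)%N ^ s).

Definition zeta_bar_partial (a b N : nat) : R :=
  \Rsum_(1 <= n < N.+1) \Rsum_(1 <= m < n) ((-1) ^ n / (INR n ^ a * INR m ^ b)).

(* [zeta_bar a b] has the bar on [a], the exponent of the larger index. *)
Definition zeta_bar (a b : nat) : R := real (Lim_seq (zeta_bar_partial a b)).

(* A tuple [n_1 > ... > n_(2l+1) > 0] is encoded with zero-based positions,
   [n i] being [n_(i+1)]; hence the condition that the entries with odd (even)
   subscript be even (odd) says that [n i] has the parity of [i]. *)
Definition S_index (l N : nat) (n : {ffun 'I_(2 * l).+1 -> 'I_N.+1}) : bool :=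
  [&& [forall i : 'I_(2 * l).+1, forall j : 'I_(2 * l).+1, (i < j)%N ==> (n j < n i)%N],
      [forall i, (0 < n i)%N]
    & [forall i, odd (n i) == odd i]].

Definition S_term (l N : nat) (n : {ffun 'I_(2 * l).+1 -> 'I_N.+1}) : R :=
  (-1) ^ (n ord0)./2 * (-1) ^ (n ord_max)./2 /
  (INR (n ord0) ^ 2 * \big[Rmult/R1]_(i | i != ord0) INR (n i)).

(* All the tuples with [n_1 <= N]. *)
Definition S_partial (l N : nat) : R :=
  2 ^ (2 * l + 1) *
  \big[Rplus/R0]_(n : {ffun 'I_(2 * l).+1 -> 'I_N.+1} | S_index n) S_term n.

(* S(bar 2, {1}_(2l-1), bar 1), for [1 <= l]; the sum is absolutely convergent,
   so the order of summation does not matter. *)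
Definition S_value (l : nat) : R := real (Lim_seq (S_partial l)).

(* Main.v *)
(* Substituting [t = i tan (x / 2)] in the iterated integral behind the nested sum
   turns [S] into the integral over [0, pi/2] of [H(x) / sin x], where [H] is, up
   to sign, the [2l]-fold iterated integral of [-ln (cos x) + 2 ln (cos (x / 2))],
   whose Fourier series is [sum_n (-1)^n (cos (2nx) - 2 cos (nx)) / n] up to a
   constant.  Integrating that series [2l] times leaves cosines and polynomials;
   against [1 / sin x], the cosines give elementary sums, and the polynomials
   give, by the expansion [1 / sin x = 2 sum_k sin ((2k+1) x)], powers of [pi/2]
   times values of [beta] and [zeta].  Integrals are avoided: functions are compared
   through bounds on their derivatives.

   The terms of the formula with powers of [pi/2] and [beta] at odd integers
   are summed by the exact Taylor expansion at [0] of the series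
   [sum_k (-1)^k sin ((2k+1) x) / (2k+1)^(2m)], a polynomial on [0, pi/2].  What
   remains is a relation between double sums: the convolutions of [zeta], of
   [beta] and of the [zeta_bar] collapse, by partial fractions of
   [sum_p x^-p y^-(2l+2-p)], to sums [sum_N q_N / N^(2l+1)], and the coefficients
   [q_N] cancel for each [N]. *)
Require Import Defs.
From HB Require Import structures.
From Stdlib Require Import ZArith Reals Lra Lia.
From mathcomp Require Import all_boot zify.
From Coquelicot Require Import Coquelicot.
Open Scope R_scope.

Set Implicit Arguments.
Unset Strict Implicit.
Unset Printing Implicit Defensive.

(** * Finite sums, series and limits *)

(** The obstacle is conditional convergence: the sine series of [1 / sin x] diverges pointwise, one
    of the polynomial coefficients is a multiple of [eta 1], and the convolutions contain [eta 1]
    and [beta 1]. So all expansions of the integrand are truncated at one common [K]. The error then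
    has as derivative a term of size [1 / K] plus a bounded amplitude times [cos (2 K x)], hence is
    [O(1 / K)] up to [PI / 2]; the convolutions are likewise transformed as finite sums, before any
    limit.

    The substitution stays real: the sign [(-1)^(n_1/2)] is moved into the generating series, which
    turns [1 - x^2] into [1 + x^2] in their differential equation and makes the tangent linearise
    it. Cosines always occur as [cos - 1], so that every primitive starts at [0] without constants
    and survives division by [sin x].

    In the final comparison the series [sum_j (-1)^j / (2 j + N + 2)] arises twice, from the
    [zeta_bar] sum and from a convolution of [eta] with weights [2^-p]; the two occurrences cancel,
    and only finite harmonic sums and [ln 2] remain. *)

HB.instance Definition _ := Monoid.isComLaw.Build R R0 Rplus
  (fun x y z => esym (Rplus_assoc x y z)) Rplus_comm Rplus_0_l.
HB.instance Definition _ := Monoid.isComLaw.Build R R1 Rmult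
  (fun x y z => esym (Rmult_assoc x y z)) Rmult_comm Rmult_1_l.
HB.instance Definition _ := Monoid.isMulLaw.Build R R0 Rmult Rmult_0_l Rmult_0_r.
HB.instance Definition _ :=
  Monoid.isAddLaw.Build R Rmult Rplus Rmult_plus_distr_r Rmult_plus_distr_l.

Lemma Rsum_ext (m n : nat) (f g : nat -> R) :
  (forall i, (m <= i < n)%N -> f i = g i) ->
  \Rsum_(m <= i < n) f i = \Rsum_(m <= i < n) g i.
Proof. by move=> h; apply: eq_big_nat. Qed.

Lemma Rsum_scal (m n : nat) (c : R) (f : nat -> R) :
  c * (\Rsum_(m <= i < n) f i) = \Rsum_(m <= i < n) (c * f i).
Proof. exact: (big_distrr (R := R) (plus := Rplus)). Qed.

Lemma Rsum_opp (m n : nat) (f : nat -> R) :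
  - (\Rsum_(m <= i < n) f i) = \Rsum_(m <= i < n) (- f i).
Proof.
rewrite (_ : - _ = (-1) * (\Rsum_(m <= i < n) f i)); last by ring.
by rewrite Rsum_scal; apply: Rsum_ext => i _; ring.
Qed.

Lemma Rsum_plus (m n : nat) (f g : nat -> R) :
  \Rsum_(m <= i < n) (f i + g i) = (\Rsum_(m <= i < n) f i) + (\Rsum_(m <= i < n) g i).
Proof. exact: (big_split (R := R)). Qed.

Lemma Rsum_minus (m n : nat) (f g : nat -> R) :
  \Rsum_(m <= i < n) (f i - g i) = (\Rsum_(m <= i < n) f i) - (\Rsum_(m <= i < n) g i).
Proof.
by rewrite /Rminus Rsum_opp -Rsum_plus.
Qed.

Lemma Rsum_S (n : nat) (f : nat -> R) :
  \Rsum_(0 <= i < n.+1) f i = (\Rsum_(0 <= i < n) f i) + f n.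
Proof. by rewrite big_nat_recr. Qed.

Lemma Rsum0 (f : nat -> R) : \Rsum_(0 <= i < 0) f i = 0.
Proof. by rewrite big_geq. Qed.

Lemma Rsum_le (m n : nat) (f g : nat -> R) :
  (forall i, (m <= i < n)%N -> f i <= g i) ->
  \Rsum_(m <= i < n) f i <= \Rsum_(m <= i < n) g i.
Proof.
move=> h; rewrite big_nat [X in _ <= X]big_nat.
elim/big_ind2: _ => // [|x1 x2 y1 y2 h1 h2]; first exact: Rle_refl.
exact: Rplus_le_compat.
Qed.

Lemma Rsum_abs (m n : nat) (f : nat -> R) :
  Rabs (\Rsum_(m <= i < n) f i) <= \Rsum_(m <= i < n) Rabs (f i).
Proof.
elim/big_ind2: _ => [|x1 x2 y1 y2 h1 h2|i _]; last exact: Rle_refl.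
- by rewrite Rabs_R0; exact: Rle_refl.
- by apply: Rle_trans (Rabs_triang _ _) _; exact: Rplus_le_compat.
Qed.

Lemma Rsum_ge0 (m n : nat) (f : nat -> R) :
  (forall i, (m <= i < n)%N -> 0 <= f i) -> 0 <= \Rsum_(m <= i < n) f i.
Proof.
move=> h; rewrite big_nat.
elim/big_ind: _ => // [|x y hx hy]; first exact: Rle_refl.
exact: Rplus_le_le_0_compat.
Qed.

Lemma Rsum_const0 (m n : nat) (f : nat -> R) :
  (forall i, (m <= i < n)%N -> f i = 0) -> \Rsum_(m <= i < n) f i = 0.
Proof. by move=> h; rewrite big_nat big1. Qed.

Lemma Rsum_cat (m n p : nat) (f : nat -> R) : (m <= n)%N -> (n <= p)%N ->
  \Rsum_(m <= i < p) f i = (\Rsum_(m <= i < n) f i) + (\Rsum_(n <= i < p) f i).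
Proof. by move=> h1 h2; rewrite (big_cat_nat (n := n)). Qed.

Lemma Rsum_triangle (n : nat) (f : nat -> nat -> R) :
  \Rsum_(0 <= i < n) \Rsum_(0 <= j < i) f i j =
  \Rsum_(0 <= j < n) \Rsum_(j.+1 <= i < n) f i j.
Proof.
elim: n => [|n IH]; first by rewrite !Rsum0.
rewrite Rsum_S IH Rsum_S [X in _ = _ + X]big_geq // Rplus_0_r -Rsum_plus.
apply: Rsum_ext => j /andP [_ h].
by rewrite [X in _ = X]big_nat_recr.
Qed.

Lemma sum_n_Rsum (a : nat -> R) (n : nat) : sum_n a n = \Rsum_(0 <= i < n.+1) a i.
Proof.
elim: n => [|n IH]; first by rewrite sum_O big_nat1.
by rewrite sum_Sn IH [X in _ = X]Rsum_S.
Qed.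

Lemma is_series_Rsum (a : nat -> R) (l : R) :
  is_series a l <-> is_lim_seq (fun n => \Rsum_(0 <= i < n) a i) l.
Proof.
split=> h.
- apply/is_lim_seq_incr_1; apply: (is_lim_seq_ext (sum_n a)); last exact: h.
  exact: sum_n_Rsum.
- move/is_lim_seq_incr_1: h => h; apply: (is_lim_seq_ext _ (sum_n a) _ _ h) => n.
  by rewrite sum_n_Rsum.
Qed.

Lemma ex_series_Rsum (a : nat -> R) : ex_series a ->
  is_lim_seq (fun n => \Rsum_(0 <= i < n) a i) (Series a).
Proof. by move=> h; apply/is_series_Rsum; apply: Series_correct. Qed.

Lemma Series_Rsum (a : nat -> R) (l : R) :
  is_lim_seq (fun n => \Rsum_(0 <= i < n) a i) l -> Series a = l.
Proof. by move=> h; apply: is_series_unique; apply/is_series_Rsum. Qed.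

Lemma ex_series_le_abs (a b : nat -> R) :
  (forall n, Rabs (a n) <= b n) -> ex_series b -> ex_series a.
Proof. by move=> h; apply: (@ex_series_le R_AbsRing R_CompleteNormedModule a b). Qed.

Lemma is_lim_seq_uniq (u : nat -> R) (x y : R) :
  is_lim_seq u x -> is_lim_seq u y -> x = y.
Proof.
move=> /is_lim_seq_unique hx /is_lim_seq_unique hy.
by move: hy; rewrite hx => - [].
Qed.

Lemma is_lim_seq_eps (u : nat -> R) (l : R) :
  is_lim_seq u l <-> forall e, 0 < e -> exists N, forall n, (N <= n)%N -> Rabs (u n - l) < e.
Proof.
split.
- move=> /is_lim_seq_spec h e he; have [N hN] := h (mkposreal e he).
  by exists N => n hn; apply: hN; apply/leP.
- move=> h; apply/is_lim_seq_spec => e; have [N hN] := h e (cond_pos e).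
  by exists N => n /leP hn; apply: hN.
Qed.

Lemma is_lim_seq_dom (u d : nat -> R) (l : R) :
  (forall n, Rabs (u n - l) <= d n) -> is_lim_seq d 0 -> is_lim_seq u l.
Proof.
move=> h /is_lim_seq_eps hd; apply/is_lim_seq_eps => e he.
have [N hN] := hd e he; exists N => n hn.
have := h n; have := hN n hn; rewrite Rminus_0_r => h1 h2.
have := Rle_abs (d n); lra.
Qed.

Lemma Series_tail (a b : nat -> R) (k : nat) :
  ex_series b -> (forall n, Rabs (a n) <= b n) ->
  Rabs (Series a - \Rsum_(0 <= i < k) a i) <= Series b - \Rsum_(0 <= i < k) b i.
Proof.
move=> hb hab; have ha : ex_series a by apply: ex_series_le_abs hb.
have l1 : is_lim_seq (fun n => Rabs ((\Rsum_(0 <= i < n + k) a i) - \Rsum_(0 <= i < k) a i))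
    (Rabs (Series a - \Rsum_(0 <= i < k) a i)).
  have -> : Finite (Rabs (Series a - \Rsum_(0 <= i < k) a i)) =
     Rbar_abs (Series a - \Rsum_(0 <= i < k) a i) by [].
  apply: is_lim_seq_abs; apply: is_lim_seq_minus'; last exact: is_lim_seq_const.
  have := ex_series_Rsum ha; move/(is_lim_seq_incr_n _ k); exact.
have l2 : is_lim_seq (fun n => (\Rsum_(0 <= i < n + k) b i) - \Rsum_(0 <= i < k) b i)
    (Series b - \Rsum_(0 <= i < k) b i).
  apply: is_lim_seq_minus'; last exact: is_lim_seq_const.
  have := ex_series_Rsum hb; move/(is_lim_seq_incr_n _ k); exact.
apply: (is_lim_seq_le _ _ _ _ _ l1 l2) => n.
rewrite (@Rsum_cat 0 k (n + k)) ?leq_addl // (@Rsum_cat 0 k (n + k) b) ?leq_addl //.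
have := @Rsum_abs k (n + k) a.
have := @Rsum_le k (n + k) (fun i => Rabs (a i)) b (fun i _ => hab i).
move=> h1 h2.
rewrite !(_ : forall x y, x + y - x = y); [lra | by move=> x y; ring ..].
Qed.

(** Dominated convergence for series: a head of fixed length converges termwise, and both tails lie
    under the same tail of [b]. The filter is arbitrary because sequences and left limits at
    [PI / 2] are both needed. *)
Lemma tannery (T : Type) (F : (T -> Prop) -> Prop) (FF : ProperFilter F)
    (f : T -> nat -> R) (c b : nat -> R) :
  ex_series b -> F (fun x => forall n, Rabs (f x n) <= b n) ->
  (forall n, filterlim (fun x => f x n) F (locally (c n))) ->
  filterlim (fun x => Series (f x)) F (locally (Series c)).
Proof.
move=> hb hf hc.
have hcb n : Rabs (c n) <= b n.
  have l1 : filterlim (fun x => Rabs (f x n)) F (Rbar_locally (Rabs (c n))).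
    apply: (filterlim_comp _ _ _ (fun x => f x n) Rabs _ (locally (c n))) => //.
    exact: (continuous_Rabs (c n)).
  have l2 : filterlim (fun x : T => b n) F (Rbar_locally (b n)).
    exact: filterlim_const.
  apply: (filterlim_le _ _ _ _ _ l1 l2).
  by apply: filter_imp hf => x; apply.
have hfin k : filterlim (fun x => \Rsum_(0 <= i < k) f x i) F
    (locally (\Rsum_(0 <= i < k) c i)).
  elim: k => [|k IH].
    rewrite Rsum0; apply: (filterlim_ext (fun=> 0)); first by move=> x; rewrite Rsum0.
    exact: filterlim_const.
  rewrite Rsum_S; apply: (filterlim_ext (fun x => (\Rsum_(0 <= i < k) f x i) + f x k)).
    by move=> x; rewrite Rsum_S.
  apply: (filterlim_comp_2 _ _ Rplus) => //; first exact: IH.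
  exact: (filterlim_plus (\Rsum_(0 <= i < k) c i : R_NormedModule) (c k)).
apply/filterlim_locally => e.
have e3 : 0 < e / 3 by have := cond_pos e; lra.
have /is_lim_seq_eps hB := ex_series_Rsum hb.
have [k hk] := hB _ e3; have {hk} := hk k (leqnn k) => hk.
have /filterlim_locally hk2 := hfin k.
apply: filter_imp (filter_and _ _ hf (hk2 (mkposreal _ e3))) => x [h1 h2].
have t1 := @Series_tail (f x) b k hb h1.
have t2 := @Series_tail c b k hb hcb.
rewrite /ball /= /AbsRing_ball /abs /minus /plus /opp /= in h2 *.
move: hk; rewrite Rabs_minus_sym => hk; have := Rle_abs (Series b - \Rsum_(0 <= i < k) b i) => hk'.
rewrite (_ : Series (f x) + - Series c =
  (Series (f x) - \Rsum_(0 <= i < k) f x i) +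
  ((\Rsum_(0 <= i < k) f x i) + - (\Rsum_(0 <= i < k) c i)) +
  - (Series c - \Rsum_(0 <= i < k) c i)); last by ring.
have := Rabs_triang (Series (f x) - \Rsum_(0 <= i < k) f x i +
  ((\Rsum_(0 <= i < k) f x i) + - (\Rsum_(0 <= i < k) c i))) (- (Series c - \Rsum_(0 <= i < k) c i)).
have := Rabs_triang (Series (f x) - \Rsum_(0 <= i < k) f x i)
  ((\Rsum_(0 <= i < k) f x i) + - (\Rsum_(0 <= i < k) c i)).
rewrite Rabs_Ropp; lra.
Qed.

(** Extending each row by zero turns a sum whose length grows with the parameter into a full
    series. *)
Lemma tannery_finite (f : nat -> nat -> R) (c b : nat -> R) :
  ex_series b -> (forall m n, (n < m)%N -> Rabs (f m n) <= b n) ->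
  (forall n, is_lim_seq (fun m => f m n) (c n)) ->
  is_lim_seq (fun m => \Rsum_(0 <= n < m) f m n) (Series c).
Proof.
move=> hb hf hc; have b0 n : 0 <= b n.
  by have := hf n.+1 n (leqnn _); have := Rabs_pos (f n.+1 n); lra.
pose g m n := if (n < m)%N then f m n else 0.
have hg : is_lim_seq (fun m => Series (g m)) (Series c).
  apply: (@tannery nat eventually _ g c b) => //.
  - exists 0%N => m _ n; rewrite /g; case: ifP => [/hf //|_].
    by rewrite Rabs_R0.
  - move=> n; suff : is_lim_seq (g^~ n) (c n) by [].
    apply: (is_lim_seq_ext_loc (fun m => f m n)); last exact: hc.
    by exists n.+1 => m /leP hm; rewrite /g hm.
apply: is_lim_seq_ext hg => m; apply: Series_Rsum.
apply: (is_lim_seq_ext_loc (fun=> \Rsum_(0 <= n < m) f m n)); last exact: is_lim_seq_const.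
exists m => k /leP hk; rewrite (@Rsum_cat 0 m k) // [X in _ = _ + X]Rsum_const0.
  by rewrite Rplus_0_r; apply: Rsum_ext => i /andP [_ hi]; rewrite /g hi.
by move=> i /andP [hi _]; rewrite /g ltnNge hi.
Qed.

(** Multiplied by the sign of its first term, a block lies between [0] and the size of that term;
    this invariant passes to blocks longer by one. *)
Lemma alternating_bound (u : nat -> R) (m n : nat) :
  (forall k, 0 <= u k) -> (forall k, u k.+1 <= u k) ->
  Rabs (\Rsum_(m <= k < n) ((-1) ^ k * u k)) <= u m.
Proof.
move=> u0 ud.
suff h : forall d m, 0 <= (-1) ^ m * (\Rsum_(m <= k < m + d) ((-1) ^ k * u k)) <= u m.
  case: (leqP m n) => hmn; last first.
    by rewrite big_geq ?Rabs_R0 //; exact: ltnW.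
  have := h (n - m)%N m; rewrite subnKC //.
  set s := \Rsum_(_ <= _ < _) _ => hs.
  rewrite (_ : Rabs s = Rabs ((-1) ^ m * s)); last by rewrite Rabs_mult pow_1_abs Rmult_1_l.
  by rewrite Rabs_pos_eq; case: hs.
elim=> [|d IH] {}m.
  by rewrite addn0 big_geq // Rmult_0_r; have := u0 m; lra.
have hmm : (-1) ^ m * (-1) ^ m = 1 by rewrite -Rpow_mult_distr (_ : -1 * -1 = 1); [exact: pow1 | ring].
rewrite big_ltn; last by rewrite addnS ltnS leq_addr.
have := IH m.+1; rewrite addSnnS; set s := \Rsum_(_ <= _ < _) _.
rewrite /= => h; have := ud m.
rewrite Rmult_plus_distr_l -Rmult_assoc hmm; lra.
Qed.

(** * Oscillating derivatives and Taylor remainders of cos and sin *)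

Lemma mvt_dist (f df : R -> R) (x y M : R) : x < y ->
  (forall z, x <= z <= y -> is_derive f z (df z)) ->
  (forall z, x <= z <= y -> Rabs (df z) <= M) ->
  Rabs (f y - f x) <= M * (y - x).
Proof.
move=> hxy hd hM.
have [c [-> hc]] := MVT_cor2 f df x y hxy (fun c h => proj1 (is_derive_Reals _ _ _) (hd c h)).
rewrite Rabs_mult (Rabs_pos_eq (y - x)); last by lra.
apply: Rmult_le_compat_r; first lra.
by apply: hM; lra.
Qed.

(** Provides starting points for the mean value theorem: derivatives will be controlled on an open
    interval only, some amplitudes having [sin x] in the denominator, and continuity lets the
    starting point approach [0]. *)
Lemma small_near0 (f : R -> R) (x e : R) : f 0 = 0 -> continuity_pt f 0 -> 0 < x -> 0 < e ->
  exists y, 0 < y < x /\ Rabs (f y) < e.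
Proof.
move=> f0 hf hx he; have [d [hd hf']] := hf e he.
exists (Rmin (d / 2) (x / 2)).
have := Rmin_l (d / 2) (x / 2); have := Rmin_r (d / 2) (x / 2).
have : 0 < Rmin (d / 2) (x / 2) by apply: Rmin_pos; lra.
set z := Rmin _ _ => h1 h2 h3; split; first lra.
have := hf' z; rewrite /D_x /no_cond /= /Rdist f0 !Rminus_0_r; apply.
by split; [split=> //; lra | rewrite Rabs_pos_eq; lra].
Qed.

(* Integration by parts without integrals: adding [g cos (lam x + c) / lam] to
   [f] removes the oscillating part of its derivative. *)
Lemma oscillation_bound (f r g dg : R -> R) (b A B rho lam c : R) :
  0 < lam -> f 0 = 0 -> continuity_pt f 0 ->
  (forall x, 0 < x < b -> is_derive f x (r x + g x * sin (lam * x + c))) ->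
  (forall x, 0 < x < b -> is_derive g x (dg x)) ->
  (forall x, 0 < x < b -> Rabs (r x) <= rho) ->
  (forall x, 0 < x < b -> Rabs (g x) <= A) ->
  (forall x, 0 < x < b -> Rabs (dg x) <= B) ->
  forall x, 0 < x < b -> Rabs (f x) <= rho * b + (2 * A + B * b) / lam.
Proof.
move=> hl f0 cf hf hg hr hA hB x hx.
apply: le_epsilon => e he.
have [y [hy hye]] := small_near0 f0 cf (proj1 hx) he.
pose h z := f z + g z * (cos (lam * z + c) / lam).
have hh : Rabs (h x - h y) <= (rho + B / lam) * (x - y).
  apply: (@mvt_dist h (fun z => r z + dg z * (cos (lam * z + c) / lam))); first lra.
    move=> z hz; have hz' : 0 < z < b by lra.
    have -> : r z + dg z * (cos (lam * z + c) / lam) =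
       (r z + g z * sin (lam * z + c)) +
       (dg z * (cos (lam * z + c) / lam) + g z * (- sin (lam * z + c))) by ring.
    apply: (@is_derive_plus R_AbsRing); first exact: hf.
    apply: (@is_derive_mult R_AbsRing g (fun t => cos (lam * t + c) / lam) z (dg z)).
    - exact: hg.
    - by auto_derive => //; field; lra.
    - by move=> *; exact: Rmult_comm.
  move=> z hz; have hz' : 0 < z < b by lra.
  apply: Rle_trans (Rabs_triang _ _) _; apply: Rplus_le_compat; first exact: hr.
  rewrite Rabs_mult /Rdiv Rabs_mult (Rabs_pos_eq (/ lam)); last by apply/Rlt_le/Rinv_0_lt_compat.
  rewrite -Rmult_assoc; apply: Rmult_le_compat_r; first by apply/Rlt_le/Rinv_0_lt_compat.
  rewrite -[B]Rmult_1_r; apply: Rmult_le_compat; try exact: Rabs_pos; first exact: hB.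
  by apply: Rabs_le; have := COS_bound (lam * z + c); lra.
have hgc z : 0 < z < b -> Rabs (g z * (cos (lam * z + c) / lam)) <= A / lam.
  move=> hz; rewrite Rabs_mult /Rdiv Rabs_mult (Rabs_pos_eq (/ lam)); last by apply/Rlt_le/Rinv_0_lt_compat.
  rewrite -Rmult_assoc; apply: Rmult_le_compat_r; first by apply/Rlt_le/Rinv_0_lt_compat.
  rewrite -[A]Rmult_1_r; apply: Rmult_le_compat; try exact: Rabs_pos; first exact: hA.
  by apply: Rabs_le; have := COS_bound (lam * z + c); lra.
have hgx := hgc x hx.
have hgy : Rabs (g y * (cos (lam * y + c) / lam)) <= A / lam by apply: hgc; lra.
have rho0 : 0 <= rho by apply: Rle_trans (Rabs_pos _) (hr x hx).
have B0 : 0 <= B / lam.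
  by apply: Rdiv_le_0_compat => //; apply: Rle_trans (Rabs_pos _) (hB x hx).
have : (rho + B / lam) * (x - y) <= (rho + B / lam) * b by apply: Rmult_le_compat_l; lra.
rewrite (_ : (2 * A + B * b) / lam = A / lam + A / lam + B / lam * b); last by field; lra.
move=> hh1; apply: Rabs_le.
move: hh hgx hgy => /Rabs_le_between hh /Rabs_le_between hgx /Rabs_le_between hgy.
move: hye => /Rabs_def2 hye; rewrite /h in hh; lra.
Qed.

Lemma primitive_bound (f df : R -> R) (b e : R) :
  f 0 = 0 -> continuity_pt f 0 ->
  (forall x, 0 < x < b -> is_derive f x (df x)) ->
  (forall x, 0 < x < b -> Rabs (df x) <= e) ->
  forall x, 0 < x < b -> Rabs (f x) <= e * b.
Proof.
move=> f0 cf hf hd x hx.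
have := @oscillation_bound f df (fun=> 0) (fun=> 0) b 0 0 e 1 0.
rewrite (_ : e * b + (2 * 0 + 0 * b) / 1 = e * b); last by field.
apply=> //; first lra.
- move=> z hz; rewrite (_ : df z + _ = df z); [exact: hf | ring].
- by move=> z hz; apply: is_derive_const.
- by move=> z hz; rewrite Rabs_R0; exact: Rle_refl.
- by move=> z hz; rewrite Rabs_R0; exact: Rle_refl.
Qed.

(** The model is a chain of cosines and sines: [C l.+1] is minus a second primitive of [C l], with
    [S l.+1] in between, all vanishing at [0]. A uniform error thus survives any number of
    integrations, each costing a factor [b]. *)
Lemma iterated_primitive_bound (C S : nat -> R -> R) (b e : R) :
  (forall l, C l.+1 0 = 0 /\ S l.+1 0 = 0) ->
  (forall l, continuity_pt (C l.+1) 0 /\ continuity_pt (S l.+1) 0) ->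
  (forall l x, 0 < x < b -> is_derive (C l.+1) x (- S l.+1 x)) ->
  (forall l x, 0 < x < b -> is_derive (S l.+1) x (C l x)) ->
  (forall x, 0 < x < b -> Rabs (C 0%N x) <= e) ->
  forall l x, 0 < x < b ->
    Rabs (C l x) <= e * b ^ (2 * l) /\ Rabs (S l.+1 x) <= e * b ^ (2 * l).+1.
Proof.
move=> h0 hc hC hS hb.
have hstep l : (forall x, 0 < x < b -> Rabs (C l x) <= e * b ^ (2 * l)) ->
    forall x, 0 < x < b -> Rabs (S l.+1 x) <= e * b ^ (2 * l).+1.
  move=> h x hx; have := @primitive_bound (S l.+1) (C l) b _ (proj2 (h0 l)) (proj2 (hc l)) (hS l) h x hx.
  by rewrite -tech_pow_Rmult => h'; apply: Rle_trans h' _; apply: Req_le; ring.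
elim=> [|l IH] x hx.
  suff h y : 0 < y < b -> Rabs (C 0%N y) <= e * b ^ (2 * 0) by split; [exact: h | exact: hstep].
  by rewrite muln0 Rmult_1_r; exact: hb.
suff h y : 0 < y < b -> Rabs (C l.+1 y) <= e * b ^ (2 * l.+1) by split; [exact: h | exact: hstep].
move=> hy; have := @primitive_bound (C l.+1) (fun x => - S l.+1 x) b (e * b ^ (2 * l).+1)
  (proj1 (h0 l)) (proj1 (hc l)) (hC l).
rewrite (_ : (2 * l.+1)%N = (2 * l).+2); last by lia.
rewrite -[b ^ _.+2]tech_pow_Rmult => h; apply: Rle_trans (h _ y hy) _; last by apply: Req_le; ring.
by move=> z hz; rewrite Rabs_Ropp; apply: (IH z hz).2.
Qed.

Definition divpow (n : nat) (x : R) : R := x ^ n / INR (fact n).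

Lemma INR_factS (n : nat) : INR (fact n.+1) = INR n.+1 * INR (fact n).
Proof. by rewrite -mult_INR. Qed.

Lemma is_derive_divpow (n : nat) (x : R) : is_derive (divpow n.+1) x (divpow n x).
Proof.
rewrite /divpow; auto_derive => //.
rewrite INR_factS -/(INR n.+1).
have := INR_fact_neq_0 n; have := not_0_INR n.+1 (Nat.neq_succ_0 n).
by move: (INR n.+1) => z hz hf; field.
Qed.

Lemma is_derive_Rsum (n : nat) (f df : nat -> R -> R) (x : R) :
  (forall i, (i < n)%N -> is_derive (f i) x (df i x)) ->
  is_derive (fun y => \Rsum_(0 <= i < n) f i y) x (\Rsum_(0 <= i < n) df i x).
Proof.
elim: n => [|n IH] h.
  rewrite Rsum0; apply: (is_derive_ext (fun=> 0)); last exact: is_derive_const.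
  by move=> t; rewrite Rsum0.
rewrite Rsum_S; apply: (is_derive_ext (fun y => (\Rsum_(0 <= i < n) f i y) + f n y)).
  by move=> t; rewrite Rsum_S.
apply: (@is_derive_plus R_AbsRing); last exact: h.
by apply: IH => i hi; apply: h; exact: ltnW.
Qed.

(** The cosine loses one term more than the sine, so that both remainders vanish at [0] for every
    [l] and form, up to sign, the chain of iterated primitives of [cos x - 1]. *)
Definition cos_rem (l : nat) (x : R) : R :=
  cos x - \Rsum_(0 <= j < l.+1) ((-1) ^ j * divpow (2 * j) x).

Definition sin_rem (l : nat) (x : R) : R :=
  sin x - \Rsum_(0 <= j < l) ((-1) ^ j * divpow (2 * j).+1 x).

Lemma cos_remS (l : nat) (x : R) :
  cos_rem l.+1 x = cos_rem l x - (-1) ^ l.+1 * divpow (2 * l.+1) x.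
Proof. by rewrite /cos_rem (Rsum_S l.+1); ring. Qed.

Lemma sin_remS (l : nat) (x : R) :
  sin_rem l.+1 x = sin_rem l x - (-1) ^ l * divpow (2 * l).+1 x.
Proof. by rewrite /sin_rem Rsum_S; ring. Qed.

Lemma cos_rem0 (x : R) : cos_rem 0 x = cos x - 1.
Proof. by rewrite /cos_rem big_nat1 /divpow /=; field. Qed.

Lemma is_derive_cos_rem (l : nat) (x : R) : is_derive (cos_rem l) x (- sin_rem l x).
Proof.
elim: l => [|l IH].
  apply: (is_derive_ext (fun x => cos x - 1)); first by move=> t; rewrite cos_rem0.
  by rewrite /sin_rem Rsum0; auto_derive; [|ring].
apply: (is_derive_ext (fun x => cos_rem l x - (-1) ^ l.+1 * divpow (2 * l.+1) x)).
  by move=> t; rewrite cos_remS.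
rewrite sin_remS (_ : - _ = - sin_rem l x - (-1) ^ l.+1 * divpow (2 * l).+1 x); last by rewrite /=; ring.
apply: (@is_derive_minus R_AbsRing) => //.
apply: is_derive_scal.
rewrite (_ : (2 * l.+1)%N = (2 * l).+2); last by lia.
exact: is_derive_divpow.
Qed.

Lemma is_derive_sin_rem (l : nat) (x : R) : is_derive (sin_rem l.+1) x (cos_rem l x).
Proof.
elim: l => [|l IH].
  apply: (is_derive_ext (fun x => sin x - x)).
    by move=> t; rewrite /sin_rem big_nat1 /divpow muln0 /=; field.
  by rewrite cos_rem0; auto_derive => //; ring.
apply: (is_derive_ext (fun x => sin_rem l.+1 x - (-1) ^ l.+1 * divpow (2 * l.+1).+1 x)).
  by move=> t; rewrite (sin_remS l.+1).
rewrite cos_remS; apply: (@is_derive_minus R_AbsRing) => //.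
by apply: is_derive_scal; exact: is_derive_divpow.
Qed.

Lemma divpow_at0 (n : nat) : divpow n.+1 0 = 0.
Proof. by rewrite /divpow /= !Rmult_0_l /Rdiv Rmult_0_l. Qed.

Lemma cos_rem_at0 (l : nat) : cos_rem l 0 = 0.
Proof.
elim: l => [|l IH]; first by rewrite cos_rem0 cos_0; ring.
rewrite cos_remS IH (_ : (2 * l.+1)%N = (2 * l).+2); last by lia.
by rewrite divpow_at0; ring.
Qed.

Lemma sin_rem_at0 (l : nat) : sin_rem l 0 = 0.
Proof.
elim: l => [|l IH]; first by rewrite /sin_rem Rsum0 sin_0; ring.
by rewrite sin_remS IH divpow_at0; ring.
Qed.

(** * Nested sums and their generating series *)

(* [chain j n] is the sum of [(-1)^(n_(j+1)/2) / (n_1 ... n_(j+1))] over the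
   [n = n_1 > ... > n_(j+1) > 0] of alternating parities with [n_(j+1)] even. *)
Fixpoint chain (j n : nat) : R :=
  if odd n == odd j then
    match j with
    | 0%N => (-1) ^ n./2
    | j'.+1 => \Rsum_(0 <= m < n) chain j' m
    end / INR n
  else 0.

Lemma chain_at0 (j : nat) : chain j 0 = 0.
Proof. by case: j => [|j] /=; [|case: ifP => // _]; rewrite /Rdiv Rinv_0 Rmult_0_r. Qed.

Lemma chain_parity (j n : nat) : odd n != odd j -> chain j n = 0.
Proof. by case: j => [|j] /= /negbTE ->. Qed.

Lemma chainS (j n : nat) : odd n == odd j.+1 ->
  INR n * chain j.+1 n = \Rsum_(0 <= m < n) chain j m.
Proof.
move=> h; case: n h => [|n] h; first by rewrite big_geq // Rmult_0_l.
move: h; rewrite [chain _ _]/= => ->; rewrite -/(INR n.+1); field; exact: not_0_INR.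
Qed.

(** Raising the bound of the nested sum by two adds two terms, one of which is excluded by its
    parity. *)
Lemma chain_rec (j n : nat) :
  INR n.+2 * chain j.+1 n.+2 - INR n * chain j.+1 n =
  if odd n.+1 == odd j then chain j n.+1 else 0.
Proof.
case: ifP => h; last first.
  by rewrite !chain_parity; [ring | move: h => /=; case: (odd n); case: (odd j) ..].
rewrite !chainS; try by move: h => /=; case: (odd n); case: (odd j).
by rewrite !Rsum_S (@chain_parity j n); [ring | move: h => /=; case: (odd n); case: (odd j)].
Qed.

Definition signed_chain (j n : nat) : R := (-1) ^ n./2 * chain j n.

(** The factor [(-1) ^ n./2] changes sign when [n] grows by two, so the difference in [chain_rec]
    becomes a sum. This is where the imaginary substitution is absorbed. *)
Lemma signed_chain_rec (j n : nat) :
  INR n.+2 * signed_chain j.+1 n.+2 + INR n * signed_chain j.+1 n =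
  (-1) ^ j * signed_chain j n.+1.
Proof.
have := chain_rec j n; rewrite /signed_chain.
case: ifP => h hc; last first.
  rewrite [chain j n.+1]chain_parity ?h // !Rmult_0_r.
  transitivity (- (-1) ^ n./2 * (INR n.+2 * chain j.+1 n.+2 - INR n * chain j.+1 n)).
    by rewrite [(n.+2)./2]/= -tech_pow_Rmult; ring.
  by rewrite hc; ring.
rewrite -{}hc.
have -> : (-1) ^ (n.+2)./2 = - (-1) ^ n./2 by rewrite [(n.+2)./2]/= -tech_pow_Rmult; ring.
have -> : (-1) ^ (n.+1)./2 = - (-1) ^ j * (-1) ^ n./2; last first.
  have hjj : (-1) ^ j * (-1) ^ j = 1 by rewrite -Rpow_mult_distr (_ : -1 * -1 = 1); [exact: pow1 | ring].
  transitivity (((-1) ^ j * (-1) ^ j) * (-1) ^ n./2 * - (INR n.+2 * chain j.+1 n.+2 - INR n * chain j.+1 n)); last by ring.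
  by rewrite hjj; ring.
have hpow m : (-1) ^ m = if odd m then -1 else 1.
  by elim: m => [//|m IH]; rewrite -tech_pow_Rmult IH /=; case: (odd m) => /=; ring.
have -> : (n.+1)./2 = (n./2 + odd n)%N by lia.
rewrite pow_add !hpow; move: h => /= /eqP <-.
by case: (odd n) => /=; ring.
Qed.

Lemma sqrt_INR_gt0 (n : nat) : 0 < sqrt (INR n.+1).
Proof. by apply: sqrt_lt_R0; apply: lt_0_INR; lia. Qed.

Lemma sqrt_INRS (n : nat) : sqrt (INR n.+1) * sqrt (INR n.+1) = sqrt (INR n) * sqrt (INR n) + 1.
Proof. by rewrite (sqrt_sqrt _ (pos_INR n.+1)) (sqrt_sqrt _ (pos_INR n)) S_INR. Qed.

Lemma sum_inv_sqrt (n : nat) : \Rsum_(0 <= m < n.+1) / sqrt (INR m) <= 2 * sqrt (INR n).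
Proof.
elim: n => [|n IH]; first by rewrite big_nat1 /= sqrt_0 Rinv_0; lra.
rewrite Rsum_S; have h := sqrt_INR_gt0 n; have h0 := sqrt_pos (INR n).
have e := sqrt_INRS n.
set x := sqrt (INR n.+1) in h e *; set y := sqrt (INR n) in IH h0 e.
suff : / x <= 2 * (x - y) by lra.
apply: (Rmult_le_reg_r x) => //; rewrite Rinv_l; nra.
Qed.

(** A crude bound that reproduces itself: the sum of [1 / sqrt m] up to [n] is at most [2 sqrt n],
    so each level costs a factor two. It still gives absolute convergence after one more division by
    [n]. *)
Lemma chain_bound (j n : nat) : Rabs (chain j n) <= 2 ^ j * / sqrt (INR n).
Proof.
elim: j n => [|j IH] [|n].
- by rewrite chain_at0 Rabs_R0 [INR 0]/= sqrt_0 Rinv_0 Rmult_0_r; apply: Rle_refl.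
- have h := sqrt_INR_gt0 n; have hi := Rinv_0_lt_compat _ h.
  rewrite /=; case: ifP => _; last by rewrite Rabs_R0 Rmult_1_l; apply: Rlt_le.
  rewrite -/(INR n.+1) /Rdiv Rabs_mult pow_1_abs !Rmult_1_l Rabs_pos_eq; last first.
    by apply/Rlt_le/Rinv_0_lt_compat/lt_0_INR; lia.
  apply: Rinv_le_contravar => //.
  rewrite -{2}(sqrt_sqrt (INR n.+1)); last exact: pos_INR.
  have : 1 <= sqrt (INR n.+1).
    rewrite -sqrt_1; apply: sqrt_le_1_alt; rewrite S_INR; have := pos_INR n; lra.
  nra.
- by rewrite chain_at0 Rabs_R0 [INR 0]/= sqrt_0 Rinv_0 Rmult_0_r; apply: Rle_refl.
have h := sqrt_INR_gt0 n; have hi := Rinv_0_lt_compat _ h.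
case hp : (odd n.+1 == odd j.+1); last first.
  rewrite chain_parity ?hp // Rabs_R0; apply: Rmult_le_pos; last lra.
  by apply: pow_le; lra.
have hn : 0 < INR n.+1 by apply: lt_0_INR; lia.
apply: (Rmult_le_reg_l (INR n.+1)) => //.
rewrite -{1}(Rabs_pos_eq (INR n.+1)); last lra.
rewrite -Rabs_mult chainS //; apply: Rle_trans (Rsum_abs _ _ _) _.
apply: Rle_trans (Rsum_le (fun i _ => IH i)) _.
rewrite -Rsum_scal; apply: Rle_trans.
  apply: Rmult_le_compat_l; [by apply: pow_le; lra | exact: sum_inv_sqrt].
apply: (Rle_trans _ (2 ^ j * (2 * sqrt (INR n.+1)))).
  apply: Rmult_le_compat_l; first by apply: pow_le; lra.
  apply: Rmult_le_compat_l; first lra.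
  by apply: sqrt_le_1_alt; rewrite S_INR; lra.
rewrite -tech_pow_Rmult; apply: Req_le.
have := sqrt_sqrt _ (Rlt_le _ _ hn).
move: (INR n.+1) (sqrt _) h => y x hx <-; field; lra.
Qed.

Lemma signed_chain_abs (j n : nat) : Rabs (signed_chain j n) = Rabs (chain j n).
Proof. by rewrite /signed_chain Rabs_mult pow_1_abs Rmult_1_l. Qed.

Lemma ex_series_telescope (a t : nat -> R) (l : R) :
  (forall n, Rabs (a n) <= t n - t n.+1) -> is_lim_seq t l -> ex_series a.
Proof.
move=> h ht; apply: (ex_series_le_abs h); exists (t 0%N - l).
apply/is_series_Rsum; apply: (is_lim_seq_ext (fun n => t 0%N - t n)).
  elim=> [|n IH]; first by rewrite Rsum0; ring.
  by rewrite Rsum_S -IH; ring.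
by apply: is_lim_seq_minus'; [exact: is_lim_seq_const | exact: ht].
Qed.

Lemma is_lim_seq_inv_sqrt : is_lim_seq (fun n => / sqrt (INR n)) 0.
Proof.
apply: (is_lim_seq_inv _ p_infty) => //.
apply: (filterlim_comp _ _ _ INR sqrt _ (Rbar_locally p_infty)); first exact: is_lim_seq_INR.
exact: filterlim_sqrt_p.
Qed.

Lemma ex_series_signed_chain (j : nat) :
  ex_series (fun n => Rabs (signed_chain j n / INR n)).
Proof.
apply/ex_series_incr_1/ex_series_incr_1.
(* With [N = n + 2], the bound [N ^ (-3/2)] is at most [2 (1 / sqrt (N - 1) - 1 / sqrt N)]; the
   terms [N = 0] and [N = 1] have been dropped so that [N - 1] is positive. *)
pose t n := 2 ^ j * 2 * / sqrt (INR n.+1).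
apply: (@ex_series_telescope _ t 0); last first.
  have -> : Finite 0 = Rbar_mult (2 ^ j * 2) 0 by rewrite /= Rmult_0_r.
  apply: is_lim_seq_scal_l; have := is_lim_seq_inv_sqrt; move/is_lim_seq_incr_1; exact.
move=> n; rewrite Rabs_Rabsolu /Rdiv Rabs_mult signed_chain_abs.
have hn : 0 < INR n.+2 by apply: lt_0_INR; lia.
rewrite (Rabs_pos_eq (/ _)); last by apply/Rlt_le/Rinv_0_lt_compat.
apply: Rle_trans (Rmult_le_compat_r _ _ _ _ (chain_bound j n.+2)) _.
  by apply/Rlt_le/Rinv_0_lt_compat.
rewrite /t -Rmult_minus_distr_l !Rmult_assoc; apply: Rmult_le_compat_l; first by apply: pow_le; lra.
rewrite -{2}(sqrt_sqrt (INR n.+2)); last lra.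
have := sqrt_INRS n.+1; have := sqrt_INR_gt0 n; have := sqrt_INR_gt0 n.+1.
move: (sqrt (INR n.+2)) (sqrt (INR n.+1)) => x y hx hy e.
have hxy : y < x by nra.
apply: (Rmult_le_reg_r (x * x * x * y)); first by repeat apply: Rmult_lt_0_compat.
have -> : / x * / (x * x) * (x * x * x * y) = y by field; lra.
have -> : 2 * (/ y - / x) * (x * x * x * y) = 2 * (x * x) * (x - y) by field; lra.
have : 1 = (x - y) * (x + y) by lra.
move=> e1; have : (x - y) * (2 * x) >= 1 by nra.
nra.
Qed.

Lemma CV_radius_signed_chain (j : nat) (x : R) : Rabs x < 1 ->
  Rbar_lt (Rabs x) (CV_radius (signed_chain j)).
Proof.
move=> hx; apply: (Rbar_lt_le_trans _ 1) => //.
have [h _] := CV_radius_bounded (signed_chain j); apply: h.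
exists (2 ^ j) => n; rewrite pow1 Rmult_1_r signed_chain_abs.
apply: Rle_trans (chain_bound _ _) _.
rewrite -[X in _ <= X]Rmult_1_r; apply: Rmult_le_compat_l; first by apply: pow_le; lra.
case: n => [|n]; first by rewrite sqrt_0 Rinv_0; lra.
rewrite -Rinv_1; apply: Rinv_le_contravar; first lra.
rewrite -sqrt_1; apply: sqrt_le_1_alt; rewrite S_INR; have := pos_INR n; lra.
Qed.

(** The recursion [signed_chain_rec] in differential form. Under [x = tan (t / 2)] each generating
    series becomes, up to sign and a factor two, the derivative of the next. *)
Lemma PSeries_signed_chain (j : nat) (x : R) : Rabs x < 1 ->
  (1 + x ^ 2) * PSeries (PS_derive (signed_chain j.+1)) x = (-1) ^ j * PSeries (signed_chain j) x.
Proof.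
move=> hx; set a := PS_derive _.
have ha : ex_pseries a x by apply: CV_radius_inside; rewrite CV_radius_derive; exact: CV_radius_signed_chain.
rewrite Rmult_plus_distr_r Rmult_1_l -PSeries_incr_n -PSeries_plus //; last exact: ex_pseries_incr_n.
rewrite -PSeries_scal; apply: PSeries_ext => n.
rewrite /PS_plus /PS_scal /plus /scal /mult /= /mult /=.
rewrite /a /PS_derive; case: n => [|[|n]].
- rewrite /signed_chain /= (chain_at0 j); case: ifP => _; rewrite ?big_nat1 ?chain_at0 /Rdiv /zero /=; by ring.
- by rewrite /= /zero /=; have := signed_chain_rec j 0; rewrite Rmult_0_l => ->; ring.
by have := signed_chain_rec j n.+1.
Qed.

(** At depth zero the two signs cancel and the derivative is the geometric series
    [x + x^3 + x^5 + ...]. *)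
Lemma PSeries_signed_chain0 (x : R) : Rabs x < 1 ->
  (1 - x ^ 2) * PSeries (PS_derive (signed_chain 0)) x = x.
Proof.
move=> hx; set a := PS_derive _.
have ha : ex_pseries a x by apply: CV_radius_inside; rewrite CV_radius_derive; exact: CV_radius_signed_chain.
have a1 n : a n = if odd n then 1 else 0.
  rewrite /a /PS_derive /signed_chain.
  rewrite [chain _ _]/=; case: (odd n) => /=; last by ring.
  rewrite -/(INR n.+1); set y := (-1) ^ _.
  have hy : y * y = 1 by rewrite -Rpow_mult_distr (_ : -1 * -1 = 1); [exact: pow1 | ring].
  by transitivity (y * y); [field; exact: not_0_INR | exact: hy].
have h : PSeries a x = x + x ^ 2 * PSeries a x.
  rewrite {1}PSeries_decr_1 // PSeries_decr_1; last first.
    by apply: CV_radius_inside; rewrite CV_radius_decr_1 CV_radius_derive; exact: CV_radius_signed_chain.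
  rewrite /PS_decr_1 !a1 (@PSeries_ext _ a) /=; first by ring.
  by move=> n; rewrite !a1 /= negbK.
lra.
Qed.

Lemma PSeries_signed_chain_log (x : R) : 0 <= x < 1 ->
  PSeries (signed_chain 0) x = - ln (1 - x ^ 2) / 2.
Proof.
move=> [hx0 hx1].
pose f y := PSeries (signed_chain 0) y + ln (1 - y ^ 2) / 2.
have df y : 0 <= y < 1 -> is_derive f y 0.
  move=> hy; have hy' : Rabs y < 1 by rewrite Rabs_pos_eq; lra.
  have -> : 0 = PSeries (PS_derive (signed_chain 0)) y + (- y / (1 - y ^ 2)).
    apply: (Rmult_eq_reg_l (1 - y ^ 2)); last nra.
    by rewrite Rmult_plus_distr_l PSeries_signed_chain0 //; field; nra.
  apply: (@is_derive_plus R_AbsRing).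
    by apply: is_derive_PSeries; exact: CV_radius_signed_chain.
  auto_derive; first nra.
  by field; nra.
have f0 : f 0 = 0.
  by rewrite /f PSeries_0 /signed_chain chain_at0 (_ : 1 - 0 ^ 2 = 1) ?ln_1; [field | ring].
suff : f x = 0 by rewrite /f; lra.
case: (Rle_lt_or_eq_dec _ _ hx0) => [hx|<- //].
have := @mvt_dist f (fun=> 0) 0 x 0 hx; rewrite f0 Rmult_0_l Rminus_0_r => h.
apply: Rabs_eq_0; apply: Rle_antisym; last exact: Rabs_pos.
by apply: h => z hz; [apply: df; lra | rewrite Rabs_R0; lra].
Qed.

(** * Sums over decreasing tuples and removal of the first entry *)

Definition chain_index (j N : nat) (n : {ffun 'I_j.+1 -> 'I_N.+1}) : bool :=
  [&& [forall i : 'I_j.+1, forall k : 'I_j.+1, (i < k)%N ==> (n k < n i)%N],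
      [forall i, (0 < n i)%N]
    & [forall i : 'I_j.+1, odd (n i) == odd (i + j)]].

Definition chain_term (j N : nat) (n : {ffun 'I_j.+1 -> 'I_N.+1}) : R :=
  (-1) ^ (n ord_max)./2 * / (\big[Rmult/R1]_i INR (n i)).

Definition ffun_cons (j N : nat) (p : 'I_N.+1 * {ffun 'I_j.+1 -> 'I_N.+1}) :
    {ffun 'I_j.+2 -> 'I_N.+1} :=
  [ffun i => if unlift ord0 i is Some k then p.2 k else p.1].

Lemma ffun_cons0 j N (p : 'I_N.+1 * {ffun 'I_j.+1 -> 'I_N.+1}) : ffun_cons p ord0 = p.1.
Proof. by rewrite ffunE unlift_none. Qed.

Lemma ffun_consS j N (p : 'I_N.+1 * {ffun 'I_j.+1 -> 'I_N.+1}) i :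
  ffun_cons p (lift ord0 i) = p.2 i.
Proof. by rewrite ffunE liftK. Qed.

Lemma ffun_cons_bij j N : bijective (@ffun_cons j N).
Proof.
exists (fun n : {ffun 'I_j.+2 -> 'I_N.+1} => (n ord0, [ffun k => n (lift ord0 k)])).
  move=> [m n]; rewrite ffun_cons0 /=; congr pair; apply/ffunP => i.
  by rewrite ffunE ffun_consS.
move=> n; apply/ffunP => i; case: (unliftP ord0 i) => [k ->|->].
  by rewrite ffun_consS ffunE.
by rewrite ffun_cons0.
Qed.

Lemma forall_ord_cons (k : nat) (P : pred 'I_k.+1) :
  [forall i, P i] = P ord0 && [forall i : 'I_k, P (lift ord0 i)].
Proof.
apply/forallP/andP => [h|[h0 /forallP h] i].
  by split; [exact: h | apply/forallP => i; exact: h].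
by case: (unliftP ord0 i) => [j ->|->].
Qed.

(** Parities are counted from the last entry, which is even, whence [i + j] in [chain_index]:
    removing the first entry gives the same condition with [j] lowered by one. As the tail
    decreases, only its first entry has to be compared with the removed one. *)
Lemma chain_index_cons j N (p : 'I_N.+1 * {ffun 'I_j.+1 -> 'I_N.+1}) :
  chain_index (ffun_cons p) =
  [&& odd p.1 == odd j.+1, (p.2 ord0 < p.1)%N & chain_index p.2].
Proof.
rewrite /chain_index [X in X && (_ && _)]forall_ord_cons [X in _ && (X && _)]forall_ord_cons.
rewrite [X in _ && (_ && X)]forall_ord_cons [X in (X && _) && _]forall_ord_cons ffun_cons0 add0n ltnn implyFb andTb.
have -> : [forall i : 'I_j.+1, ((ord0 : 'I_j.+2) < lift ord0 i)%N ==> (ffun_cons p (lift ord0 i) < p.1)%N] =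
    [forall i, (p.2 i < p.1)%N].
  by apply: eq_forallb => i; rewrite ffun_consS lift0.
have -> : [forall i : 'I_j.+1, (0 < ffun_cons p (lift ord0 i))%N] = [forall i, (0 < p.2 i)%N].
  by apply: eq_forallb => i; rewrite ffun_consS.
have -> : [forall i : 'I_j.+1, odd (ffun_cons p (lift ord0 i)) == odd (lift ord0 i + j.+1)] =
    [forall i : 'I_j.+1, odd (p.2 i) == odd (i + j)].
  apply: eq_forallb => i; rewrite ffun_consS lift0 addSnnS; congr (_ == _).
  by rewrite addnS /= addnS /= negbK.
set A := [forall i : 'I_j.+1, [forall k : 'I_j.+2, _]].
have -> : A = [forall i : 'I_j.+1, forall k : 'I_j.+1, (i < k)%N ==> (p.2 k < p.2 i)%N].
  apply: eq_forallb => i; rewrite forall_ord_cons ltn0 implyFb andTb.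
  by apply: eq_forallb => k; rewrite !ffun_consS !lift0 ltnS.
case hA' : [forall i, forall k, _]; last by rewrite !(andbF, andFb).
have hlt : [forall i, (p.2 i < p.1)%N] = (p.2 ord0 < p.1)%N.
  apply/forallP/idP => [h|h i]; first exact: h.
  case: (posnP i) => hi; first by rewrite (_ : i = ord0) //; apply/val_inj.
  by apply: ltn_trans h; move/forallP: hA' => /(_ ord0) /forallP /(_ i) /implyP; exact.
rewrite hlt; case h : (p.2 ord0 < p.1)%N; last by rewrite !(andbF, andFb).
by rewrite (leq_ltn_trans _ h) //= andbCA.
Qed.

(** Tuples with first entry [m] are sorted by their second entry, which reproduces the recursion
    defining [chain]. *)
Lemma sum_chain_term (j N : nat) (m : 'I_N.+1) :
  \big[Rplus/R0]_(n : {ffun 'I_j.+1 -> 'I_N.+1} | chain_index n && (n ord0 == m)) chain_term n =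
  chain j m.
Proof.
elim: j m => [|j IH] m.
  pose n0 : {ffun 'I_1 -> 'I_N.+1} := [ffun => m].
  have hn0 (n : {ffun 'I_1 -> 'I_N.+1}) : (n ord0 == m) = (n == n0).
    apply/eqP/eqP => [h|->]; last by rewrite ffunE.
    by apply/ffunP => i; rewrite ffunE (ord1 i).
  have hi : chain_index n0 = (0 < m)%N && ~~ odd m.
    rewrite /chain_index; apply/and3P/andP => [[_ /forallP h1 /forallP h2]|[h1 h2]].
      by have := h1 ord0; have := h2 ord0; rewrite !ffunE /= eqbF_neg.
    split.
    - by apply/forallP => i; apply/forallP => k; rewrite (ord1 i) (ord1 k).
    - by apply/forallP => i; rewrite ffunE.
    - by apply/forallP => i; rewrite ffunE (ord1 i) /= eqbF_neg.
  rewrite (eq_bigl (fun n => chain_index n0 && (n == n0))); last first.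
    by move=> n /=; rewrite hn0; case: eqP => [->|]; rewrite ?andbF.
  case h : (chain_index n0).
    rewrite (big_pred1 n0) // /chain_term big_ord1 !ffunE.
    move: h; rewrite hi /= eqbF_neg => /andP [_ ->] //.
  rewrite big_pred0 //; move: h; rewrite hi /= eqbF_neg.
  case: (odd m) => //=; rewrite andbT; case: (posnP m) => // -> _.
  by rewrite /Rdiv /= Rinv_0 Rmult_0_r.
rewrite (reindex (@ffun_cons j N)); last exact: onW_bij (ffun_cons_bij j N).
case hp : (odd m == odd j.+1); last first.
  rewrite (@chain_parity j.+1) ?hp // big_pred0 // => p; rewrite chain_index_cons ffun_cons0.
  by case: (p.1 =P m) => [->|]; rewrite ?hp ?andbF.
transitivity (\big[Rplus/R0]_(p : 'I_N.+1 * {ffun 'I_j.+1 -> 'I_N.+1} | (p.1 == m) && ((p.2 ord0 < p.1)%N && chain_index p.2))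
    chain_term (@ffun_cons j N (p.1, p.2))).
  apply: eq_big => [p|[a b] _ //]; rewrite chain_index_cons ffun_cons0 [RHS]andbC.
  by case: (p.1 =P m) => [->|]; rewrite ?hp ?andbF.
rewrite -(pair_big_dep (pred1 m) (fun a (b : {ffun 'I_j.+1 -> 'I_N.+1}) => (b ord0 < a)%N && chain_index b)
  (fun a b => chain_term (@ffun_cons j N (a, b)))) (big_pred1 m) //.
have hterm (n : {ffun 'I_j.+1 -> 'I_N.+1}) : chain_term (ffun_cons (m, n)) = / INR m * chain_term n.
  rewrite /chain_term big_ord_recl ffun_cons0 /=.
  rewrite (eq_bigr (fun i => INR (n i))); last by move=> i _; rewrite ffun_consS.
  have -> : ord_max = lift ord0 (ord_max : 'I_j.+1) by apply/val_inj.
  by rewrite ffun_consS Rinv_mult /=; ring.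
rewrite (eq_bigr _ (fun n _ => hterm n)) -(big_distrr (R := R) (plus := Rplus)) /=.
rewrite (partition_big (fun n : {ffun 'I_j.+1 -> 'I_N.+1} => n ord0) (fun k => (k < m)%N)) /=; last first.
  by move=> n /andP [].
rewrite /Rdiv Rmult_comm; move: hp => /= ->; congr (_ * _).
rewrite big_mkord (big_ord_widen N.+1 (chain j)); last exact: ltnW.
apply: eq_bigr => k hk; rewrite -IH; apply: eq_bigl => n.
by case: (n ord0 =P k) => [->|]; rewrite ?andbF // hk.
Qed.

(** The square on [n_1] and the sign [(-1)^(n_1/2)] are all that separates [S_term] from
    [chain_term]. Since [2 * l] is even, parities counted from either end agree. *)
Lemma S_partial_chain (l N : nat) :
  S_partial l N = 2 ^ (2 * l + 1) * (\Rsum_(0 <= n < N.+1) (signed_chain (2 * l) n / INR n)).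
Proof.
rewrite /S_partial; congr (_ * _).
rewrite (partition_big (fun n : {ffun 'I_(2 * l).+1 -> 'I_N.+1} => n ord0) predT) //= big_mkord.
apply: eq_bigr => m _; rewrite /signed_chain -sum_chain_term.
rewrite [RHS](_ : _ = (-1) ^ m./2 * / INR m * \big[Rplus/R0]_(n : {ffun 'I_(2 * l).+1 -> 'I_N.+1} |
  chain_index n && (n ord0 == m)) chain_term n); last by rewrite /Rdiv; ring.
rewrite (big_distrr (R := R) (plus := Rplus)) /=.
apply: eq_big => n.
  congr (_ && _); rewrite /S_index /chain_index; congr [&& _, _ & _].
  by apply: eq_forallb => i; rewrite oddD oddM addbF.
move=> /andP [_ /eqP hm]; rewrite /S_term /chain_term [in RHS](bigD1 (ord0 : 'I_(2 * l).+1)) //= hm.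
by rewrite /Rdiv Rmult_1_r !Rinv_mult; ring.
Qed.

Lemma is_lim_S_partial (l : nat) :
  is_lim_seq (S_partial l) (2 ^ (2 * l + 1) * Series (fun n => signed_chain (2 * l) n / INR n)).
Proof.
apply: (is_lim_seq_ext (fun N => 2 ^ (2 * l + 1) *
    (\Rsum_(0 <= n < N.+1) (signed_chain (2 * l) n / INR n)))).
  by move=> N; rewrite S_partial_chain.
apply: (is_lim_seq_scal_l _ _ (Finite _)).
have := ex_series_Rsum (ex_series_Rabs _ (ex_series_signed_chain (2 * l))).
by move/is_lim_seq_incr_1.
Qed.

Lemma S_valueE (l : nat) :
  S_value l = 2 ^ (2 * l + 1) * Series (fun n => signed_chain (2 * l) n / INR n).
Proof. by rewrite /S_value (is_lim_seq_unique _ _ (@is_lim_S_partial l)). Qed.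

(** * Fourier series of the iterated integrals *)

Lemma cos_half_gt0 (b x : R) : b < PI -> 0 <= x <= b -> 0 < cos (b / 2) <= cos (x / 2).
Proof.
move=> hb hx; have := PI_RGT_0 => hpi; split; first by apply: cos_gt_0; lra.
by apply: cos_decr_1; lra.
Qed.

Lemma tan_half_range (x : R) : 0 <= x < PI / 2 -> 0 <= tan (x / 2) < 1.
Proof.
move=> hx; have := PI_RGT_0 => hpi; split.
  case: (Rle_lt_or_eq_dec 0 x (proj1 hx)) => [h|<-].
    by apply/Rlt_le/tan_gt_0; lra.
  by rewrite (_ : 0 / 2 = 0) ?tan_0; lra.
by rewrite -tan_PI4; apply: tan_increasing; lra.
Qed.

Lemma tan_half_cos (x : R) : 0 <= x < PI / 2 -> 0 < cos (x / 2).
Proof. by move=> hx; have := PI_RGT_0 => hpi; apply: cos_gt_0; lra. Qed.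

Lemma is_derive_tan_half (x : R) : 0 <= x < PI / 2 ->
  is_derive (fun y => tan (y / 2)) x ((1 + tan (x / 2) ^ 2) / 2).
Proof.
move=> hx; have hc := tan_half_cos hx.
rewrite /tan; auto_derive; first by move: hc; rewrite /Rdiv; lra.
have := sin2_cos2 (x / 2); rewrite /Rsqr /Rdiv => h; rewrite /Rdiv in hc.
field; lra.
Qed.

(* Up to sign, the [j]-fold iterated integral of [-ln (cos x) + 2 ln (cos (x / 2))]. *)
Definition angle_chain (j : nat) (x : R) : R :=
  2 ^ j.+1 * PSeries (signed_chain j) (tan (x / 2)).

(** The derivative of [tan (x / 2)] is half of the factor [1 + tan^2] occurring in
    [PSeries_signed_chain]; the remaining [1/2] is absorbed by the normalisation [2 ^ j.+1]. *)
Lemma is_derive_angle_chain (j : nat) (x : R) : 0 <= x < PI / 2 ->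
  is_derive (angle_chain j.+1) x ((-1) ^ j * angle_chain j x).
Proof.
move=> hx; have [h0 h1] := tan_half_range hx.
have hu : Rabs (tan (x / 2)) < 1 by rewrite Rabs_pos_eq.
have -> : (-1) ^ j * angle_chain j x =
   2 ^ j.+2 * ((1 + tan (x / 2) ^ 2) / 2 * PSeries (PS_derive (signed_chain j.+1)) (tan (x / 2))).
  have := PSeries_signed_chain j hu; rewrite /angle_chain => h.
  rewrite (_ : (-1) ^ j * _ = 2 ^ j.+1 * ((-1) ^ j * PSeries (signed_chain j) (tan (x / 2)))); last by ring.
  by rewrite -h -(tech_pow_Rmult 2 j.+1); field.
apply: is_derive_scal; apply: (is_derive_comp (PSeries (signed_chain j.+1)) (fun y => tan (y / 2))).
  by apply: is_derive_PSeries; exact: CV_radius_signed_chain.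
exact: is_derive_tan_half.
Qed.

Lemma angle_chain_at0 (j : nat) : angle_chain j 0 = 0.
Proof.
rewrite /angle_chain (_ : 0 / 2 = 0); last by field.
by rewrite tan_0 PSeries_0 /signed_chain chain_at0 !Rmult_0_r.
Qed.

Lemma angle_chain0 (x : R) : 0 <= x < PI / 2 ->
  angle_chain 0 x = - ln (cos (2 * x / 2)) + 2 * ln (cos (x / 2)).
Proof.
move=> hx; rewrite /angle_chain PSeries_signed_chain_log; last exact: tan_half_range.
have hc := tan_half_cos hx; have hpi := PI_RGT_0.
have hc2 : 0 < cos (2 * x / 2).
  by rewrite (_ : 2 * x / 2 = x); [apply: cos_gt_0; lra | field].
have -> : 1 - tan (x / 2) ^ 2 = cos (2 * x / 2) / (cos (x / 2) * cos (x / 2)).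
  rewrite (_ : 2 * x / 2 = 2 * (x / 2)); last by field.
  by rewrite cos_2a /tan; field; lra.
rewrite ln_div // ?ln_mult //; last exact: Rmult_lt_0_compat.
by field.
Qed.

Lemma sum_sin_alternating (M : nat) (x : R) :
  2 * cos (x / 2) * (\Rsum_(0 <= n < M) ((-1) ^ n * sin (INR n.+1 * x))) =
  sin (x / 2) - (-1) ^ M * sin ((INR M + / 2) * x).
Proof.
elim: M => [|M IH].
  rewrite Rsum0 /= (_ : (0 + / 2) * x = x / 2); last by field.
  by ring.
rewrite Rsum_S Rmult_plus_distr_l IH !S_INR -tech_pow_Rmult.
set a := (INR M + 1) * x.
rewrite (_ : (INR M + / 2) * x = a - x / 2); last by rewrite /a; field.
rewrite (_ : (INR M + 1 + / 2) * x = a + x / 2); last by rewrite /a; field.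
by rewrite sin_minus sin_plus; ring.
Qed.

(** By [sum_sin_alternating] the derivative of the error is exactly [(-1)^M sin ((M + 1/2) x) / (2
    cos (x / 2))], a pure oscillation whose amplitude is smooth away from [PI]. *)
Lemma log_cos_fourier (b : R) : 0 < b < PI -> exists K, forall M x, 0 < x < b ->
  Rabs (- ln (cos (x / 2)) -
    (\Rsum_(0 <= n < M) ((-1) ^ n.+1 * ((cos (INR n.+1 * x) - 1) / INR n.+1)))) <= K / (INR M + / 2).
Proof.
move=> [hb0 hb]; have hcb : 0 < cos (b / 2) by have := @cos_half_gt0 b b hb; lra.
(* The value [2 A + B b] of [oscillation_bound], with the generous bounds [A = 1 / cos (b / 2)] for
   the amplitude and [B = A^2] for its derivative. *)
exists (2 * (/ cos (b / 2)) + (/ (cos (b / 2) ^ 2)) * b) => M x hx.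
have hl : 0 < INR M + / 2 by have := pos_INR M; lra.
pose f x := - ln (cos (x / 2)) -
    \Rsum_(0 <= n < M) ((-1) ^ n.+1 * ((cos (INR n.+1 * x) - 1) / INR n.+1)).
pose g x := (-1) ^ M * (/ 2 * / cos (x / 2)).
pose dg x := (-1) ^ M * (/ 4 * sin (x / 2) / cos (x / 2) ^ 2).
have hd y : 0 <= y < b -> is_derive f y (0 + g y * sin ((INR M + / 2) * y + 0)).
  move=> hy; have hc : 0 < cos (y / 2) by have := @cos_half_gt0 b y hb; lra.
  have -> : 0 + g y * sin ((INR M + / 2) * y + 0) =
     / 2 * (sin (y / 2) / cos (y / 2)) - \Rsum_(0 <= n < M) ((-1) ^ n.+1 * (- sin (INR n.+1 * y))).
    have -> : \Rsum_(0 <= n < M) ((-1) ^ n.+1 * (- sin (INR n.+1 * y))) =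
        \Rsum_(0 <= n < M) ((-1) ^ n * sin (INR n.+1 * y)).
      by apply: Rsum_ext => n _; rewrite -tech_pow_Rmult; ring.
    have := sum_sin_alternating M y; set s := \Rsum_(_ <= _ < _) _ => h.
    have -> : s = (sin (y / 2) - (-1) ^ M * sin ((INR M + / 2) * y)) / (2 * cos (y / 2)).
      by rewrite -h; field; lra.
    rewrite /g Rplus_0_r; field; lra.
  apply: (@is_derive_minus R_AbsRing).
    auto_derive; first by move: hc; rewrite /Rdiv.
    by rewrite /Rdiv in hc *; field; lra.
  apply: (@is_derive_Rsum M (fun n x => (-1) ^ n.+1 * ((cos (INR n.+1 * x) - 1) / INR n.+1))
    (fun n x => (-1) ^ n.+1 * (- sin (INR n.+1 * x)))) => n _.
  apply: is_derive_scal; auto_derive => //.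
  by rewrite -/(INR n.+1); field; exact: not_0_INR.
have f0 : f 0 = 0.
  rewrite /f (_ : 0 / 2 = 0) ?cos_0 ?ln_1; last by field.
  rewrite Rsum_const0; first by ring.
  by move=> n _; rewrite Rmult_0_r cos_0 Rminus_eq_0 /Rdiv; ring.
have hf : continuity_pt f 0.
  apply: derivable_continuous_pt; eexists; apply/is_derive_Reals; apply: hd; lra.
have hrange y : 0 < y < b -> 0 < cos (b / 2) <= cos (y / 2) by move=> hy; apply: cos_half_gt0; lra.
have hinv y : 0 < y < b -> 0 < / cos (y / 2) <= / cos (b / 2).
  move=> hy; have := hrange y hy => h; split; first by apply: Rinv_0_lt_compat; lra.
  by apply: Rinv_le_contravar; lra.
have := @oscillation_bound f (fun=> 0) g dg b (/ cos (b / 2)) (/ (cos (b / 2) ^ 2)) 0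
  (INR M + / 2) 0 hl f0 hf (fun y hy => hd y (conj (Rlt_le _ _ (proj1 hy)) (proj2 hy))) _ _ _ _ x hx.
rewrite Rmult_0_l Rplus_0_l; apply.
- move=> y hy; have := hrange y hy => h; rewrite /g /dg; apply: is_derive_scal.
  auto_derive; first by rewrite /Rdiv in h; lra.
  by rewrite /Rdiv in h *; field; lra.
- by move=> y hy; rewrite Rabs_R0; lra.
- move=> y hy; have := hinv y hy => h; rewrite /g Rabs_mult pow_1_abs Rmult_1_l Rabs_pos_eq; lra.
move=> y hy; have := hinv y hy => h; rewrite /dg Rabs_mult pow_1_abs Rmult_1_l.
have -> : / 4 * sin (y / 2) / cos (y / 2) ^ 2 = / 4 * sin (y / 2) * (/ cos (y / 2) * / cos (y / 2)).
  by rewrite /Rdiv /= Rmult_1_r Rinv_mult.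
have -> : / cos (b / 2) ^ 2 = / cos (b / 2) * / cos (b / 2) by rewrite /= Rmult_1_r Rinv_mult.
rewrite Rabs_mult (Rabs_pos_eq (/ cos _ * _)); last by nra.
have : Rabs (/ 4 * sin (y / 2)) <= 1 by apply: Rabs_le; have := SIN_bound (y / 2); lra.
have := Rabs_pos (/ 4 * sin (y / 2)).
move: h; set p := / cos (y / 2); set q := / cos (b / 2); set r := Rabs _ => - [h1 h2] h3 h4.
have : p * p <= q * q by nra.
have : 0 <= p * p by nra.
nra.
Qed.

(** Up to sign, the [2l]-fold primitive of [(cos (lam x) - 1) / lam], every integration starting at
    [0]. *)
Definition cos_kernel (l : nat) (lam x : R) : R := cos_rem l (lam * x) / lam ^ (2 * l).+1.
Definition sin_kernel (l : nat) (lam x : R) : R := sin_rem l (lam * x) / lam ^ (2 * l).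

Lemma is_derive_cos_kernel l lam x : 0 < lam ->
  is_derive (cos_kernel l lam) x (- sin_kernel l lam x).
Proof.
move=> hl; have h : lam ^ (2 * l) <> 0 by apply: pow_nonzero; lra.
rewrite /cos_kernel /sin_kernel.
have -> : - (sin_rem l (lam * x) / lam ^ (2 * l)) =
    (lam * - sin_rem l (lam * x)) * / lam ^ (2 * l).+1.
  by rewrite -tech_pow_Rmult; field; lra.
apply: (is_derive_ext (fun y => / lam ^ (2 * l).+1 * cos_rem l (lam * y))).
  by move=> t; rewrite /Rdiv Rmult_comm.
rewrite [_ * / _]Rmult_comm; apply: is_derive_scal.
apply: (is_derive_comp (cos_rem l) (fun y => lam * y)); first exact: is_derive_cos_rem.
by auto_derive => //; ring.
Qed.

Lemma is_derive_sin_kernel l lam x : 0 < lam ->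
  is_derive (sin_kernel l.+1 lam) x (cos_kernel l lam x).
Proof.
move=> hl; have h : lam ^ (2 * l) <> 0 by apply: pow_nonzero; lra.
rewrite /cos_kernel /sin_kernel (_ : (2 * l.+1)%N = (2 * l).+2); last by lia.
have -> : cos_rem l (lam * x) / lam ^ (2 * l).+1 =
    (lam * cos_rem l (lam * x)) * / lam ^ (2 * l).+2.
  by rewrite -!tech_pow_Rmult; field; lra.
apply: (is_derive_ext (fun y => / lam ^ (2 * l).+2 * sin_rem l.+1 (lam * y))).
  by move=> t; rewrite /Rdiv Rmult_comm.
rewrite [_ * / _]Rmult_comm; apply: is_derive_scal.
apply: (is_derive_comp (sin_rem l.+1) (fun y => lam * y)); first exact: is_derive_sin_rem.
by auto_derive => //; ring.
Qed.

Lemma cos_kernel_at0 l lam : cos_kernel l lam 0 = 0.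
Proof. by rewrite /cos_kernel Rmult_0_r cos_rem_at0 /Rdiv; ring. Qed.

Lemma sin_kernel_at0 l lam : sin_kernel l lam 0 = 0.
Proof. by rewrite /sin_kernel Rmult_0_r sin_rem_at0 /Rdiv; ring. Qed.

Lemma is_derive_continuity_pt (f : R -> R) (x df : R) : is_derive f x df -> continuity_pt f x.
Proof. by move=> h; apply: derivable_continuous_pt; exists df; apply/is_derive_Reals. Qed.

(** Integrated Fourier term of index [n + 1]: the frequency [2 (n + 1)] comes from [ln (cos x)] and
    the frequency [n + 1] from [ln (cos (x / 2))]. *)
Definition chain_kernel (l n : nat) (x : R) : R :=
  2 * (-1) ^ n.+1 * (cos_kernel l (2 * INR n.+1) x - cos_kernel l (INR n.+1) x).
Definition chain_kernel' (l n : nat) (x : R) : R :=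
  2 * (-1) ^ n.+1 * (sin_kernel l (2 * INR n.+1) x - sin_kernel l (INR n.+1) x).

Lemma is_lim_seq_const_div (K a : R) : is_lim_seq (fun M => K / (INR M + a)) 0.
Proof.
have -> : Finite 0 = Rbar_mult K 0 by rewrite /= Rmult_0_r.
apply: (is_lim_seq_scal_l (fun M => / (INR M + a))).
apply: (is_lim_seq_inv _ p_infty) => //.
apply: (is_lim_seq_plus _ _ p_infty a) => //; [exact: is_lim_seq_INR | exact: is_lim_seq_const].
Qed.

(** For [l = 0] the error is [O(1 / M)] uniformly on [(0, b)]. Both sides are then integrated from
    [0] in the same way, so [iterated_primitive_bound] preserves the rate. *)
Lemma angle_chain_fourier (l : nat) (x : R) : 0 < x < PI / 2 ->
  is_lim_seq (fun M => \Rsum_(0 <= n < M) chain_kernel l n x) (angle_chain (2 * l) x).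
Proof.
(* Any [b] strictly between [x] and [PI / 2] serves: both [y] and [2 y] then stay below
   [2 b < PI]. *)
move=> [hx0 hx]; pose b := (x + PI / 2) / 2.
have hb : x < b < PI / 2 by rewrite /b; lra.
have [K hK] := @log_cos_fourier (2 * b) (ltac:(lra)).
(* The constant [3 K] is [K] for the logarithm at [2 y] plus [2 K] for the one at [y], which has
   coefficient two. *)
apply: (@is_lim_seq_dom _ (fun M => (3 * K * b ^ (2 * l)) / (INR M + / 2))); last exact: is_lim_seq_const_div.
move=> M; rewrite Rabs_minus_sym.
have hN n : 0 < INR n.+1 by apply: lt_0_INR; lia.
have hM : 0 < INR M + / 2 by have := pos_INR M; lra.
pose C l x := angle_chain (2 * l) x - \Rsum_(0 <= n < M) chain_kernel l n x.
pose S l x := angle_chain (2 * l).-1 x - \Rsum_(0 <= n < M) chain_kernel' l n x.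
have hC k y : 0 <= y < b -> is_derive (C k.+1) y (- S k.+1 y).
  move=> hy; rewrite /C /S (_ : (2 * k.+1)%N = (2 * k).+2); last by lia.
  have -> : - (angle_chain (2 * k).+2.-1 y - \Rsum_(0 <= n < M) chain_kernel' k.+1 n y) =
    (-1) ^ (2 * k).+1 * angle_chain (2 * k).+1 y - \Rsum_(0 <= n < M) (- chain_kernel' k.+1 n y).
    by rewrite -Rsum_opp -tech_pow_Rmult pow_mult (_ : (-1) ^ 2 = 1) ?pow1; [rewrite /=; ring | ring].
  apply: (@is_derive_minus R_AbsRing); first by apply: is_derive_angle_chain; lra.
  apply: (@is_derive_Rsum M (chain_kernel k.+1) (fun n x => - chain_kernel' k.+1 n x)) => n _.
  rewrite /chain_kernel /chain_kernel'.
  rewrite (_ : - _ = 2 * (-1) ^ n.+1 * (- sin_kernel k.+1 (2 * INR n.+1) y - (- sin_kernel k.+1 (INR n.+1) y))); last by ring.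
  apply: is_derive_scal; apply: (@is_derive_minus R_AbsRing); apply: is_derive_cos_kernel => //.
  by have := hN n; lra.
have hS k y : 0 <= y < b -> is_derive (S k.+1) y (C k y).
  move=> hy; rewrite /C /S (_ : (2 * k.+1)%N = (2 * k).+2); last by lia.
  have -> : angle_chain (2 * k) y = (-1) ^ (2 * k) * angle_chain (2 * k) y.
    by rewrite pow_mult (_ : (-1) ^ 2 = 1) ?pow1; ring.
  apply: (@is_derive_minus R_AbsRing); first by apply: is_derive_angle_chain; lra.
  apply: (@is_derive_Rsum M (chain_kernel' k.+1) (chain_kernel k)) => n _.
  rewrite /chain_kernel /chain_kernel'.
  apply: is_derive_scal; apply: (@is_derive_minus R_AbsRing); apply: is_derive_sin_kernel => //.
  by have := hN n; lra.
have := @iterated_primitive_bound C S b (3 * K / (INR M + / 2)) _ _ _ _ _ l x.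
have -> : 3 * K / (INR M + / 2) * b ^ (2 * l) = 3 * K * b ^ (2 * l) / (INR M + / 2) by field; lra.
case=> //; last by lra.
- move=> k; split; rewrite /C /S angle_chain_at0 Rsum_const0; try by ring.
    by move=> n _; rewrite /chain_kernel !cos_kernel_at0; ring.
  by move=> n _; rewrite /chain_kernel' !sin_kernel_at0; ring.
- by move=> k; split; [apply: is_derive_continuity_pt (hC k 0 _) | apply: is_derive_continuity_pt (hS k 0 _)]; lra.
- by move=> k y hy; apply: hC; lra.
- by move=> k y hy; apply: hS; lra.
move=> y hy.
have h1 := hK M y (ltac:(lra)); have h2 := hK M (2 * y) (ltac:(lra)).
set s1 := \Rsum_(_ <= _ < _) _ in h1; set s2 := \Rsum_(_ <= _ < _) _ in h2.
have -> : C 0%N y = (- ln (cos (2 * y / 2)) - s2) - 2 * (- ln (cos (y / 2)) - s1).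
  rewrite /C muln0 angle_chain0; last lra.
  suff -> : \Rsum_(0 <= n < M) chain_kernel 0 n y = s2 - 2 * s1 by ring.
  rewrite /s1 /s2 Rsum_scal -Rsum_minus; apply: Rsum_ext => n _.
  rewrite /chain_kernel /cos_kernel !cos_rem0 (_ : INR n.+1 * (2 * y) = 2 * INR n.+1 * y); last by ring.
  by rewrite muln0 !pow_1; field; have := hN n; lra.
move: h1 h2; rewrite (_ : 3 * K / (INR M + / 2) = 3 * (K / (INR M + / 2))); last by rewrite /Rdiv; ring.
move: (K / _) (_ - s1) (_ - s2) => q a c /Rabs_le_between h1 /Rabs_le_between h2.
by apply: Rabs_le; lra.
Qed.

(** * Expansion against the cosecant *)

Lemma ex_series_alternating (u : nat -> R) :
  (forall k, 0 <= u k) -> (forall k, u k.+1 <= u k) -> is_lim_seq u 0 ->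
  ex_series (fun k => (-1) ^ k * u k).
Proof.
move=> u0 ud ul.
have [l hl] : ex_finite_lim_seq (fun n => \Rsum_(0 <= k < n) ((-1) ^ k * u k)).
  apply/ex_lim_seq_cauchy_corr => e.
  have [N hN] := (is_lim_seq_eps u 0).1 ul _ (cond_pos e).
  have h n m : (N <= n)%N -> (n <= m)%N ->
      Rabs ((\Rsum_(0 <= k < n) ((-1) ^ k * u k)) - \Rsum_(0 <= k < m) ((-1) ^ k * u k)) < e.
    move=> hn hm; rewrite (@Rsum_cat 0 n m) //.
    have := alternating_bound n m u0 ud; have := hN n hn; have := u0 n.
    rewrite Rminus_0_r; set s := \Rsum_(0 <= _ < n) _; set t := \Rsum_(_ <= _ < _) _ => h1 h2 h3.
    rewrite (_ : s - (s + t) = - t); last by ring.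
    by rewrite Rabs_Ropp; have := Rle_abs (u n); lra.
  exists N => n m /leP hn /leP hm; case: (leqP n m) => hnm; first exact: h.
  by rewrite Rabs_minus_sym; apply: h => //; exact: ltnW.
by exists l; apply/is_series_Rsum.
Qed.

Lemma is_lim_seq_inv_affine (a b : nat) : (0 < a)%N ->
  is_lim_seq (fun n => / INR (a * n + b)%N) 0.
Proof.
move=> ha; apply/is_lim_seq_eps => e he.
have [N hN] := (is_lim_seq_eps _ _).1 (is_lim_seq_const_div 1 0) e he.
exists N.+1 => n hn; have h := hN n (ltnW hn).
rewrite Rminus_0_r Rplus_0_r in h; rewrite Rminus_0_r.
have hn0 : 0 < INR n by apply: lt_0_INR; lia.
have hle : INR n <= INR (a * n + b)%N by apply: le_INR; apply/leP; nia.
have h1 : / INR (a * n + b)%N <= / INR n by apply: Rinv_le_contravar.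
have h2 := Rinv_0_lt_compat _ (Rlt_le_trans _ _ _ hn0 hle).
rewrite Rabs_pos_eq; last lra.
have := Rle_abs (1 / INR n); rewrite /Rdiv Rmult_1_l in h *; lra.
Qed.

Lemma inv_pow_le (x : R) (s t : nat) : 1 <= x -> (s <= t)%N -> 0 < / x ^ t <= / x ^ s.
Proof.
move=> hx hst; have h0 : 0 < x ^ s by apply: pow_lt; lra.
split; first by apply/Rinv_0_lt_compat/pow_lt; lra.
by apply: Rinv_le_contravar => //; apply: Rle_pow => //; apply/leP.
Qed.

Lemma INR_ge1 (n : nat) : (0 < n)%N -> 1 <= INR n.
Proof. by move=> h; rewrite -[1]/(INR 1); apply: le_INR; apply/leP. Qed.

Lemma inv_pow_decr (x y : R) (s : nat) : 1 <= x <= y -> 0 < / y ^ s <= / x ^ s.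
Proof.
move=> hx; split; first by apply/Rinv_0_lt_compat/pow_lt; lra.
by apply: Rinv_le_contravar; [apply: pow_lt; lra | apply: pow_incr; lra].
Qed.

Lemma ex_series_alternating_affine (a b s : nat) : (0 < a)%N -> (0 < b)%N -> (0 < s)%N ->
  ex_series (fun k => (-1) ^ k * / INR (a * k + b)%N ^ s).
Proof.
move=> ha hb hs; have h1 k : 1 <= INR (a * k + b)%N by apply: INR_ge1; lia.
apply: ex_series_alternating => [k|k|].
- by apply/Rlt_le/Rinv_0_lt_compat/pow_lt; have := h1 k; lra.
- apply: (inv_pow_decr _ _).2; split=> //; apply: le_INR; lia.
apply: (@is_lim_seq_dom _ (fun k => / INR (a * k + b)%N)); last exact: is_lim_seq_inv_affine.
move=> k; have := inv_pow_le (h1 k) hs; rewrite pow_1 Rminus_0_r => h.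
by rewrite Rabs_pos_eq; lra.
Qed.

Definition eta (s : nat) : R := Series (fun n => (-1) ^ n * / INR n.+1 ^ s).

Lemma ex_series_eta (s : nat) : (0 < s)%N -> ex_series (fun n => (-1) ^ n * / INR n.+1 ^ s).
Proof.
move=> hs; apply: (ex_series_ext _ _ _ (@ex_series_alternating_affine 1 1 s _ _ hs)) => // n.
by rewrite mul1n addn1.
Qed.

Lemma ex_series_inv_pow (s : nat) : (1 < s)%N -> ex_series (fun n => / INR n.+1 ^ s).
Proof.
move=> hs; apply/ex_series_incr_1.
apply: (@ex_series_telescope _ (fun n => / INR n.+1) 0); last first.
  apply: (is_lim_seq_ext _ _ _ _ (@is_lim_seq_inv_affine 1 1 _)) => // n.
  by rewrite mul1n addn1.
move=> n; have h := @inv_pow_le (INR n.+2) 2 s (INR_ge1 (ltn0Sn _)) hs.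
rewrite Rabs_pos_eq; last lra.
apply: Rle_trans h.2 _; have h1 := @INR_ge1 n.+1 (ltn0Sn _).
rewrite (S_INR n.+1) /= -/(INR n.+1).
move: (INR n.+1) h1 => x hx.
have -> : / x - / (x + 1) = / (x * (x + 1)) by field; lra.
by apply: Rinv_le_contravar; nra.
Qed.

Definition lambda (s : nat) : R := Series (fun k => / INR (2 * k + 1)%N ^ s).

Lemma ex_series_lambda (s : nat) : (1 < s)%N -> ex_series (fun k => / INR (2 * k + 1)%N ^ s).
Proof.
move=> hs; apply: ex_series_le_abs (ex_series_inv_pow hs) => n.
have := @inv_pow_decr (INR n.+1) (INR (2 * n + 1)%N) s => h.
have h' : 1 <= INR n.+1 <= INR (2 * n + 1)%N by split; [exact: INR_ge1 | apply: le_INR; lia].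
by rewrite Rabs_pos_eq; have := h h'; lra.
Qed.

Lemma ex_series_beta (s : nat) : (0 < s)%N -> ex_series (fun k => (-1) ^ k / INR (2 * k + 1)%N ^ s).
Proof. by move=> hs; exact: ex_series_alternating_affine. Qed.

Lemma sum_inv_sq_tail (m n : nat) : (0 < m)%N ->
  \Rsum_(m <= i < n) / INR i.+1 ^ 2 <= / INR m.
Proof.
move=> hm; case: (leqP m n) => hmn; last first.
  rewrite big_geq; last exact: ltnW.
  by apply/Rlt_le/Rinv_0_lt_compat/lt_0_INR/ltP.
suff h d : \Rsum_(m <= i < m + d) / INR i.+1 ^ 2 <= / INR m - / INR (m + d)%N.
  have := h (n - m)%N; rewrite subnKC // => h'; apply: Rle_trans h' _.
  have : 0 < / INR n by apply: Rinv_0_lt_compat; apply: lt_0_INR; lia.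
  lra.
elim: d => [|d IH]; first by rewrite addn0 big_geq // Rminus_eq_0; exact: Rle_refl.
rewrite addnS (@Rsum_cat m (m + d) (m + d).+1) ?leq_addr // big_nat1.
have : / INR (m + d).+1 ^ 2 <= / INR (m + d)%N - / INR (m + d).+1.
  have h : 0 < INR (m + d)%N by apply: lt_0_INR; lia.
  rewrite S_INR; move: (INR _) h => x hx.
  have -> : / x - / (x + 1) = / (x * (x + 1)) by field; lra.
  by apply: Rinv_le_contravar; nra.
lra.
Qed.

(** The primitive of [(1 - cos (n x)) / sin x] vanishing at [0]; the recursion by two comes from
    [cos (n x) - cos ((n + 2) x) = 2 sin x sin ((n + 1) x)]. *)
Fixpoint cosec_prim (n : nat) (x : R) : R :=
  match n with
  | 0%N => 0
  | 1%N => - 2 * ln (cos (x / 2))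
  | n'.+2 => cosec_prim n' x + 2 * ((1 - cos (INR n'.+1 * x)) / INR n'.+1)
  end.

Fixpoint cosec_prim' (n : nat) (x : R) : R :=
  match n with
  | 0%N => 0
  | 1%N => tan (x / 2)
  | n'.+2 => cosec_prim' n' x + 2 * sin (INR n'.+1 * x)
  end.

Lemma nat_ind2 (P : nat -> Prop) : P 0%N -> P 1%N -> (forall n, P n -> P n.+2) -> forall n, P n.
Proof.
move=> h0 h1 hS n; suff : P n /\ P n.+1 by case.
by elim: n => [|n [ha hb]]; split=> //; exact: hS.
Qed.

Lemma is_derive_cosec_prim (n : nat) (x : R) : 0 <= x < PI ->
  is_derive (cosec_prim n) x (cosec_prim' n x).
Proof.
move=> hx; have hc : 0 < cos (x / 2) by apply: cos_gt_0; have := PI_RGT_0; lra.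
elim/nat_ind2: n => [||n IH]; first exact: is_derive_const.
  rewrite /cosec_prim /cosec_prim' /tan /Rdiv in hc *; auto_derive => //.
  by field; lra.
apply: (@is_derive_plus R_AbsRing) IH _; apply: is_derive_scal.
auto_derive => //; rewrite -/(INR n.+1); field; exact: not_0_INR.
Qed.

Lemma cosec_prim_at0 (n : nat) : cosec_prim n 0 = 0.
Proof.
elim/nat_ind2: n => [//||n IH] /=; first by rewrite /Rdiv Rmult_0_l cos_0 ln_1; ring.
by rewrite IH Rmult_0_r cos_0 Rminus_eq_0 /Rdiv; ring.
Qed.

Lemma cosec_prim'_sin (n : nat) (x : R) : 0 <= x < PI ->
  cosec_prim' n x * sin x = 1 - cos (INR n * x).
Proof.
move=> hx; have hc : 0 < cos (x / 2) by apply: cos_gt_0; have := PI_RGT_0; lra.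
elim/nat_ind2: n => [||n IH].
- by rewrite /= !Rmult_0_l cos_0; ring.
- rewrite /= Rmult_1_l {2 3}(_ : x = 2 * (x / 2)); last by field.
  rewrite sin_2a cos_2a /tan; have := sin2_cos2 (x / 2); rewrite /Rsqr => h.
  have -> : cos (x / 2) * cos (x / 2) = 1 - sin (x / 2) * sin (x / 2) by lra.
  by field; lra.
rewrite [cosec_prim' _ _]/= -/(INR n.+1) Rmult_plus_distr_r IH.
rewrite (_ : INR n * x = INR n.+1 * x - x); last by rewrite S_INR; ring.
rewrite (_ : INR n.+2 * x = INR n.+1 * x + x); last by rewrite (S_INR n.+1); ring.
by rewrite cos_minus cos_plus; ring.
Qed.

(** The primitive of [divpow (2 * j) x * sin (a * x)] vanishing at [0]; two integrations by parts
    lower [j] by one. *)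
Fixpoint sinpow_prim (j : nat) (a x : R) : R :=
  match j with
  | 0%N => (1 - cos (a * x)) / a
  | j'.+1 => divpow (2 * j').+1 x * sin (a * x) / a ^ 2 -
      divpow (2 * j').+2 x * cos (a * x) / a - sinpow_prim j' a x / a ^ 2
  end.

Lemma is_derive_sinpow_prim (j : nat) (a x : R) : 0 < a ->
  is_derive (sinpow_prim j a) x (divpow (2 * j) x * sin (a * x)).
Proof.
move=> ha; elim: j => [|j IH].
  rewrite /sinpow_prim muln0 /divpow; auto_derive => //=; field; lra.
rewrite (_ : (2 * j.+1)%N = (2 * j).+2); last by lia.
have -> : divpow (2 * j).+2 x * sin (a * x) =
  (divpow (2 * j) x * sin (a * x) + divpow (2 * j).+1 x * (a * cos (a * x))) * / a ^ 2 -
  (divpow (2 * j).+1 x * cos (a * x) + divpow (2 * j).+2 x * (- a * sin (a * x))) * / a -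
  divpow (2 * j) x * sin (a * x) * / a ^ 2 by field; lra.
have hs k (f df : R -> R) : (is_derive f x (df x)) ->
    is_derive (fun x => divpow k.+1 x * f x) x (divpow k x * f x + divpow k.+1 x * df x).
  move=> h; apply: (@is_derive_mult R_AbsRing); [exact: is_derive_divpow | exact: h | ].
  by move=> *; exact: Rmult_comm.
have hscal (f : R -> R) (df c : R) : is_derive f x df -> is_derive (fun x => f x / c) x (df * / c).
  move=> h; rewrite Rmult_comm.
  apply: (is_derive_ext (fun x => / c * f x)); first by move=> t; rewrite /Rdiv Rmult_comm.
  exact: is_derive_scal.
rewrite /sinpow_prim -/sinpow_prim.
apply: (@is_derive_minus R_AbsRing); last by apply: hscal.
apply: (@is_derive_minus R_AbsRing); apply: hscal.
  by apply: (@hs _ (fun x => sin (a * x)) (fun x => a * cos (a * x))); auto_derive => //; ring.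
by apply: (@hs _ (fun x => cos (a * x)) (fun x => - a * sin (a * x))); auto_derive => //; ring.
Qed.

Lemma sinpow_prim_at0 (j : nat) (a : R) : sinpow_prim j a 0 = 0.
Proof.
elim: j => [|j IH] /=; first by rewrite Rmult_0_r cos_0 Rminus_eq_0 /Rdiv; ring.
by rewrite IH !divpow_at0 /Rdiv; ring.
Qed.

Lemma cos_odd_PI2 (k : nat) : cos (INR (2 * k + 1)%N * (PI / 2)) = 0.
Proof.
elim: k => [|k IH]; first by rewrite muln0 add0n Rmult_1_l cos_PI2.
rewrite (_ : (2 * k.+1 + 1)%N = (2 * k + 1).+2); last by lia.
rewrite !S_INR (_ : (_ + 1 + 1) * (PI / 2) = INR (2 * k + 1)%N * (PI / 2) + PI); last by field.
by rewrite neg_cos IH; ring.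
Qed.

Lemma sin_odd_PI2 (k : nat) : sin (INR (2 * k + 1)%N * (PI / 2)) = (-1) ^ k.
Proof.
elim: k => [|k IH]; first by rewrite muln0 add0n Rmult_1_l sin_PI2.
rewrite (_ : (2 * k.+1 + 1)%N = (2 * k + 1).+2); last by lia.
rewrite !S_INR (_ : (_ + 1 + 1) * (PI / 2) = INR (2 * k + 1)%N * (PI / 2) + PI); last by field.
by rewrite neg_sin IH -tech_pow_Rmult; ring.
Qed.

(** At [PI / 2] an odd frequency kills the boundary terms with a cosine and turns the sines into
    [(-1) ^ k]. Summed over [k], this gives [beta] at even integers and, from the lower end of the
    recursion, one value of [lambda]. *)
Lemma sinpow_prim_PI2 (j k : nat) :
  (-1) ^ j * sinpow_prim j (INR (2 * k + 1)%N) (PI / 2) =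
  / INR (2 * k + 1)%N ^ (2 * j).+1 +
  \Rsum_(0 <= i < j) ((-1) ^ i.+1 * divpow (2 * i).+1 (PI / 2) *
     ((-1) ^ k / INR (2 * k + 1)%N ^ (2 * (j - i)))).
Proof.
have ha : INR (2 * k + 1)%N <> 0 by apply: not_0_INR; lia.
elim: j => [|j IH].
  rewrite Rsum0 /sinpow_prim cos_odd_PI2 muln0 /=; field; exact: ha.
rewrite /sinpow_prim -/sinpow_prim cos_odd_PI2 sin_odd_PI2 Rsum_S subSnn muln1.
have -> : \Rsum_(0 <= i < j) ((-1) ^ i.+1 * divpow (2 * i).+1 (PI / 2) *
     ((-1) ^ k / INR (2 * k + 1)%N ^ (2 * (j.+1 - i)))) =
  / INR (2 * k + 1)%N ^ 2 * (\Rsum_(0 <= i < j) ((-1) ^ i.+1 * divpow (2 * i).+1 (PI / 2) *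
     ((-1) ^ k / INR (2 * k + 1)%N ^ (2 * (j - i))))).
  rewrite Rsum_scal; apply: Rsum_ext => i /andP [_ hi].
  rewrite (_ : (2 * (j.+1 - i))%N = (2 * (j - i)).+2); last by lia.
  rewrite -!tech_pow_Rmult /=; field; split=> //; exact: pow_nonzero.
move: IH; set s := \Rsum_(_ <= _ < _) _ => IH.
have -> : s = (-1) ^ j * sinpow_prim j (INR (2 * k + 1)%N) (PI / 2) - / INR (2 * k + 1)%N ^ (2 * j).+1 by lra.
rewrite (_ : (2 * j.+1).+1 = (2 * j).+3); last by lia.
rewrite -!tech_pow_Rmult /=; field; split=> //; exact: pow_nonzero.
Qed.

(** A linear lower bound tames [1 / sin x] near [0]; the Taylor polynomial of degree seven gives
    this one from [x <= 2] alone. *)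
Lemma sin_ge_third (x : R) : 0 <= x <= PI / 2 -> x / 3 <= sin x.
Proof.
move=> hx; have hpi := PI_4; have hpi0 := PI_RGT_0.
have [h _] := SIN x (proj1 hx) (ltac:(lra)).
apply: Rle_trans h; rewrite /sin_lb /sin_approx /sin_term /= /INR /=.
have h2 : x <= 2 by lra.
have : 0 <= x * x <= 4 by nra.
move=> h4.
suff : 0 <= x * (2 / 3 - x * x / 6 + x * x * (x * x) / 120 - x * x * (x * x) * (x * x) / 5040) by lra.
apply: Rmult_le_pos; first lra.
have : x * x * (x * x) * (x * x) <= 4 * (x * x * (x * x)) by nra.
nra.
Qed.

(** * Separation of the polynomial part of the kernels *)

Definition kernel_coef (l j n : nat) : R :=
  2 * (-1) ^ n.+1 * (/ (2 * INR n.+1) ^ (2 * (l - j.+1)).+1 - / INR n.+1 ^ (2 * (l - j.+1)).+1).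

(** For [j = l - 1] this is [eta 1 = ln 2], a conditionally convergent sum and the origin of the
    terms [ln 2 * beta] in the formula. *)
Definition kernel_coef_sum (l j : nat) : R :=
  2 * (1 - / 2 ^ (2 * (l - j.+1)).+1) * eta (2 * (l - j.+1)).+1.

(** The kernel without its monomials of positive degree. The constant stays with the cosine, so that
    the term vanishes at [0] and can be divided by [sin x]. *)
Definition kernel_osc (l n : nat) (x : R) : R :=
  2 * (-1) ^ n.+1 * ((cos (2 * INR n.+1 * x) - 1) / (2 * INR n.+1) ^ (2 * l).+1 -
                     (cos (INR n.+1 * x) - 1) / INR n.+1 ^ (2 * l).+1).

Lemma cos_kernel_decomp (l : nat) (lam x : R) : 0 < lam ->
  cos_kernel l lam x = (cos (lam * x) - 1) / lam ^ (2 * l).+1 -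
    \Rsum_(0 <= j < l) ((-1) ^ j.+1 * divpow (2 * j.+1) x * / lam ^ (2 * (l - j.+1)).+1).
Proof.
move=> hl; rewrite /cos_kernel /cos_rem big_nat_recl //.
have -> : (-1) ^ 0 * divpow (2 * 0) (lam * x) = 1 by rewrite muln0 /divpow /=; field.
have -> : \Rsum_(0 <= j < l) ((-1) ^ j.+1 * divpow (2 * j.+1) x * / lam ^ (2 * (l - j.+1)).+1) =
   (\Rsum_(0 <= j < l) ((-1) ^ j.+1 * divpow (2 * j.+1) (lam * x))) / lam ^ (2 * l).+1.
  rewrite /Rdiv Rmult_comm Rsum_scal; apply: Rsum_ext => j /andP [_ hj].
  rewrite /divpow (_ : (2 * l).+1 = (2 * j.+1 + (2 * (l - j.+1)).+1)%N); last by lia.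
  rewrite (pow_add lam) Rpow_mult_distr.
  have h1 : lam ^ (2 * j.+1) <> 0 by apply: pow_nonzero; lra.
  have h2 : lam ^ (2 * (l - j.+1)).+1 <> 0 by apply: pow_nonzero; lra.
  have h3 := INR_fact_neq_0 (2 * j.+1)%N.
  by field.
have h : lam ^ (2 * l).+1 <> 0 by apply: pow_nonzero; lra.
by field.
Qed.

Lemma chain_kernel_decomp (l n : nat) (x : R) :
  chain_kernel l n x = kernel_osc l n x -
    \Rsum_(0 <= j < l) ((-1) ^ j.+1 * divpow (2 * j.+1) x * kernel_coef l j n).
Proof.
have hn : 0 < INR n.+1 by apply: lt_0_INR; lia.
rewrite /chain_kernel !cos_kernel_decomp; try lra.
rewrite /kernel_osc.
have -> : \Rsum_(0 <= j < l) ((-1) ^ j.+1 * divpow (2 * j.+1) x * kernel_coef l j n) =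
  2 * (-1) ^ n.+1 *
  ((\Rsum_(0 <= j < l) ((-1) ^ j.+1 * divpow (2 * j.+1) x * / (2 * INR n.+1) ^ (2 * (l - j.+1)).+1)) -
   (\Rsum_(0 <= j < l) ((-1) ^ j.+1 * divpow (2 * j.+1) x * / INR n.+1 ^ (2 * (l - j.+1)).+1))).
  by rewrite -Rsum_minus Rsum_scal; apply: Rsum_ext => j _; rewrite /kernel_coef; ring.
by ring.
Qed.

Lemma is_lim_Rsum (m : nat) (u : nat -> nat -> R) (v : nat -> R) :
  (forall j, (j < m)%N -> is_lim_seq (fun M => u M j) (v j)) ->
  is_lim_seq (fun M => \Rsum_(0 <= j < m) u M j) (\Rsum_(0 <= j < m) v j).
Proof.
elim: m => [|m IH] h.
  by rewrite Rsum0; apply: is_lim_seq_ext (is_lim_seq_const 0) => M; rewrite Rsum0.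
rewrite Rsum_S; apply: (is_lim_seq_ext (fun M => (\Rsum_(0 <= j < m) u M j) + u M m)).
  by move=> M; rewrite Rsum_S.
apply: is_lim_seq_plus'; last exact: h.
by apply: IH => j hj; apply: h; exact: ltnW.
Qed.

Lemma is_lim_scal (u : nat -> R) (c v : R) :
  is_lim_seq u v -> is_lim_seq (fun M => c * u M) (c * v).
Proof. exact: (is_lim_seq_scal_l u c (Finite v)). Qed.

Lemma is_lim_kernel_coef (l j : nat) :
  is_lim_seq (fun M => \Rsum_(0 <= n < M) kernel_coef l j n) (kernel_coef_sum l j).
Proof.
have h := ex_series_Rsum (@ex_series_eta (2 * (l - j.+1)).+1 (ltn0Sn _)).
have := @is_lim_scal _ (2 * (1 - / 2 ^ (2 * (l - j.+1)).+1)) _ h.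
apply: is_lim_seq_ext => M.
rewrite Rsum_scal; apply: Rsum_ext => n _; rewrite /kernel_coef (Rpow_mult_distr 2) -(tech_pow_Rmult (-1) n).
have h2 : 2 ^ (2 * (l - j.+1)).+1 <> 0 by apply: pow_nonzero; lra.
have h3 : INR n.+1 ^ (2 * (l - j.+1)).+1 <> 0 by apply: pow_nonzero; exact: not_0_INR.
by field.
Qed.

Definition osc_limit (l : nat) (x : R) : R :=
  angle_chain (2 * l) x +
  \Rsum_(0 <= j < l) ((-1) ^ j.+1 * divpow (2 * j.+1) x * kernel_coef_sum l j).

Lemma is_lim_kernel_osc (l : nat) (x : R) : 0 < x < PI / 2 ->
  is_lim_seq (fun M => \Rsum_(0 <= n < M) kernel_osc l n x) (osc_limit l x).
Proof.
move=> hx; apply: (is_lim_seq_ext (fun M => (\Rsum_(0 <= n < M) chain_kernel l n x) +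
   \Rsum_(0 <= j < l) ((-1) ^ j.+1 * divpow (2 * j.+1) x * (\Rsum_(0 <= n < M) kernel_coef l j n)))).
  move=> M; have -> : \Rsum_(0 <= j < l) ((-1) ^ j.+1 * divpow (2 * j.+1) x * (\Rsum_(0 <= n < M) kernel_coef l j n)) =
     \Rsum_(0 <= n < M) \Rsum_(0 <= j < l) ((-1) ^ j.+1 * divpow (2 * j.+1) x * kernel_coef l j n).
    by rewrite exchange_big_nat; apply: Rsum_ext => j _; rewrite Rsum_scal.
  by rewrite -Rsum_plus; apply: Rsum_ext => n _; rewrite chain_kernel_decomp; ring.
apply: is_lim_seq_plus'; first exact: angle_chain_fourier.
by apply: is_lim_Rsum => j _; apply: is_lim_scal; exact: is_lim_kernel_coef.
Qed.

Lemma one_sub_cos_le (y : R) : 0 <= y -> Rabs (cos y - 1) <= y.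
Proof.
move=> hy; case: (Rle_lt_or_eq_dec _ _ hy) => [h|<-]; last by rewrite cos_0 Rminus_eq_0 Rabs_R0; lra.
have := @mvt_dist cos (fun x => - sin x) 0 y 1 h; rewrite cos_0 Rmult_1_l Rminus_0_r; apply.
  by move=> z _; auto_derive => //; ring.
by move=> z _; rewrite Rabs_Ropp; apply: Rabs_le; have := SIN_bound z; lra.
Qed.

(** One power of the frequency is spent on [|cos (lam x) - 1| <= lam x], which yields the factor [x]
    that later compensates [1 / sin x]; for [l >= 1] at least two powers are left. *)
Lemma kernel_osc_bound (l n : nat) (x : R) : (0 < l)%N -> 0 <= x ->
  Rabs (kernel_osc l n x) <= 4 * x * / INR n.+1 ^ 2.
Proof.
move=> hl hx; have hN := @INR_ge1 n.+1 (ltn0Sn _); rewrite /kernel_osc.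
have h lam : 1 <= lam -> Rabs ((cos (lam * x) - 1) / lam ^ (2 * l).+1) <= x * / lam ^ 2.
  move=> h1; rewrite Rabs_mult (Rabs_pos_eq (/ _)); last by apply/Rlt_le/Rinv_0_lt_compat/pow_lt; lra.
  apply: Rle_trans (Rmult_le_compat_r _ _ _ _ (one_sub_cos_le _)) _.
  - by apply/Rlt_le/Rinv_0_lt_compat/pow_lt; lra.
  - by apply: Rmult_le_pos; lra.
  have -> : lam * x * / lam ^ (2 * l).+1 = x * / lam ^ (2 * l).
    have h2 : lam ^ (2 * l) <> 0 by apply: pow_nonzero; lra.
    by rewrite -tech_pow_Rmult; field; lra.
  apply: Rmult_le_compat_l => //; apply: (inv_pow_le h1 _).2; lia.
rewrite Rabs_mult Rabs_mult pow_1_abs (Rabs_pos_eq 2); last lra.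
have := h (2 * INR n.+1) (ltac:(lra)); have := h _ hN.
have [_ h2] := @inv_pow_decr (INR n.+1) (2 * INR n.+1) 2 (ltac:(lra)).
set a := _ / _; set b := _ / _ => ha hb.
have := Rabs_triang b (- a); rewrite Rabs_Ropp -/(Rminus b a).
have : x * / (2 * INR n.+1) ^ 2 <= x * / INR n.+1 ^ 2 by apply: Rmult_le_compat_l.
rewrite /Rminus; lra.
Qed.

Lemma osc_limit_tail (l K : nat) (x : R) : (0 < l)%N -> (0 < K)%N -> 0 < x < PI / 2 ->
  Rabs (osc_limit l x - \Rsum_(0 <= n < K) kernel_osc l n x) <= 4 * x * / INR K.
Proof.
move=> hl hK hx.
have h1 : is_lim_seq (fun M => Rabs ((\Rsum_(0 <= n < M + K) kernel_osc l n x) -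
    \Rsum_(0 <= n < K) kernel_osc l n x))
   (Rabs (osc_limit l x - \Rsum_(0 <= n < K) kernel_osc l n x)).
  apply: (is_lim_seq_abs _ (Finite _)); apply: is_lim_seq_minus'; last exact: is_lim_seq_const.
  by have := @is_lim_kernel_osc l x hx; move/(is_lim_seq_incr_n _ K).
apply: (is_lim_seq_le _ _ _ _ _ h1 (is_lim_seq_const _)) => M.
rewrite (@Rsum_cat 0 K (M + K)) ?leq_addl //.
rewrite (_ : forall a b, a + b - a = b); last by move=> a b; ring.
apply: Rle_trans (Rsum_abs _ _ _) _.
apply: Rle_trans (Rsum_le (fun n _ => @kernel_osc_bound l n x hl (Rlt_le _ _ (proj1 hx)))) _.
by rewrite -Rsum_scal; apply: Rmult_le_compat_l; [lra | exact: sum_inv_sq_tail].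
Qed.

Lemma sum_sin_odd (K : nat) (x : R) :
  2 * (\Rsum_(0 <= k < K) sin (INR (2 * k + 1)%N * x)) * sin x = 1 - cos (2 * INR K * x).
Proof.
elim: K => [|K IH]; first by rewrite Rsum0 [INR 0]/= Rmult_0_r !Rmult_0_l cos_0; ring.
rewrite Rsum_S Rmult_plus_distr_l Rmult_plus_distr_r IH.
set y := INR (2 * K + 1)%N * x.
have e : INR (2 * K + 1)%N = 2 * INR K + 1 by rewrite plus_INR mult_INR.
rewrite (_ : 2 * INR K * x = y - x); last by rewrite /y e; ring.
rewrite (_ : 2 * INR K.+1 * x = y + x); last by rewrite /y e S_INR; ring.
by rewrite cos_minus cos_plus; ring.
Qed.

(** * Truncated primitives of the integrand and their error *)

Definition chain_coef (l n : nat) : R := signed_chain (2 * l) n / INR n.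

Definition osc_prim (l n : nat) (x : R) : R :=
  2 * (-1) ^ n.+1 * (cosec_prim n.+1 x / INR n.+1 ^ (2 * l).+1 -
    cosec_prim (2 * n.+1) x / (2 * INR n.+1) ^ (2 * l).+1).

Definition osc_prim' (l n : nat) (x : R) : R :=
  2 * (-1) ^ n.+1 * (cosec_prim' n.+1 x / INR n.+1 ^ (2 * l).+1 -
    cosec_prim' (2 * n.+1) x / (2 * INR n.+1) ^ (2 * l).+1).

Lemma is_derive_div_cst (f : R -> R) (x df c : R) :
  is_derive f x df -> is_derive (fun x => f x / c) x (df / c).
Proof.
move=> h; rewrite /Rdiv Rmult_comm.
apply: (is_derive_ext (fun x => / c * f x)); first by move=> t; rewrite Rmult_comm.
exact: is_derive_scal.
Qed.

Lemma is_derive_osc_prim (l n : nat) (x : R) : 0 <= x < PI ->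
  is_derive (osc_prim l n) x (osc_prim' l n x).
Proof.
move=> hx; apply: is_derive_scal.
by apply: (@is_derive_minus R_AbsRing); apply: is_derive_div_cst; exact: is_derive_cosec_prim.
Qed.

Lemma osc_prim'_sin (l n : nat) (x : R) : 0 <= x < PI ->
  osc_prim' l n x * sin x = kernel_osc l n x.
Proof.
move=> hx; rewrite /osc_prim' /kernel_osc.
have h1 := cosec_prim'_sin n.+1 hx; have h2 := cosec_prim'_sin (2 * n.+1) hx.
have e : INR (2 * n.+1)%N = 2 * INR n.+1 by rewrite mult_INR.
transitivity (2 * (-1) ^ n.+1 * ((cosec_prim' n.+1 x * sin x) / INR n.+1 ^ (2 * l).+1 -
    (cosec_prim' (2 * n.+1) x * sin x) / (2 * INR n.+1) ^ (2 * l).+1)).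
  by rewrite /Rdiv; ring.
by rewrite h1 h2 e /Rdiv; ring.
Qed.

Lemma osc_prim_at0 (l n : nat) : osc_prim l n 0 = 0.
Proof. by rewrite /osc_prim !cosec_prim_at0 /Rdiv; ring. Qed.

(** The logarithmic derivative of [tan (x / 2)] is [1 / sin x], so dividing the coefficients by [n]
    integrates the series against [1 / sin x]. At [tan (PI / 4) = 1] the value is [S_value l]. *)
Definition chain_prim (l : nat) (x : R) : R :=
  2 ^ (2 * l).+1 * PSeries (chain_coef l) (tan (x / 2)).

Definition chain_prim' (l : nat) (x : R) : R :=
  2 ^ (2 * l).+1 * ((1 + tan (x / 2) ^ 2) / 2 * PSeries (PS_derive (chain_coef l)) (tan (x / 2))).

Lemma CV_radius_chain_coef (l : nat) (x : R) : Rabs x < 1 ->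
  Rbar_lt (Rabs x) (CV_radius (chain_coef l)).
Proof.
move=> hx; apply: (Rbar_lt_le_trans _ 1) => //.
have [h _] := CV_radius_bounded (chain_coef l); apply: h.
exists (Series (fun n => Rabs (chain_coef l n))) => n; rewrite pow1 Rmult_1_r.
have hs := ex_series_signed_chain (2 * l).
have h := ex_series_Rsum hs.
apply: (is_lim_seq_le_loc (fun=> Rabs (chain_coef l n)) _ (Rabs (chain_coef l n)) _ _ (is_lim_seq_const _) h).
exists n.+1 => m /leP hm; rewrite (@Rsum_cat 0 n.+1 m) // Rsum_S -/(chain_coef l n).
have := @Rsum_ge0 0 n (fun i => Rabs (chain_coef l i)) (fun i _ => Rabs_pos _).
have := @Rsum_ge0 n.+1 m (fun i => Rabs (chain_coef l i)) (fun i _ => Rabs_pos _).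
rewrite /chain_coef; lra.
Qed.

Lemma is_derive_chain_prim (l : nat) (x : R) : 0 <= x < PI / 2 ->
  is_derive (chain_prim l) x (chain_prim' l x).
Proof.
move=> hx; have [h0 h1] := tan_half_range hx.
apply: is_derive_scal; apply: (is_derive_comp (PSeries (chain_coef l)) (fun y => tan (y / 2))).
  by apply: is_derive_PSeries; apply: CV_radius_chain_coef; rewrite Rabs_pos_eq.
exact: is_derive_tan_half.
Qed.

Lemma chain_prim'_sin (l : nat) (x : R) : 0 <= x < PI / 2 ->
  chain_prim' l x * sin x = angle_chain (2 * l) x.
Proof.
move=> hx; have [h0 h1] := tan_half_range hx; have hc := tan_half_cos hx.
rewrite /chain_prim' /angle_chain.
have -> : PSeries (signed_chain (2 * l)) (tan (x / 2)) =
    tan (x / 2) * PSeries (PS_derive (chain_coef l)) (tan (x / 2)).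
  rewrite PSeries_decr_1; last first.
    by apply: CV_radius_inside; apply: CV_radius_signed_chain; rewrite Rabs_pos_eq.
  rewrite /signed_chain chain_at0 Rmult_0_r Rplus_0_l; congr (_ * _); apply: PSeries_ext => n.
  rewrite /PS_decr_1 /PS_derive /chain_coef /signed_chain; field; exact: not_0_INR.
have -> : sin x = 2 * tan (x / 2) * / (1 + tan (x / 2) ^ 2).
  rewrite {1}(_ : x = 2 * (x / 2)); last by field.
  rewrite sin_2a /tan; have := sin2_cos2 (x / 2); rewrite /Rsqr => e.
  have -> : 1 + (sin (x / 2) / cos (x / 2)) ^ 2 = (sin (x / 2) * sin (x / 2) + cos (x / 2) * cos (x / 2)) / (cos (x / 2) * cos (x / 2)).
    by field; lra.
  by rewrite e; field; lra.
field; nra.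
Qed.

(** Minus the primitive of the truncated integrand: the polynomials against [K] terms of the
    cosecant series, and [K] of the cosine terms divided by [sin x]. *)
Definition trig_part (l K : nat) (x : R) : R :=
  (\Rsum_(0 <= j < l) ((-1) ^ j.+1 * kernel_coef_sum l j *
     (2 * (\Rsum_(0 <= k < K) sinpow_prim j.+1 (INR (2 * k + 1)%N) x)))) -
  \Rsum_(0 <= n < K) osc_prim l n x.

Definition trig_part' (l K : nat) (x : R) : R :=
  (\Rsum_(0 <= j < l) ((-1) ^ j.+1 * kernel_coef_sum l j *
     (2 * (\Rsum_(0 <= k < K) (divpow (2 * j.+1) x * sin (INR (2 * k + 1)%N * x)))))) -
  \Rsum_(0 <= n < K) osc_prim' l n x.

Lemma is_derive_trig_part (l K : nat) (x : R) : 0 <= x < PI ->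
  is_derive (trig_part l K) x (trig_part' l K x).
Proof.
move=> hx; apply: (@is_derive_minus R_AbsRing); last first.
  by apply: (@is_derive_Rsum K (osc_prim l) (osc_prim' l)) => n _; exact: is_derive_osc_prim.
apply: (@is_derive_Rsum l
  (fun j x => (-1) ^ j.+1 * kernel_coef_sum l j *
     (2 * (\Rsum_(0 <= k < K) sinpow_prim j.+1 (INR (2 * k + 1)%N) x)))
  (fun j x => (-1) ^ j.+1 * kernel_coef_sum l j *
     (2 * (\Rsum_(0 <= k < K) (divpow (2 * j.+1) x * sin (INR (2 * k + 1)%N * x)))))) => j _.
apply: is_derive_scal; apply: is_derive_scal.
apply: (@is_derive_Rsum K (fun k => sinpow_prim j.+1 (INR (2 * k + 1)%N))
  (fun k x => divpow (2 * j.+1) x * sin (INR (2 * k + 1)%N * x))) => k _.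
by apply: is_derive_sinpow_prim; apply: lt_0_INR; lia.
Qed.

Lemma trig_part_at0 (l K : nat) : trig_part l K 0 = 0.
Proof.
rewrite /trig_part !Rsum_const0; first by ring.
  by move=> n _; exact: osc_prim_at0.
by move=> j _; rewrite Rsum_const0; [ring | move=> k _; exact: sinpow_prim_at0].
Qed.

(** The factor of [cos (2 K x)] that survives truncation, since [2 sum_(k < K) sin ((2 k + 1) x) =
    (1 - cos (2 K x)) / sin x]. It does not depend on [K]. *)
Definition residual_amplitude (l : nat) (x : R) : R :=
  - (\Rsum_(0 <= j < l) ((-1) ^ j.+1 * kernel_coef_sum l j * (divpow (2 * j.+1) x / sin x))).

Definition residual_amplitude' (l : nat) (x : R) : R :=
  - (\Rsum_(0 <= j < l) ((-1) ^ j.+1 * kernel_coef_sum l j *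
     (divpow (2 * j).+1 x / sin x - divpow (2 * j.+1) x * cos x / sin x ^ 2))).

Lemma residual_derivative (l K : nat) (x : R) : 0 < x < PI / 2 ->
  chain_prim' l x + trig_part' l K x =
  (osc_limit l x - \Rsum_(0 <= n < K) kernel_osc l n x) / sin x +
  residual_amplitude l x * sin (2 * INR K * x + PI / 2).
Proof.
move=> hx; have hpi := PI_RGT_0; have hs : 0 < sin x by apply: sin_gt_0; lra.
apply: (Rmult_eq_reg_r (sin x)); last lra.
(* The phase [PI / 2] puts the cosine into the form that [oscillation_bound] expects. *)
rewrite (_ : forall y, sin (y + PI / 2) = cos y); last first.
  by move=> y; rewrite sin_plus sin_PI2 cos_PI2; ring.
rewrite Rmult_plus_distr_r chain_prim'_sin; last lra.
have -> : trig_part' l K x * sin x =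
  (\Rsum_(0 <= j < l) ((-1) ^ j.+1 * kernel_coef_sum l j * (divpow (2 * j.+1) x * (1 - cos (2 * INR K * x))))) -
  \Rsum_(0 <= n < K) kernel_osc l n x.
  rewrite /trig_part' /Rminus Rmult_plus_distr_r; congr (_ + _).
    rewrite [LHS]Rmult_comm Rsum_scal; apply: Rsum_ext => j _.
    by rewrite -Rsum_scal -[1 + - _]/(1 - _) -(sum_sin_odd K x); ring.
  rewrite -Ropp_mult_distr_l; congr (- _); rewrite [LHS]Rmult_comm Rsum_scal; apply: Rsum_ext => n _.
  by rewrite Rmult_comm osc_prim'_sin; lra.
have -> : residual_amplitude l x = - (\Rsum_(0 <= j < l) ((-1) ^ j.+1 * divpow (2 * j.+1) x * kernel_coef_sum l j)) / sin x.
  rewrite /residual_amplitude /Rdiv -Ropp_mult_distr_l; congr (- _); rewrite [RHS]Rmult_comm Rsum_scal.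
  by apply: Rsum_ext => j _; ring.
have -> : \Rsum_(0 <= j < l) ((-1) ^ j.+1 * kernel_coef_sum l j * (divpow (2 * j.+1) x * (1 - cos (2 * INR K * x)))) =
  (1 - cos (2 * INR K * x)) * (\Rsum_(0 <= j < l) ((-1) ^ j.+1 * divpow (2 * j.+1) x * kernel_coef_sum l j)).
  by rewrite Rsum_scal; apply: Rsum_ext => j _; ring.
rewrite /osc_limit; field; lra.
Qed.

Lemma divpow_le (n : nat) (x : R) : 0 <= x <= 2 -> 0 <= divpow n x <= x ^ n.
Proof.
move=> hx; have h := pow_le x n (proj1 hx).
have hf : 1 <= INR (fact n) by apply: INR_ge1; apply/ltP; exact: lt_O_fact.
have hi : 0 < / INR (fact n) <= 1.
  by split; [apply: Rinv_0_lt_compat; lra | rewrite -Rinv_1; apply: Rinv_le_contravar; lra].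
rewrite /divpow /Rdiv; nra.
Qed.

(** Every monomial has degree at least two, so after division by [sin x] it stays bounded together
    with its derivative. *)
Lemma residual_amplitude_bound (l : nat) : exists A, forall x, 0 < x < PI / 2 ->
  [/\ is_derive (residual_amplitude l) x (residual_amplitude' l x),
      Rabs (residual_amplitude l x) <= A & Rabs (residual_amplitude' l x) <= A].
Proof.
(* As [x <= 2], the [j]-th term is bounded by [6 * 4 ^ j] times its coefficient and its derivative
   by [12 * 4 ^ j] times it; [24] covers both. *)
exists (\Rsum_(0 <= j < l) (Rabs ((-1) ^ j.+1 * kernel_coef_sum l j) * (24 * 4 ^ j))) => x hx.
have hpi := PI_RGT_0; have hpi4 := PI_4; have hs : 0 < sin x by apply: sin_gt_0; lra.
have hi : / sin x <= 3 * / x.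
  have h3 := @sin_ge_third x (ltac:(lra)).
  by rewrite (_ : 3 * / x = / (x / 3)); [apply: Rinv_le_contravar; lra | field; lra].
have hi0 := Rinv_0_lt_compat _ hs.
have hpow j : 0 <= x ^ (2 * j) <= 4 ^ j.
  split; first by apply: pow_le; lra.
  by rewrite pow_mult; apply: pow_incr; nra.
have hq j : 0 <= divpow (2 * j.+1) x / sin x <= 3 * (x ^ (2 * j)) * x.
  have := @divpow_le (2 * j.+1) x (ltac:(lra)).
  rewrite (_ : (2 * j.+1)%N = (2 * j).+2); last by lia.
  rewrite -!tech_pow_Rmult; have := hpow j; move: (x ^ _) (divpow _ _) => p d hp hd.
  split; first by apply: Rdiv_le_0_compat; lra.
  apply: (Rle_trans _ (x * (x * p) * (3 * / x))).
    by apply: Rmult_le_compat; try lra; nra.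
  by apply: Req_le; field; lra.
have hq1 j : 0 <= divpow (2 * j).+1 x / sin x <= 3 * (x ^ (2 * j)).
  have := @divpow_le (2 * j).+1 x (ltac:(lra)).
  rewrite -!tech_pow_Rmult; have := hpow j; move: (x ^ _) (divpow _ _) => p d hp hd.
  split; first by apply: Rdiv_le_0_compat; lra.
  apply: (Rle_trans _ ((x * p) * (3 * / x))).
    by apply: Rmult_le_compat; try lra; nra.
  by apply: Req_le; field; lra.
split.
- apply: (@is_derive_opp R_AbsRing).
  apply: (@is_derive_Rsum l
    (fun j x => (-1) ^ j.+1 * kernel_coef_sum l j * (divpow (2 * j.+1) x / sin x))
    (fun j x => (-1) ^ j.+1 * kernel_coef_sum l j *
       (divpow (2 * j).+1 x / sin x - divpow (2 * j.+1) x * cos x / sin x ^ 2))) => j _.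
  apply: is_derive_scal; rewrite (_ : (2 * j.+1)%N = (2 * j).+2); last by lia.
  rewrite (_ : _ - _ = (divpow (2 * j).+1 x * sin x - divpow (2 * j).+2 x * cos x) / sin x ^ 2); last by field; lra.
  apply: is_derive_div; last lra; first exact: is_derive_divpow.
  by apply/is_derive_Reals; exact: derivable_pt_lim_sin.
- rewrite Rabs_Ropp; apply: Rle_trans (Rsum_abs _ _ _) _; apply: Rsum_le => j _.
  rewrite Rabs_mult; apply: Rmult_le_compat_l; first exact: Rabs_pos.
  have := hq j; have := hpow j => h1 h2; rewrite Rabs_pos_eq; nra.
rewrite Rabs_Ropp; apply: Rle_trans (Rsum_abs _ _ _) _; apply: Rsum_le => j _.
rewrite Rabs_mult; apply: Rmult_le_compat_l; first exact: Rabs_pos.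
have h1 := hq j; have h2 := hq1 j; have h3 := hpow j.
have h4 : 0 <= divpow (2 * j.+1) x / sin x * / sin x <= 9 * x ^ (2 * j).
  split; first by apply: Rmult_le_pos; lra.
  apply: (Rle_trans _ (3 * x ^ (2 * j) * x * (3 * / x))).
    by apply: Rmult_le_compat; lra.
  by apply: Req_le; field; lra.
rewrite (_ : divpow (2 * j.+1) x * cos x / sin x ^ 2 = cos x * (divpow (2 * j.+1) x / sin x * / sin x)); last by field; lra.
have h5 : Rabs (cos x * (divpow (2 * j.+1) x / sin x * / sin x)) <= 9 * x ^ (2 * j).
  rewrite Rabs_mult (Rabs_pos_eq (_ * _)); last lra.
  have : Rabs (cos x) <= 1 by apply: Rabs_le; have := COS_bound x; lra.
  have := Rabs_pos (cos x); nra.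
apply: Rle_trans (Rabs_triang _ _) _; rewrite Rabs_Ropp (Rabs_pos_eq (divpow _ _ / _)); lra.
Qed.

Lemma is_derive_at_left (f : R -> R) (x df : R) : is_derive f x df ->
  filterlim f (at_left x) (locally (f x)).
Proof.
move=> h; have hc : continuous f x by apply: (ex_derive_continuous f x); exists df.
exact: (filterlim_filter_le_1 _ (filter_le_within (fun u => u < x)) hc).
Qed.

Lemma tan_half_at_left : filterlim (fun x => tan (x / 2)) (at_left (PI / 2)) (locally 1).
Proof.
have e : tan (PI / 2 / 2) = 1 by rewrite (_ : PI / 2 / 2 = PI / 4) ?tan_PI4 //; field.
rewrite -e.
have hc : 0 < cos (PI / 2 / 2) by apply: cos_gt_0; have := PI_RGT_0; lra.
apply: (@is_derive_at_left (fun x => tan (x / 2)) _ ((1 + tan (PI / 2 / 2) ^ 2) / 2)).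
rewrite /tan; auto_derive; first by move: hc; rewrite /Rdiv; lra.
have := sin2_cos2 (PI / 2 / 2); rewrite /Rsqr /Rdiv => h; rewrite /Rdiv in hc.
field; lra.
Qed.

Lemma at_left_PI2 : at_left (PI / 2) (fun x => 0 < x < PI / 2).
Proof.
have hpi := PI_RGT_0; have h : 0 < PI / 2 by lra.
exists (mkposreal _ h) => y; rewrite /ball /= /AbsRing_ball /abs /minus /plus /opp /= => hy hlt.
by move: hy => /Rabs_def2 hy; lra.
Qed.

Lemma filterlim_pow (T : Type) (F : (T -> Prop) -> Prop) (FF : Filter F) (f : T -> R) (a : R) (n : nat) :
  filterlim f F (locally a) -> filterlim (fun x => f x ^ n) F (locally (a ^ n)).
Proof.
move=> h; apply: (filterlim_comp _ _ _ f (fun y => y ^ n) _ (locally a)) => //.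
suff : continuous (fun y => y ^ n) a by [].
apply: (ex_derive_continuous (fun y => y ^ n) a); exists (INR n * 1 * a ^ n.-1).
by apply: is_derive_pow; exact: is_derive_id.
Qed.

(** The coefficients are absolutely summable, so Abel's limit theorem is here a case of
    [tannery]. *)
Lemma chain_prim_at_left (l : nat) :
  filterlim (chain_prim l) (at_left (PI / 2)) (locally (2 ^ (2 * l).+1 * Series (chain_coef l))).
Proof.
apply: (filterlim_comp _ _ _ _ (fun y => 2 ^ (2 * l).+1 * y) _ (locally (Series (chain_coef l)))).
  apply: (@tannery R (at_left (PI / 2)) _ (fun x n => chain_coef l n * tan (x / 2) ^ n)
    (chain_coef l) (fun n => Rabs (chain_coef l n))).
  - exact: ex_series_signed_chain.
  - apply: filter_imp at_left_PI2 => x hx n; rewrite Rabs_mult.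
    rewrite -{2}[Rabs _]Rmult_1_r; apply: Rmult_le_compat_l; first exact: Rabs_pos.
    have [h0 h1] := @tan_half_range x (ltac:(lra)).
    rewrite -RPow_abs Rabs_pos_eq //; rewrite -(pow1 n); apply: pow_incr; lra.
  move=> n; apply: (filterlim_comp _ _ _ _ (fun y => chain_coef l n * y) _ (locally 1)); last first.
    rewrite -{2}[chain_coef l n]Rmult_1_r.
    exact: (@filterlim_scal_r R_AbsRing R_NormedModule (chain_coef l n) 1).
  by rewrite -(pow1 n); apply: filterlim_pow; exact: tan_half_at_left.
exact: (@filterlim_scal_r R_AbsRing R_NormedModule (2 ^ (2 * l).+1) (Series (chain_coef l))).
Qed.

(** The bound on [chain_prim + trig_part] comes from its derivative on the open interval and passes
    to [PI / 2] as a left limit, since the power series is differentiated only where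
    [tan (x / 2) < 1]. *)
Lemma trig_part_limit (l : nat) : (0 < l)%N -> exists A, forall K, (0 < K)%N ->
  Rabs (S_value l + trig_part l K (PI / 2)) <= A * / INR K.
Proof.
move=> hl; have hpi := PI_RGT_0; have [A hA] := residual_amplitude_bound l.
(* Here [12 = 4 * 3], from the tail [4 x / K] and [1 / sin x <= 3 / x]; the rest is the oscillation
   at frequency [2 K]. *)
exists (12 * (PI / 2) + (2 * A + A * (PI / 2)) / 2) => K hK.
have hK0 : 0 < INR K by apply: lt_0_INR; apply/ltP.
have -> : S_value l = 2 ^ (2 * l).+1 * Series (chain_coef l) by rewrite S_valueE addn1.
pose f x := chain_prim l x + trig_part l K x.
have hd x : 0 <= x < PI / 2 -> is_derive f x (chain_prim' l x + trig_part' l K x).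
  move=> hx; apply: (@is_derive_plus R_AbsRing); first exact: is_derive_chain_prim.
  by apply: is_derive_trig_part; lra.
have f0 : f 0 = 0.
  rewrite /f /chain_prim trig_part_at0 (_ : 0 / 2 = 0) ?tan_0 ?PSeries_0; last by field.
  by rewrite /chain_coef /signed_chain chain_at0 /Rdiv; ring.
have hb x : 0 < x < PI / 2 -> Rabs (f x) <= (12 * (PI / 2) + (2 * A + A * (PI / 2)) / 2) * / INR K.
  move=> hx.
  have -> : (12 * (PI / 2) + (2 * A + A * (PI / 2)) / 2) * / INR K =
     12 * / INR K * (PI / 2) + (2 * A + A * (PI / 2)) / (2 * INR K) by field; lra.
  apply: (@oscillation_bound f (fun x => (osc_limit l x - \Rsum_(0 <= n < K) kernel_osc l n x) / sin x)
    (residual_amplitude l) (residual_amplitude' l) (PI / 2) A A (12 * / INR K) (2 * INR K) (PI / 2)) => //.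
  - lra.
  - by apply: is_derive_continuity_pt (hd 0 _); lra.
  - by move=> y hy; rewrite -residual_derivative //; apply: hd; lra.
  - by move=> y /hA [].
  - move=> y hy; rewrite Rabs_mult.
    have hs : 0 < sin y by apply: sin_gt_0; lra.
    have h3 := @sin_ge_third y (ltac:(lra)).
    have hi := Rinv_0_lt_compat _ hs; have hi2 := Rinv_0_lt_compat _ hK0.
    rewrite (Rabs_pos_eq (/ _)); last lra.
    apply: Rle_trans (Rmult_le_compat_r _ _ _ _ (osc_limit_tail hl hK hy)) _; first lra.
    have -> : 12 * / INR K = 4 * y * / INR K * (3 * / y) by field; lra.
    apply: Rmult_le_compat_l; first by repeat apply: Rmult_le_pos; lra.
    by rewrite (_ : 3 * / y = / (y / 3)); [apply: Rinv_le_contravar; lra | field; lra].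
  - by move=> y /hA [].
  - by move=> y /hA [].
have hlim : filterlim (fun x => Rabs (f x)) (at_left (PI / 2))
    (Rbar_locally (Rabs (2 ^ (2 * l).+1 * Series (chain_coef l) + trig_part l K (PI / 2)))).
  apply: (filterlim_comp _ _ _ f Rabs _
    (locally (2 ^ (2 * l).+1 * Series (chain_coef l) + trig_part l K (PI / 2)))); last first.
    exact: (continuous_Rabs (2 ^ (2 * l).+1 * Series (chain_coef l) + trig_part l K (PI / 2))).
  apply: (filterlim_comp_2 _ _ Rplus (chain_prim_at_left (l := l))).
    apply: (is_derive_at_left (df := trig_part' l K (PI / 2))).
    by apply: is_derive_trig_part; lra.
  exact: (@filterlim_plus R_AbsRing R_NormedModule
    (2 ^ (2 * l).+1 * Series (chain_coef l)) (trig_part l K (PI / 2))).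
apply: (@filterlim_le R (at_left (PI / 2)) _ _ (fun=> _) _ (Finite _) _ hlim).
  by apply: filter_imp at_left_PI2; exact: hb.
exact: filterlim_const.
Qed.

(** The [beta] part of an integral: that of [x^(2j+2) / ((2j+2)! sin x)] over [[0, PI/2]] is
    [2 (-1)^(j+1)] times [lambda (2j+3) + secant_poly j]. *)
Definition secant_poly (j : nat) : R :=
  \Rsum_(0 <= i < j.+1) ((-1) ^ i.+1 * divpow (2 * i).+1 (PI / 2) * beta (2 * (j.+1 - i))).

Lemma is_lim_sinpow_prim_PI2 (j : nat) :
  is_lim_seq (fun K => \Rsum_(0 <= k < K) ((-1) ^ j.+1 * sinpow_prim j.+1 (INR (2 * k + 1)%N) (PI / 2)))
   (lambda (2 * j.+1).+1 + secant_poly j).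
Proof.
apply: (is_lim_seq_ext (fun K => (\Rsum_(0 <= k < K) / INR (2 * k + 1)%N ^ (2 * j.+1).+1) +
  \Rsum_(0 <= i < j.+1) ((-1) ^ i.+1 * divpow (2 * i).+1 (PI / 2) *
    (\Rsum_(0 <= k < K) ((-1) ^ k / INR (2 * k + 1)%N ^ (2 * (j.+1 - i))))))).
  move=> K.
  have -> : \Rsum_(0 <= i < j.+1) ((-1) ^ i.+1 * divpow (2 * i).+1 (PI / 2) *
    (\Rsum_(0 <= k < K) ((-1) ^ k / INR (2 * k + 1)%N ^ (2 * (j.+1 - i))))) =
    \Rsum_(0 <= k < K) \Rsum_(0 <= i < j.+1) ((-1) ^ i.+1 * divpow (2 * i).+1 (PI / 2) *
     ((-1) ^ k / INR (2 * k + 1)%N ^ (2 * (j.+1 - i)))).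
    by rewrite exchange_big_nat; apply: Rsum_ext => i _; rewrite Rsum_scal.
  by rewrite -Rsum_plus; apply: Rsum_ext => k _; rewrite sinpow_prim_PI2.
apply: is_lim_seq_plus'; first by apply: ex_series_Rsum; exact: ex_series_lambda.
apply: is_lim_Rsum => i hi; apply: is_lim_scal; apply: ex_series_Rsum; apply: ex_series_beta; lia.
Qed.

Lemma is_lim_osc_prim_PI2 (l : nat) : (0 < l)%N ->
  is_lim_seq (fun K => \Rsum_(0 <= n < K) osc_prim l n (PI / 2))
   (S_value l + \Rsum_(0 <= j < l) (kernel_coef_sum l j * (2 * (lambda (2 * j.+1).+1 + secant_poly j)))).
Proof.
move=> hl; have [A hA] := trig_part_limit hl.
have h1 : is_lim_seq (fun K => S_value l + trig_part l K (PI / 2)) 0.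
  apply/is_lim_seq_incr_1; apply: (@is_lim_seq_dom _ (fun K => A * / INR K.+1)).
    by move=> K; rewrite Rminus_0_r; exact: hA.
  rewrite -[0](Rmult_0_r A); apply: is_lim_scal.
  by have := @is_lim_seq_inv_affine 1 1 isT; apply: is_lim_seq_ext => n; rewrite mul1n addn1.
pose G K := \Rsum_(0 <= j < l) (kernel_coef_sum l j * (2 *
  (\Rsum_(0 <= k < K) ((-1) ^ j.+1 * sinpow_prim j.+1 (INR (2 * k + 1)%N) (PI / 2))))).
have h2 : is_lim_seq G
   (\Rsum_(0 <= j < l) (kernel_coef_sum l j * (2 * (lambda (2 * j.+1).+1 + secant_poly j)))).
  apply: is_lim_Rsum => j _; apply: is_lim_scal; apply: is_lim_scal; exact: is_lim_sinpow_prim_PI2.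
have h3 := is_lim_seq_plus' _ _ _ _ (is_lim_seq_minus' _ _ _ _ (is_lim_seq_const (S_value l)) h1) h2.
rewrite Rminus_0_r in h3; apply: is_lim_seq_ext h3 => K.
have -> : G K = \Rsum_(0 <= j < l) ((-1) ^ j.+1 * kernel_coef_sum l j *
     (2 * (\Rsum_(0 <= k < K) sinpow_prim j.+1 (INR (2 * k + 1)%N) (PI / 2)))).
  by apply: Rsum_ext => j _; rewrite -Rsum_scal; ring.
by rewrite /trig_part; ring.
Qed.

(** * Values of lambda at even integers *)

Lemma sum_sin_odd_alternating (M : nat) (x : R) :
  2 * cos x * (\Rsum_(0 <= k < M) ((-1) ^ k * sin (INR (2 * k + 1)%N * x))) =
  - (-1) ^ M * sin (2 * INR M * x).
Proof.
elim: M => [|M IH]; first by rewrite Rsum0 [INR 0]/= !(Rmult_0_r, Rmult_0_l) sin_0 Rmult_0_r.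
rewrite Rsum_S Rmult_plus_distr_l IH -(tech_pow_Rmult (-1) M).
set y := INR (2 * M + 1)%N * x.
have e : INR (2 * M + 1)%N = 2 * INR M + 1 by rewrite plus_INR mult_INR.
rewrite (_ : 2 * INR M * x = y - x); last by rewrite /y e; ring.
rewrite (_ : 2 * INR M.+1 * x = y + x); last by rewrite /y e S_INR; ring.
by rewrite sin_minus sin_plus; ring.
Qed.

Definition odd_kernel (l k : nat) (x : R) : R := (-1) ^ k * cos_kernel l (INR (2 * k + 1)%N) x.
Definition odd_kernel' (l k : nat) (x : R) : R := (-1) ^ k * sin_kernel l (INR (2 * k + 1)%N) x.

Lemma INR_odd_gt0 (k : nat) : 0 < INR (2 * k + 1)%N.
Proof. by apply: lt_0_INR; lia. Qed.

(** The series of [(-1)^k cos ((2k+1) x) / (2k+1)] is a square wave, constant on [[0, PI/2)], so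
    with [cos - 1] its sums tend to [0]. The jump at [PI / 2] imposes [b < PI / 2]. *)
Lemma odd_cos_fourier (b : R) : 0 < b < PI / 2 -> exists A, forall M x, (0 < M)%N -> 0 < x < b ->
  Rabs (\Rsum_(0 <= k < M) odd_kernel 0 k x) <= A * / INR M.
Proof.
move=> [hb0 hb]; have hpi := PI_RGT_0.
have hcb : 0 < cos b by apply: cos_gt_0; lra.
exists ((2 * (/ cos b) + (/ cos b * / cos b) * b) / 2) => M x hM hx.
have hM0 : 0 < INR M by apply: lt_0_INR; apply/ltP.
have hrange y : 0 <= y < b -> 0 < / cos y <= / cos b.
  move=> hy; have : cos b <= cos y by apply: cos_decr_1; lra.
  by move=> h; split; [apply: Rinv_0_lt_compat; lra | apply: Rinv_le_contravar].
have hcos y : 0 <= y < b -> 0 < cos y by move=> hy; apply: cos_gt_0; lra.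
pose g x := (-1) ^ M * (/ 2 * / cos x).
pose dg x := (-1) ^ M * (/ 2 * sin x * (/ cos x * / cos x)).
pose f x := \Rsum_(0 <= k < M) odd_kernel 0 k x.
have hd y : 0 <= y < b -> is_derive f y (0 + g y * sin (2 * INR M * y + 0)).
  move=> hy; have hc := hcos y hy.
  have -> : 0 + g y * sin (2 * INR M * y + 0) =
      \Rsum_(0 <= k < M) (- ((-1) ^ k * sin (INR (2 * k + 1)%N * y))).
    have := sum_sin_odd_alternating M y; rewrite -Rsum_opp; set s := \Rsum_(_ <= _ < _) _ => h.
    have -> : s = - (-1) ^ M * sin (2 * INR M * y) / (2 * cos y) by rewrite -h; field; lra.
    by rewrite /g Rplus_0_r; field; lra.
  apply: (@is_derive_Rsum M (odd_kernel 0) (fun k y => - ((-1) ^ k * sin (INR (2 * k + 1)%N * y)))) => k _.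
  have -> : - ((-1) ^ k * sin (INR (2 * k + 1)%N * y)) = (-1) ^ k * - sin_kernel 0 (INR (2 * k + 1)%N) y.
    by rewrite /sin_kernel /sin_rem Rsum0 muln0 /=; field.
  apply: is_derive_scal; apply: is_derive_cos_kernel; exact: INR_odd_gt0.
have f0 : f 0 = 0 by apply: Rsum_const0 => k _; rewrite /odd_kernel cos_kernel_at0; ring.
have hf : continuity_pt f 0 by apply: is_derive_continuity_pt (hd 0 _); lra.
have -> : (2 * / cos b + / cos b * / cos b * b) / 2 * / INR M =
  0 * b + (2 * (/ cos b) + (/ cos b * / cos b) * b) / (2 * INR M) by field; lra.
apply: (@oscillation_bound f (fun=> 0) g dg b (/ cos b) (/ cos b * / cos b) 0 (2 * INR M) 0) => //.
- lra.
- by move=> y hy; apply: hd; lra.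
- move=> y hy; have hc := hcos y (ltac:(lra)); rewrite /g /dg; apply: is_derive_scal.
  by auto_derive; [lra | field; lra].
- by move=> y hy; rewrite Rabs_R0; lra.
- move=> y hy; have h := hrange y (ltac:(lra)); rewrite /g Rabs_mult pow_1_abs Rmult_1_l Rabs_pos_eq; lra.
move=> y hy; have h := hrange y (ltac:(lra)); rewrite /dg Rabs_mult pow_1_abs Rmult_1_l.
rewrite Rabs_mult (Rabs_pos_eq (/ cos _ * _)); last by nra.
have : Rabs (/ 2 * sin y) <= 1 by apply: Rabs_le; have := SIN_bound y; lra.
have := Rabs_pos (/ 2 * sin y).
move: h; set p := / cos y; set q := / cos b; set r := Rabs _ => - [h1 h2] h3 h4.
have : p * p <= q * q by nra.
have : 0 <= p * p by nra.
nra.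
Qed.

(** Integrating the square wave [2 l + 1] times: the Taylor remainders of the sines sum to zero,
    which is why the expansion of the sine series is exact. *)
Lemma is_lim_odd_kernel' (l : nat) (x : R) : 0 < x < PI / 2 ->
  is_lim_seq (fun M => \Rsum_(0 <= k < M) odd_kernel' l.+1 k x) 0.
Proof.
move=> hx; pose b := (x + PI / 2) / 2.
have hb : x < b < PI / 2 by rewrite /b; lra.
have [A hA] := @odd_cos_fourier b (ltac:(lra)).
apply/is_lim_seq_incr_1.
apply: (@is_lim_seq_dom _ (fun M => A * b ^ (2 * l).+1 * / INR M.+1)); last first.
  rewrite -[0](Rmult_0_r (A * b ^ (2 * l).+1)); apply: is_lim_scal.
  by have := @is_lim_seq_inv_affine 1 1 isT; apply: is_lim_seq_ext => n; rewrite mul1n addn1.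
move=> M; rewrite Rminus_0_r.
pose C l x := \Rsum_(0 <= k < M.+1) odd_kernel l k x.
pose S l x := \Rsum_(0 <= k < M.+1) odd_kernel' l k x.
have hC k y : is_derive (C k.+1) y (- S k.+1 y).
  rewrite /C /S Rsum_opp; apply: (@is_derive_Rsum M.+1 (odd_kernel k.+1) (fun i y => - odd_kernel' k.+1 i y)) => i _.
  rewrite /odd_kernel' Ropp_mult_distr_r; apply: is_derive_scal; apply: is_derive_cos_kernel; exact: INR_odd_gt0.
have hS k y : is_derive (S k.+1) y (C k y).
  apply: (@is_derive_Rsum M.+1 (odd_kernel' k.+1) (odd_kernel k)) => i _.
  by apply: is_derive_scal; apply: is_derive_sin_kernel; exact: INR_odd_gt0.
have := @iterated_primitive_bound C S b (A * / INR M.+1) _ _ _ _ _ l x.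
rewrite (_ : A * / INR M.+1 * b ^ (2 * l).+1 = A * b ^ (2 * l).+1 * / INR M.+1); last by ring.
case=> //; last by lra.
- move=> k; split; apply: Rsum_const0 => i _.
    by rewrite /odd_kernel cos_kernel_at0; ring.
  by rewrite /odd_kernel' sin_kernel_at0; ring.
- by move=> k; split; [apply: is_derive_continuity_pt (hC k 0) | apply: is_derive_continuity_pt (hS k 0)].
by move=> y hy; apply: hA.
Qed.

Lemma sin_kernel_decomp (l : nat) (lam x : R) : 0 < lam ->
  sin_kernel l.+1 lam x = sin (lam * x) / lam ^ (2 * l.+1) -
    \Rsum_(0 <= i < l.+1) ((-1) ^ i * divpow (2 * i).+1 x * / lam ^ (2 * (l - i)).+1).
Proof.
move=> hl; rewrite /sin_kernel /sin_rem.
have -> : \Rsum_(0 <= i < l.+1) ((-1) ^ i * divpow (2 * i).+1 x * / lam ^ (2 * (l - i)).+1) =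
   (\Rsum_(0 <= i < l.+1) ((-1) ^ i * divpow (2 * i).+1 (lam * x))) / lam ^ (2 * l.+1).
  rewrite /Rdiv [RHS]Rmult_comm Rsum_scal; apply: Rsum_ext => j /andP [_ hj].
  rewrite /divpow (_ : (2 * l.+1)%N = ((2 * j).+1 + (2 * (l - j)).+1)%N); last by lia.
  rewrite (pow_add lam) Rpow_mult_distr.
  have h1 : lam ^ (2 * j).+1 <> 0 by apply: pow_nonzero; lra.
  have h2 : lam ^ (2 * (l - j)).+1 <> 0 by apply: pow_nonzero; lra.
  have h3 := INR_fact_neq_0 (2 * j).+1%N.
  by field.
have h : lam ^ (2 * l.+1) <> 0 by apply: pow_nonzero; lra.
by field.
Qed.

Lemma series_odd_sin (l : nat) (x : R) : 0 < x < PI / 2 ->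
  Series (fun k => (-1) ^ k * (sin (INR (2 * k + 1)%N * x) / INR (2 * k + 1)%N ^ (2 * l.+1))) =
  \Rsum_(0 <= i < l.+1) ((-1) ^ i * divpow (2 * i).+1 x * beta (2 * (l - i)).+1).
Proof.
move=> hx; apply: Series_Rsum.
have h1 : is_lim_seq (fun M => \Rsum_(0 <= i < l.+1) ((-1) ^ i * divpow (2 * i).+1 x *
     (\Rsum_(0 <= k < M) ((-1) ^ k / INR (2 * k + 1)%N ^ (2 * (l - i)).+1))))
   (\Rsum_(0 <= i < l.+1) ((-1) ^ i * divpow (2 * i).+1 x * beta (2 * (l - i)).+1)).
  by apply: is_lim_Rsum => i _; apply: is_lim_scal; apply: ex_series_Rsum; exact: ex_series_beta.
have h2 := is_lim_seq_plus' _ _ _ _ (is_lim_odd_kernel' l hx) h1.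
rewrite Rplus_0_l in h2; apply: is_lim_seq_ext h2 => M.
have -> : \Rsum_(0 <= i < l.+1) ((-1) ^ i * divpow (2 * i).+1 x *
     (\Rsum_(0 <= k < M) ((-1) ^ k / INR (2 * k + 1)%N ^ (2 * (l - i)).+1))) =
  \Rsum_(0 <= k < M) \Rsum_(0 <= i < l.+1) ((-1) ^ i * divpow (2 * i).+1 x *
     ((-1) ^ k / INR (2 * k + 1)%N ^ (2 * (l - i)).+1)).
  by rewrite exchange_big_nat; apply: Rsum_ext => i _; rewrite Rsum_scal.
rewrite -Rsum_plus; apply: Rsum_ext => k _.
rewrite /odd_kernel' sin_kernel_decomp; last exact: INR_odd_gt0.
have -> : \Rsum_(0 <= i < l.+1) ((-1) ^ i * divpow (2 * i).+1 x *
     ((-1) ^ k / INR (2 * k + 1)%N ^ (2 * (l - i)).+1)) =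
  (-1) ^ k * (\Rsum_(0 <= i < l.+1) ((-1) ^ i * divpow (2 * i).+1 x * / INR (2 * k + 1)%N ^ (2 * (l - i)).+1)).
  by rewrite Rsum_scal; apply: Rsum_ext => i _; rewrite /Rdiv; ring.
by ring.
Qed.

(** At [PI / 2] the sines become [(-1) ^ k] and the signs square away. The polynomial identity holds
    below [PI / 2] only, so both sides are compared through left limits. *)
Lemma lambda_even (l : nat) :
  lambda (2 * l.+1) =
  \Rsum_(0 <= i < l.+1) ((-1) ^ i * divpow (2 * i).+1 (PI / 2) * beta (2 * (l - i)).+1).
Proof.
have h1 : filterlim (fun x =>
    Series (fun k => (-1) ^ k * (sin (INR (2 * k + 1)%N * x) / INR (2 * k + 1)%N ^ (2 * l.+1))))
    (at_left (PI / 2)) (locally (lambda (2 * l.+1))).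
  apply: (@tannery R (at_left (PI / 2)) _
    (fun x k => (-1) ^ k * (sin (INR (2 * k + 1)%N * x) / INR (2 * k + 1)%N ^ (2 * l.+1)))
    (fun k => / INR (2 * k + 1)%N ^ (2 * l.+1)) (fun k => / INR (2 * k + 1)%N ^ (2 * l.+1))).
  - by apply: ex_series_lambda; lia.
  - exists (mkposreal _ Rlt_0_1) => x _ _ k; rewrite Rabs_mult pow_1_abs Rmult_1_l Rabs_mult.
    have h : 0 < / INR (2 * k + 1)%N ^ (2 * l.+1) by apply/Rinv_0_lt_compat/pow_lt; exact: INR_odd_gt0.
    rewrite (Rabs_pos_eq (/ _)); last lra.
    rewrite -[X in _ <= X]Rmult_1_l; apply: Rmult_le_compat_r; first lra.
    by apply: Rabs_le; have := SIN_bound (INR (2 * k + 1)%N * x); lra.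
  move=> k; have hk := INR_odd_gt0 k.
  have -> : / INR (2 * k + 1)%N ^ (2 * l.+1) =
     (-1) ^ k * (sin (INR (2 * k + 1)%N * (PI / 2)) / INR (2 * k + 1)%N ^ (2 * l.+1)).
    rewrite sin_odd_PI2 /Rdiv -Rmult_assoc -Rpow_mult_distr (_ : -1 * -1 = 1); last by ring.
    by rewrite pow1 Rmult_1_l.
  apply: (@is_derive_at_left (fun x => (-1) ^ k * (sin (INR (2 * k + 1)%N * x) / INR (2 * k + 1)%N ^ (2 * l.+1)))
     _ ((-1) ^ k * (INR (2 * k + 1)%N * cos (INR (2 * k + 1)%N * (PI / 2)) / INR (2 * k + 1)%N ^ (2 * l.+1)))).
  by apply: is_derive_scal; apply: is_derive_div_cst; auto_derive => //; ring.
pose p x := \Rsum_(0 <= i < l.+1) ((-1) ^ i * divpow (2 * i).+1 x * beta (2 * (l - i)).+1).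
have h2 : filterlim p (at_left (PI / 2)) (locally (p (PI / 2))).
  apply: (@is_derive_at_left p _ (\Rsum_(0 <= i < l.+1) ((-1) ^ i * beta (2 * (l - i)).+1 * divpow (2 * i) (PI / 2)))).
  apply: (@is_derive_Rsum l.+1 (fun i x => (-1) ^ i * divpow (2 * i).+1 x * beta (2 * (l - i)).+1)
    (fun i x => (-1) ^ i * beta (2 * (l - i)).+1 * divpow (2 * i) x)) => i _.
  have e t : (-1) ^ i * beta (2 * (l - i)).+1 * divpow (2 * i).+1 t =
     (-1) ^ i * divpow (2 * i).+1 t * beta (2 * (l - i)).+1 by ring.
  apply: (is_derive_ext _ _ _ _ e).
  by apply: is_derive_scal; exact: is_derive_divpow.
apply: (@filterlim_locally_unique R R_AbsRing R_NormedModule (at_left (PI / 2)) _ _ _ _ h1).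
apply: (filterlim_ext_loc _ _ _ h2).
by apply: filter_imp at_left_PI2 => x hx; rewrite series_odd_sin.
Qed.

(** * Single sums and convolutions *)

Definition harm (n : nat) : R := \Rsum_(0 <= k < n) / INR k.+1.
Definition alt_harm (n : nat) : R := \Rsum_(0 <= k < n) ((-1) ^ k.+1 * / INR k.+1).

Lemma harmS (n : nat) : harm n.+1 = harm n + / INR n.+1.
Proof. exact: Rsum_S. Qed.

Lemma alt_harmS (n : nat) : alt_harm n.+1 = alt_harm n + (-1) ^ n.+1 * / INR n.+1.
Proof. exact: Rsum_S. Qed.

Lemma pow_m1_even (n : nat) : (-1) ^ (2 * n) = 1.
Proof. by rewrite pow_mult (_ : (-1) ^ 2 = 1) ?pow1 //; ring. Qed.

Lemma pow_m1_sq (n : nat) : (-1) ^ n * (-1) ^ n = 1.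
Proof. by rewrite -Rpow_mult_distr (_ : -1 * -1 = 1) ?pow1 //; ring. Qed.

Lemma INR_doubleS (n : nat) : INR (2 * n).+2 = 2 * INR n.+1.
Proof. by rewrite (_ : (2 * n).+2 = (2 * n.+1)%N) ?mult_INR //; lia. Qed.

Lemma alt_harm_even (n : nat) : alt_harm (2 * n) = harm n - harm (2 * n).
Proof.
elim: n => [|n IH]; first by rewrite muln0 /alt_harm /harm !Rsum0; ring.
rewrite (_ : (2 * n.+1)%N = (2 * n).+2); last by lia.
rewrite !alt_harmS !harmS IH -!(tech_pow_Rmult (-1)) pow_m1_even.
rewrite INR_doubleS.
have h := not_0_INR n.+1 (Nat.neq_succ_0 n).
have h2 := not_0_INR (2 * n).+1 (Nat.neq_succ_0 _).
by field.
Qed.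

Lemma harm_le (n : nat) : 0 <= harm n <= INR n.
Proof.
elim: n => [|n IH]; first by rewrite /harm Rsum0 /=; lra.
rewrite harmS S_INR; have h := @INR_ge1 n.+1 (ltn0Sn _); rewrite S_INR in h.
have : 0 < / (INR n + 1) <= 1.
  by split; [apply: Rinv_0_lt_compat; lra | rewrite -Rinv_1; apply: Rinv_le_contravar; lra].
lra.
Qed.

Lemma is_lim_alt_harm : is_lim_seq alt_harm (- ln 2).
Proof.
suff h M : Rabs (ln (1 + 1) + alt_harm M) <= / INR M.+1.
  apply: (@is_lim_seq_dom _ (fun M => / INR M.+1)).
    by move=> M; rewrite /Rminus Ropp_involutive Rplus_comm; exact: h.
  by have := @is_lim_seq_inv_affine 1 1 isT; apply: is_lim_seq_ext => n; rewrite mul1n addn1.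
pose q x := \Rsum_(0 <= k < M) ((-1) ^ k.+1 * (x ^ k.+1 / INR k.+1)).
pose f x := ln (1 + x) + q x.
pose df x := (-1) ^ M * (x ^ M / (1 + x)).
have hd x : 0 <= x <= 1 -> is_derive f x (df x).
  move=> hx; have -> : df x = / (1 + x) + \Rsum_(0 <= k < M) ((-1) ^ k.+1 * x ^ k).
    rewrite /df; elim: (M) => [|m IH]; first by rewrite Rsum0 /=; field; lra.
    by rewrite Rsum_S -Rplus_assoc -IH -!tech_pow_Rmult; field; lra.
  apply: (@is_derive_plus R_AbsRing); first by auto_derive; [lra | field; lra].
  apply: (@is_derive_Rsum M (fun k x => (-1) ^ k.+1 * (x ^ k.+1 / INR k.+1)) (fun k x => (-1) ^ k.+1 * x ^ k)) => k _.
  apply: is_derive_scal.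
  have -> : x ^ k = INR k.+1 * 1 * x ^ k / INR k.+1 by field; exact: not_0_INR.
  apply: is_derive_div_cst; apply: (is_derive_pow (fun y => y) k.+1 x 1); exact: is_derive_id.
(* Compare [f] with [x ^ M.+1 / M.+1], whose derivative [x ^ M] dominates that of [f]. *)
have hs s : s = 1 \/ s = -1 -> s * f 1 <= / INR M.+1.
  move=> hs; pose g x := x ^ M.+1 / INR M.+1 - s * f x.
  have hg x : 0 <= x <= 1 -> is_derive g x (x ^ M - s * df x).
    move=> hx; apply: (@is_derive_minus R_AbsRing); last by apply: is_derive_scal; exact: hd.
    have -> : x ^ M = INR M.+1 * 1 * x ^ M / INR M.+1 by field; exact: not_0_INR.
    apply: is_derive_div_cst; apply: (is_derive_pow (fun y => y) M.+1 x 1); exact: is_derive_id.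
  have [c [hc1 hc2]] := MVT_cor2 g _ 0 1 Rlt_0_1 (fun x h => proj1 (is_derive_Reals _ _ _) (hg x h)).
  have g0 : g 0 = 0.
    rewrite /g /f Rplus_0_r ln_1 /q Rsum_const0; first by rewrite /= /Rdiv; ring.
    by move=> k _; rewrite /= /Rdiv; ring.
  have : 0 <= c ^ M - s * df c.
    have hp := pow_le c M (ltac:(lra)).
    have : Rabs (s * df c) <= c ^ M.
      rewrite Rabs_mult /df Rabs_mult pow_1_abs Rmult_1_l.
      have -> : Rabs s = 1 by case: hs => ->; rewrite ?Rabs_R1 // Rabs_left; lra.
      rewrite Rmult_1_l Rabs_pos_eq; last by apply: Rdiv_le_0_compat; lra.
      have : / (1 + c) <= 1 by rewrite -Rinv_1; apply: Rinv_le_contravar; lra.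
      have : 0 < / (1 + c) by apply: Rinv_0_lt_compat; lra.
      rewrite /Rdiv; nra.
    by move=> /Rabs_le_between; lra.
  have : g 1 = / INR M.+1 - s * f 1 by rewrite /g pow1 /Rdiv Rmult_1_l.
  lra.
have -> : ln (1 + 1) + alt_harm M = f 1.
  by rewrite /f /q; congr (_ + _); apply: Rsum_ext => k _; rewrite pow1 /Rdiv Rmult_1_l.
by apply: Rabs_le; have := hs 1 (or_introl erefl); have := hs (-1) (or_intror erefl); lra.
Qed.

Lemma eta1 : eta 1 = ln 2.
Proof.
apply: Series_Rsum; have h := @is_lim_scal _ (-1) _ is_lim_alt_harm.
rewrite (_ : -1 * - ln 2 = ln 2) in h; last by ring.
apply: is_lim_seq_ext h => M; rewrite /alt_harm Rsum_scal; apply: Rsum_ext => k _.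
by rewrite pow_1 -tech_pow_Rmult; ring.
Qed.

(** Closed form of [sum_(m >= 1) (-1)^m / (n + m)], a tail of the series for [ln 2]. *)
Definition alt_shift (n : nat) : R := (-1) ^ n * (- ln 2 - alt_harm n).

Lemma sum_alt_shift (n M : nat) :
  \Rsum_(0 <= m < M) ((-1) ^ m.+1 * / (INR n + INR m.+1)) =
  (-1) ^ n * (alt_harm (n + M) - alt_harm n).
Proof.
elim: M => [|M IH]; first by rewrite Rsum0 addn0; ring.
rewrite Rsum_S IH addnS alt_harmS -addnS plus_INR pow_add.
transitivity ((-1) ^ n * (alt_harm (n + M) - alt_harm n) +
  ((-1) ^ n * (-1) ^ n) * (-1) ^ M.+1 * / (INR n + INR M.+1)); last by ring.
by rewrite pow_m1_sq; ring.
Qed.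

Lemma is_lim_alt_shift (n : nat) :
  is_lim_seq (fun M => \Rsum_(0 <= m < M) ((-1) ^ m.+1 * / (INR n + INR m.+1))) (alt_shift n).
Proof.
apply: (is_lim_seq_ext (fun M => (-1) ^ n * (alt_harm (n + M) - alt_harm n))).
  by move=> M; rewrite sum_alt_shift.
apply: is_lim_scal; apply: is_lim_seq_minus'; last exact: is_lim_seq_const.
have := is_lim_alt_harm; move/(is_lim_seq_incr_n _ n); apply: is_lim_seq_ext => M.
by rewrite addnC.
Qed.

Lemma sum_alt_shift_bound (x : R) (M : nat) : 0 <= x ->
  Rabs (\Rsum_(0 <= m < M) ((-1) ^ m.+1 * / (x + INR m.+1))) <= 1.
Proof.
move=> hx; have hp k : 0 < x + INR k.+1 by have := lt_0_INR k.+1 (Nat.lt_0_succ k); lra.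
have -> : \Rsum_(0 <= m < M) ((-1) ^ m.+1 * / (x + INR m.+1)) =
   - \Rsum_(0 <= m < M) ((-1) ^ m * / (x + INR m.+1)).
  by rewrite Rsum_opp; apply: Rsum_ext => m _; rewrite -tech_pow_Rmult; ring.
rewrite Rabs_Ropp; apply: Rle_trans (@alternating_bound (fun m => / (x + INR m.+1)) 0 M _ _) _.
- by move=> k; apply/Rlt_le/Rinv_0_lt_compat.
- by move=> k; apply: Rinv_le_contravar => //; rewrite (S_INR k.+1); lra.
by rewrite -Rinv_1; apply: Rinv_le_contravar; rewrite /=; lra.
Qed.

(** Left as a series: its value involves [ln 2] or [PI] according to the parity of [m], but it will
    cancel unevaluated. *)
Definition odd_shift (m : nat) : R := Series (fun j => (-1) ^ j * / INR (2 * j + m.+3)%N).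

Lemma is_lim_odd_shift (m : nat) :
  is_lim_seq (fun M => \Rsum_(0 <= j < M) ((-1) ^ j * / INR (2 * j + m.+3)%N)) (odd_shift m).
Proof.
apply: ex_series_Rsum; apply: ex_series_ext (@ex_series_alternating_affine 2 m.+3 1 _ _ _) => // k.
by rewrite pow_1.
Qed.

Lemma odd_shift_sum_bound (m M : nat) :
  Rabs (\Rsum_(0 <= j < M) ((-1) ^ j * / INR (2 * j + m.+3)%N)) <= 1.
Proof.
apply: Rle_trans (@alternating_bound (fun j => / INR (2 * j + m.+3)%N) 0 M _ _) _.
- by move=> k; apply/Rlt_le/Rinv_0_lt_compat; apply: lt_0_INR; lia.
- by move=> k; apply: Rinv_le_contravar; [apply: lt_0_INR; lia | apply: le_INR; lia].
by rewrite -Rinv_1; apply: Rinv_le_contravar; [lra | apply: INR_ge1; lia].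
Qed.

(** The integral of [(1 - cos (n x)) / sin x] over [[0, PI/2]], a harmonic sum whose shape depends
    on the parity of [n]. *)
Definition cosec_value (n : nat) : R := cosec_prim n (PI / 2).

Lemma cosec_value1 : cosec_value 1 = ln 2.
Proof.
rewrite /cosec_value /cosec_prim (_ : PI / 2 / 2 = PI / 4); last by field.
have h2 : 0 < sqrt 2 by apply: sqrt_lt_R0; lra.
have : ln 2 = ln (sqrt 2) + ln (sqrt 2) by rewrite -ln_mult // sqrt_sqrt //; lra.
rewrite cos_PI4 ln_div ?ln_1 //; lra.
Qed.

Lemma cosec_value_bound (n : nat) : Rabs (cosec_value n) <= 4 * INR n.
Proof.
rewrite /cosec_value; elim/nat_ind2: n => [||n IH].
- by rewrite /= Rabs_R0 Rmult_0_r; exact: Rle_refl.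
- rewrite -/(cosec_value 1) cosec_value1.
  rewrite Rabs_pos_eq; last by rewrite -ln_1; apply: ln_le; lra.
  have := ln_lt_2; have h : ln 2 < 2 by rewrite -[X in _ < X]ln_exp; apply: ln_increasing; [lra | have := exp_ineq1 2; lra].
  rewrite /=; lra.
rewrite [cosec_prim _ _]/= -/(INR n.+1).
apply: Rle_trans (Rabs_triang _ _) _.
have h1 := @INR_ge1 n.+1 (ltn0Sn _).
have h : Rabs (2 * ((1 - cos (INR n.+1 * (PI / 2))) / INR n.+1)) <= 4.
  have hc := COS_bound (INR n.+1 * (PI / 2)).
  have hi : 0 < / INR n.+1 <= 1.
    by split; [apply: Rinv_0_lt_compat; lra | rewrite -Rinv_1; apply: Rinv_le_contravar; lra].
  move: hi; rewrite /Rdiv; move: (/ INR _) (cos _) hc => i c hc hi.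
  have h0 : 0 <= (1 - c) * i <= 2 by split; [apply: Rmult_le_pos; lra | nra].
  by rewrite Rabs_pos_eq; lra.
have := S_INR n.+1; have := S_INR n; lra.
Qed.

Lemma cosec_value_even (n : nat) : cosec_value (2 * n) = 2 * harm (2 * n) - harm n.
Proof.
elim: n => [|n IH]; first by rewrite muln0 /cosec_value /harm Rsum0 /=; ring.
rewrite (_ : (2 * n.+1)%N = (2 * n).+2); last by lia.
have -> : cosec_value (2 * n).+2 = cosec_value (2 * n) +
    2 * ((1 - cos (INR (2 * n).+1 * (PI / 2))) / INR (2 * n).+1) by [].
rewrite IH !harmS.
have -> : cos (INR (2 * n).+1 * (PI / 2)) = 0 by rewrite -(cos_odd_PI2 n) addn1.
rewrite INR_doubleS.
have h := not_0_INR n.+1 (Nat.neq_succ_0 n).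
have h2 := not_0_INR (2 * n).+1 (Nat.neq_succ_0 _).
by field.
Qed.

Lemma cosec_value_odd (n : nat) : cosec_value (2 * n).+1 = ln 2 + harm n - alt_harm n.
Proof.
elim: n => [|n IH]; first by rewrite muln0 cosec_value1 /harm /alt_harm !Rsum0; ring.
rewrite (_ : (2 * n.+1).+1 = (2 * n).+3); last by lia.
have -> : cosec_value (2 * n).+3 = cosec_value (2 * n).+1 +
    2 * ((1 - cos (INR (2 * n).+2 * (PI / 2))) / INR (2 * n).+2) by [].
rewrite IH harmS alt_harmS.
rewrite INR_doubleS.
have -> : cos (2 * INR n.+1 * (PI / 2)) = (-1) ^ n.+1.
  rewrite (_ : 2 * INR n.+1 * (PI / 2) = INR n.+1 * PI); last by field.
  elim: n.+1 => [|m IHm]; first by rewrite /= Rmult_0_l cos_0.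
  by rewrite S_INR Rmult_plus_distr_r Rmult_1_l neg_cos IHm -tech_pow_Rmult; ring.
have h := not_0_INR n.+1 (Nat.neq_succ_0 n).
by field.
Qed.

(** * Partial fractions *)

Lemma geometric_mixed (X Y : R) (w : nat) :
  (Y + X) * (\Rsum_(0 <= p < w) ((- X) ^ p * Y ^ (w - p.+1))) = Y ^ w - (- X) ^ w.
Proof.
elim: w => [|w IH]; first by rewrite Rsum0 /=; ring.
rewrite Rsum_S subnn Rmult_1_r.
have -> : \Rsum_(0 <= p < w) ((- X) ^ p * Y ^ (w.+1 - p.+1)) =
  Y * (\Rsum_(0 <= p < w) ((- X) ^ p * Y ^ (w - p.+1))).
  rewrite Rsum_scal; apply: Rsum_ext => p /andP [_ hp].
  by rewrite (_ : (w.+1 - p.+1)%N = (w - p.+1).+1) -?tech_pow_Rmult; [ring | lia].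
rewrite Rmult_plus_distr_l (_ : (Y + X) * (Y * _) = Y * ((Y + X) *
  (\Rsum_(0 <= p < w) ((- X) ^ p * Y ^ (w - p.+1))))); last by ring.
by rewrite IH -!tech_pow_Rmult; ring.
Qed.

(** A geometric sum in [- 1 / x] and [1 / y]; its odd number [2 l + 1] of terms makes the two powers
    add. *)
Lemma partial_fraction_alt (x y : R) (l : nat) : x <> 0 -> y <> 0 -> x + y <> 0 ->
  \Rsum_(0 <= p < (2 * l).+1) ((-1) ^ p * (/ x ^ p.+1 * / y ^ ((2 * l).+1 - p))) =
  (/ x ^ (2 * l).+1 + / y ^ (2 * l).+1) / (x + y).
Proof.
move=> hx hy hxy.
have h := geometric_mixed (/ x) (/ y) (2 * l).+1.
have -> : \Rsum_(0 <= p < (2 * l).+1) ((-1) ^ p * (/ x ^ p.+1 * / y ^ ((2 * l).+1 - p))) =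
  / x * / y * (\Rsum_(0 <= p < (2 * l).+1) ((- / x) ^ p * (/ y) ^ ((2 * l).+1 - p.+1))).
  rewrite Rsum_scal; apply: Rsum_ext => p /andP [_ hp].
  rewrite (_ : ((2 * l).+1 - p)%N = ((2 * l).+1 - p.+1).+1); last by lia.
  rewrite (_ : - / x = -1 * / x); last by ring.
  by rewrite Rpow_mult_distr !pow_inv -!tech_pow_Rmult !Rinv_mult; ring.
move: h; set s := \Rsum_(_ <= _ < _) _ => h.
have e : (- / x) ^ (2 * l).+1 = - / x ^ (2 * l).+1.
  rewrite (_ : - / x = -1 * / x); last by ring.
  by rewrite Rpow_mult_distr pow_inv -tech_pow_Rmult pow_m1_even; ring.
rewrite e pow_inv in h.
have -> : / x ^ (2 * l).+1 + / y ^ (2 * l).+1 = (/ y + / x) * s by rewrite h; ring.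
by field.
Qed.

Lemma partial_fraction (x y : R) (l : nat) : x <> 0 -> y <> 0 -> x - y <> 0 ->
  \Rsum_(0 <= p < (2 * l).+1) (/ x ^ p.+1 * / y ^ ((2 * l).+1 - p)) =
  (/ y ^ (2 * l).+1 - / x ^ (2 * l).+1) / (x - y).
Proof.
move=> hx hy hxy.
have hx' : - x <> 0 by move=> h; apply: hx; lra.
have hxy' : - x + y <> 0 by move=> h; apply: hxy; lra.
have := partial_fraction_alt l hx' hy hxy'.
have hm n : / (- x) ^ n = (-1) ^ n * / x ^ n.
  rewrite (_ : - x = -1 * x); last by ring.
  rewrite Rpow_mult_distr Rinv_mult -pow_inv; congr (_ ^ _ * _); field; lra.
have -> : \Rsum_(0 <= p < (2 * l).+1) ((-1) ^ p * (/ (- x) ^ p.+1 * / y ^ ((2 * l).+1 - p))) =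
   - \Rsum_(0 <= p < (2 * l).+1) (/ x ^ p.+1 * / y ^ ((2 * l).+1 - p)).
  rewrite Rsum_opp; apply: Rsum_ext => p _; rewrite hm.
  transitivity (((-1) ^ p * (-1) ^ p) * (-1 * / x ^ p.+1 * / y ^ ((2 * l).+1 - p))).
    by rewrite -(tech_pow_Rmult (-1) p); ring.
  by rewrite pow_m1_sq; ring.
rewrite hm -(tech_pow_Rmult (-1)) pow_m1_even => h.
rewrite -[LHS]Ropp_involutive h; move: (/ x ^ _) (/ y ^ _) => a b.
by field; split=> // h'; apply: hxy; lra.
Qed.

(** The three weights run over all [N], the even [N] and the odd [N], each with the sign of the
    summation index; the final comparison takes place at each [N ^ (2 l + 1)]. *)
Definition wt (l n : nat) : R := (-1) ^ n * / INR n.+1 ^ (2 * l).+1.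
Definition wt2 (l n : nat) : R := (-1) ^ n * / (2 * INR n.+1) ^ (2 * l).+1.
Definition wt_odd (l n : nat) : R := (-1) ^ n * / INR (2 * n + 1)%N ^ (2 * l).+1.

Lemma wt_bounds (l n : nat) : (0 < l)%N ->
  [/\ Rabs (wt l n) <= / INR n.+1 ^ 3, Rabs (wt2 l n) <= / INR n.+1 ^ 3
    & Rabs (wt_odd l n) <= / INR n.+1 ^ 3].
Proof.
move=> hl; have h1 := @INR_ge1 n.+1 (ltn0Sn _).
have h x : INR n.+1 <= x -> Rabs ((-1) ^ n * / x ^ (2 * l).+1) <= / INR n.+1 ^ 3.
  move=> hx; rewrite Rabs_mult pow_1_abs Rmult_1_l Rabs_pos_eq; last first.
    by apply/Rlt_le/Rinv_0_lt_compat/pow_lt; lra.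
  apply: (Rle_trans _ (/ x ^ 3)); first by apply: (inv_pow_le _ _).2; [lra | lia].
  by apply: (inv_pow_decr _ _).2; lra.
by split; apply: h; [lra | lra | apply: le_INR; lia].
Qed.

Lemma weighted_bound (C : R) (a f : nat -> R) (n : nat) :
  (forall n, Rabs (a n) <= / INR n.+1 ^ 3) -> (forall n, Rabs (f n) <= C * INR n.+1) ->
  Rabs (a n * f n) <= C * / INR n.+1 ^ 2.
Proof.
move=> ha hf; rewrite Rabs_mult.
have h : 0 < INR n.+1 by apply: lt_0_INR; lia.
apply: Rle_trans (Rmult_le_compat _ _ _ _ (Rabs_pos _) (Rabs_pos _) (ha n) (hf n)) _.
by apply: Req_le; field; lra.
Qed.

Lemma ex_series_scal_inv_sq (C : R) : ex_series (fun n => C * / INR n.+1 ^ 2).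
Proof. by apply: (@ex_series_scal R_AbsRing R_NormedModule); exact: ex_series_inv_pow. Qed.

Lemma is_lim_weighted (C : R) (a f : nat -> R) :
  (forall n, Rabs (a n) <= / INR n.+1 ^ 3) -> (forall n, Rabs (f n) <= C * INR n.+1) ->
  is_lim_seq (fun M => \Rsum_(0 <= n < M) (a n * f n)) (Series (fun n => a n * f n)).
Proof.
move=> ha hf; apply: ex_series_Rsum; apply: ex_series_le_abs (ex_series_scal_inv_sq C) => n.
exact: weighted_bound.
Qed.

(** The inner sums will be alternating: only conditionally convergent, yet bounded by one at every
    truncation, which is the domination required. *)
Lemma is_lim_weighted_dom (a : nat -> R) (f : nat -> nat -> R) (c : nat -> R) :
  (forall n, Rabs (a n) <= / INR n.+1 ^ 3) -> (forall M n, Rabs (f M n) <= 1) ->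
  (forall n, is_lim_seq (fun M => f M n) (c n)) ->
  is_lim_seq (fun M => \Rsum_(0 <= n < M) (a n * f M n)) (Series (fun n => a n * c n)).
Proof.
move=> ha hf hc; apply: (@tannery_finite (fun M n => a n * f M n) _ (fun n => 1 * / INR n.+1 ^ 2)).
- exact: ex_series_scal_inv_sq.
- move=> M n _; apply: (@weighted_bound 1 a (f M) n ha) => k; apply: Rle_trans (hf M k) _.
  by have := @INR_ge1 k.+1 (ltn0Sn _); lra.
by move=> n; apply: is_lim_scal.
Qed.

Lemma alt_shift_bound (n : nat) : Rabs (alt_shift n) <= 1.
Proof.
have h := is_lim_seq_le _ _ _ _ _ (is_lim_seq_abs _ _ (@is_lim_alt_shift n)) (is_lim_seq_const 1).
apply: h.
by move=> M; apply: sum_alt_shift_bound; exact: pos_INR.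
Qed.

Lemma Rsum_mul (M : nat) (f g : nat -> R) :
  (\Rsum_(0 <= n < M) f n) * (\Rsum_(0 <= m < M) g m) =
  \Rsum_(0 <= n < M) \Rsum_(0 <= m < M) (f n * g m).
Proof.
rewrite Rmult_comm Rsum_scal; apply: Rsum_ext => n _.
by rewrite Rmult_comm Rsum_scal.
Qed.

(** Done on a finite square, where sums may be exchanged freely; the order of summation of the
    infinite double series never matters. *)
Lemma convolution_collapse (M l : nat) (sg x y : nat -> R) :
  (forall n, 0 < x n) -> (forall n, 0 < y n) ->
  \Rsum_(0 <= p < (2 * l).+1) ((-1) ^ p *
    ((\Rsum_(0 <= n < M) (sg n * / x n ^ p.+1)) * (\Rsum_(0 <= m < M) (sg m * / y m ^ ((2 * l).+1 - p))))) =
  (\Rsum_(0 <= n < M) (sg n * / x n ^ (2 * l).+1 * (\Rsum_(0 <= m < M) (sg m * / (x n + y m))))) +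
  (\Rsum_(0 <= m < M) (sg m * / y m ^ (2 * l).+1 * (\Rsum_(0 <= n < M) (sg n * / (x n + y m))))).
Proof.
move=> hx hy.
transitivity (\Rsum_(0 <= n < M) \Rsum_(0 <= m < M)
   (sg n * sg m * ((/ x n ^ (2 * l).+1 + / y m ^ (2 * l).+1) / (x n + y m)))).
  transitivity (\Rsum_(0 <= p < (2 * l).+1) \Rsum_(0 <= n < M) \Rsum_(0 <= m < M)
    ((-1) ^ p * (sg n * / x n ^ p.+1 * (sg m * / y m ^ ((2 * l).+1 - p))))).
    apply: Rsum_ext => p _; rewrite Rsum_mul Rsum_scal; apply: Rsum_ext => n _.
    by rewrite Rsum_scal.
  rewrite exchange_big_nat; apply: Rsum_ext => n _.
  rewrite exchange_big_nat; apply: Rsum_ext => m _.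
  have := hx n; have := hy m => hym hxn.
  rewrite -(@partial_fraction_alt (x n) (y m) l); try lra.
  by rewrite Rsum_scal; apply: Rsum_ext => p _; ring.
transitivity ((\Rsum_(0 <= n < M) \Rsum_(0 <= m < M) (sg n * / x n ^ (2 * l).+1 * (sg m * / (x n + y m)))) +
  (\Rsum_(0 <= n < M) \Rsum_(0 <= m < M) (sg m * / y m ^ (2 * l).+1 * (sg n * / (x n + y m))))).
  rewrite -Rsum_plus; apply: Rsum_ext => n _; rewrite -Rsum_plus; apply: Rsum_ext => m _.
  by rewrite /Rdiv; ring.
congr (_ + _); first by apply: Rsum_ext => n _; rewrite Rsum_scal.
by rewrite exchange_big_nat; apply: Rsum_ext => n _; rewrite Rsum_scal.
Qed.

Definition wseries (a f : nat -> R) : R := Series (fun n => a n * f n).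

Lemma wt_le (l : nat) : (0 < l)%N -> forall n, Rabs (wt l n) <= / INR n.+1 ^ 3.
Proof. by move=> hl n; case: (wt_bounds n hl). Qed.
Lemma wt2_le (l : nat) : (0 < l)%N -> forall n, Rabs (wt2 l n) <= / INR n.+1 ^ 3.
Proof. by move=> hl n; case: (wt_bounds n hl). Qed.
Lemma wt_odd_le (l : nat) : (0 < l)%N -> forall n, Rabs (wt_odd l n) <= / INR n.+1 ^ 3.
Proof. by move=> hl n; case: (wt_bounds n hl). Qed.

Lemma is_lim_mult (u v : nat -> R) (x y : R) :
  is_lim_seq u x -> is_lim_seq v y -> is_lim_seq (fun M => u M * v M) (x * y).
Proof. exact: is_lim_seq_mult'. Qed.

Lemma is_lim_opp (u : nat -> R) (x : R) : is_lim_seq u x -> is_lim_seq (fun M => - u M) (- x).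
Proof. by move=> h; apply: ((is_lim_seq_opp u (Finite x)).1 h). Qed.

Lemma neg_alt_sum (x : R) (M : nat) :
  \Rsum_(0 <= m < M) ((-1) ^ m * / (x + INR m.+1)) =
  - \Rsum_(0 <= m < M) ((-1) ^ m.+1 * / (x + INR m.+1)).
Proof. by rewrite Rsum_opp; apply: Rsum_ext => m _; rewrite -tech_pow_Rmult; ring. Qed.

Lemma neg_alt_sum_bound (x : R) (M : nat) : 0 <= x ->
  Rabs (\Rsum_(0 <= m < M) ((-1) ^ m * / (x + INR m.+1))) <= 1.
Proof. by move=> hx; rewrite neg_alt_sum Rabs_Ropp; exact: sum_alt_shift_bound. Qed.

Lemma is_lim_neg_alt_sum (n : nat) :
  is_lim_seq (fun M => \Rsum_(0 <= m < M) ((-1) ^ m * / (INR n + INR m.+1))) (- alt_shift n).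
Proof.
have := is_lim_opp (@is_lim_alt_shift n); apply: is_lim_seq_ext => M.
by rewrite neg_alt_sum.
Qed.

Lemma wseries_opp (a f : nat -> R) : wseries a (fun n => - f n) = - wseries a f.
Proof.
rewrite /wseries -Series_opp; apply: Series_ext => n; ring.
Qed.

(** With [x = n] and [y = m] both halves of [convolution_collapse] coincide, whence the factor
    two. *)
Lemma eta_convolution (l : nat) : (0 < l)%N ->
  \Rsum_(0 <= p < (2 * l).+1) ((-1) ^ p * (eta p.+1 * eta ((2 * l).+1 - p))) =
  - 2 * wseries (wt l) (fun n => alt_shift n.+1).
Proof.
move=> hl; pose sg n := (-1) ^ n; pose x n := INR n.+1.
have h1 : is_lim_seq (fun M => \Rsum_(0 <= p < (2 * l).+1) ((-1) ^ p *
    ((\Rsum_(0 <= n < M) (sg n * / x n ^ p.+1)) * (\Rsum_(0 <= m < M) (sg m * / x m ^ ((2 * l).+1 - p))))))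
   (\Rsum_(0 <= p < (2 * l).+1) ((-1) ^ p * (eta p.+1 * eta ((2 * l).+1 - p)))).
  apply: is_lim_Rsum => p hp; apply: is_lim_scal; apply: is_lim_mult; apply: ex_series_Rsum; apply: ex_series_eta => //.
  by rewrite subn_gt0.
have h2 : is_lim_seq (fun M => \Rsum_(0 <= n < M) (wt l n * (\Rsum_(0 <= m < M) ((-1) ^ m * / (x n + INR m.+1)))))
    (wseries (wt l) (fun n => - alt_shift n.+1)).
  apply: (is_lim_weighted_dom (wt_le hl)) => [M n|n]; last exact: is_lim_neg_alt_sum.
  apply: neg_alt_sum_bound; exact: pos_INR.
have := is_lim_seq_plus' _ _ _ _ h2 h2; rewrite wseries_opp => h3.
apply: (is_lim_seq_uniq h1); rewrite (_ : -2 * _ = - wseries (wt l) (fun n => alt_shift n.+1) + - wseries (wt l) (fun n => alt_shift n.+1)); last by ring.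
apply: is_lim_seq_ext h3 => M.
rewrite convolution_collapse; try by move=> n; apply: lt_0_INR; lia.
congr (_ + _); apply: Rsum_ext => n _; congr (_ * _); apply: Rsum_ext => m _.
by rewrite Rplus_comm.
Qed.

(** The powers of two replace [x] by [2 n], and [x + y = 2 n + m] is not symmetric: summing over [m]
    gives [alt_shift] at an even place, summing over [n] gives [odd_shift]. *)
Lemma eta_convolution2 (l : nat) : (0 < l)%N ->
  \Rsum_(0 <= p < (2 * l).+1) ((-1) ^ p * (/ 2 ^ p.+1 * eta p.+1 * eta ((2 * l).+1 - p))) =
  - wseries (wt2 l) (fun n => alt_shift (2 * n.+1)) + wseries (wt l) odd_shift.
Proof.
move=> hl; pose sg n := (-1) ^ n; pose x n := 2 * INR n.+1; pose y n := INR n.+1.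
have h1 : is_lim_seq (fun M => \Rsum_(0 <= p < (2 * l).+1) ((-1) ^ p *
    ((\Rsum_(0 <= n < M) (sg n * / x n ^ p.+1)) * (\Rsum_(0 <= m < M) (sg m * / y m ^ ((2 * l).+1 - p))))))
   (\Rsum_(0 <= p < (2 * l).+1) ((-1) ^ p * (/ 2 ^ p.+1 * eta p.+1 * eta ((2 * l).+1 - p)))).
  apply: is_lim_Rsum => p hp; apply: is_lim_scal; apply: is_lim_mult; last first.
    by apply: ex_series_Rsum; apply: ex_series_eta; rewrite subn_gt0.
  have := @is_lim_scal _ (/ 2 ^ p.+1) _ (ex_series_Rsum (ex_series_eta (ltn0Sn p))).
  apply: is_lim_seq_ext => M; rewrite Rsum_scal; apply: Rsum_ext => n _.
  by rewrite /x Rpow_mult_distr Rinv_mult /sg; ring.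
have h2 : is_lim_seq (fun M => \Rsum_(0 <= n < M) (wt2 l n * (\Rsum_(0 <= m < M) ((-1) ^ m * / (x n + INR m.+1)))))
    (wseries (wt2 l) (fun n => - alt_shift (2 * n.+1))).
  apply: (is_lim_weighted_dom (wt2_le hl)) => [M n|n].
    by apply: neg_alt_sum_bound; rewrite /x; have := pos_INR n.+1; lra.
  by have := @is_lim_neg_alt_sum (2 * n.+1)%N; rewrite mult_INR.
have h3 : is_lim_seq (fun M => \Rsum_(0 <= m < M) (wt l m * (\Rsum_(0 <= n < M) ((-1) ^ n * / INR (2 * n + m.+3)%N))))
    (wseries (wt l) odd_shift).
  apply: (is_lim_weighted_dom (wt_le hl)) => [M n|n]; last exact: is_lim_odd_shift.
  exact: odd_shift_sum_bound.
have := is_lim_seq_plus' _ _ _ _ h2 h3; rewrite wseries_opp => h4.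
apply: (is_lim_seq_uniq h1); apply: is_lim_seq_ext h4 => M.
have hy n : 0 < y n by apply: lt_0_INR; lia.
rewrite convolution_collapse //; last by move=> n; have := hy n; rewrite /x /y; lra.
congr (_ + _); apply: Rsum_ext => n _; congr (_ * _); apply: Rsum_ext => m _.
congr (_ * / _); rewrite /x /y (_ : (2 * m + n.+3)%N = (2 * m.+1 + n.+1)%N); last by lia.
by rewrite plus_INR mult_INR.
Qed.

Lemma INR_odd (n : nat) : INR (2 * n + 1)%N = 2 * INR n + 1.
Proof. by rewrite plus_INR mult_INR. Qed.

(** The sum of two odd denominators is twice an integer; this [1/2] absorbs the doubling by
    symmetry. *)
Lemma beta_convolution (l : nat) : (0 < l)%N ->
  \Rsum_(0 <= p < (2 * l).+1) ((-1) ^ p * (beta p.+1 * beta ((2 * l).+1 - p))) =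
  - wseries (wt_odd l) alt_shift.
Proof.
move=> hl; pose sg n := (-1) ^ n; pose x n := INR (2 * n + 1)%N.
have h1 : is_lim_seq (fun M => \Rsum_(0 <= p < (2 * l).+1) ((-1) ^ p *
    ((\Rsum_(0 <= n < M) (sg n * / x n ^ p.+1)) * (\Rsum_(0 <= m < M) (sg m * / x m ^ ((2 * l).+1 - p))))))
   (\Rsum_(0 <= p < (2 * l).+1) ((-1) ^ p * (beta p.+1 * beta ((2 * l).+1 - p)))).
  apply: is_lim_Rsum => p hp; apply: is_lim_scal; apply: is_lim_mult; apply: ex_series_Rsum; apply: ex_series_beta => //.
  by rewrite subn_gt0.
have h2 : is_lim_seq (fun M => \Rsum_(0 <= n < M) (wt_odd l n * (\Rsum_(0 <= m < M) ((-1) ^ m * / (INR n + INR m.+1)))))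
    (wseries (wt_odd l) (fun n => - alt_shift n)).
  apply: (is_lim_weighted_dom (wt_odd_le hl)) => [M n|n]; last exact: is_lim_neg_alt_sum.
  apply: neg_alt_sum_bound; exact: pos_INR.
rewrite wseries_opp in h2; apply: (is_lim_seq_uniq h1); apply: is_lim_seq_ext h2 => M.
rewrite convolution_collapse; try by move=> n; exact: INR_odd_gt0.
have e n m : / (x n + x m) = / 2 * / (INR n + INR m.+1).
  by rewrite -Rinv_mult; congr (/ _); rewrite /x !INR_odd S_INR; ring.
rewrite -Rsum_plus; apply: Rsum_ext => n _; rewrite /wt_odd -/(x n) /sg.
have -> : \Rsum_(0 <= m < M) ((-1) ^ m * / (x n + x m)) = / 2 * (\Rsum_(0 <= m < M) ((-1) ^ m * / (INR n + INR m.+1))).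
  by rewrite Rsum_scal; apply: Rsum_ext => m _; rewrite e; ring.
have -> : \Rsum_(0 <= m < M) ((-1) ^ m * / (x m + x n)) = / 2 * (\Rsum_(0 <= m < M) ((-1) ^ m * / (INR n + INR m.+1))).
  by rewrite Rsum_scal; apply: Rsum_ext => m _; rewrite (Rplus_comm (x m)) e; ring.
by field; apply: pow_nonzero; have := INR_odd_gt0 n; rewrite /x; lra.
Qed.

(** * Alternating double zeta values *)

Lemma zeta_bar_partialE (a b N : nat) :
  zeta_bar_partial a b N =
  \Rsum_(0 <= n < N) \Rsum_(0 <= m < n) ((-1) ^ n.+1 * / INR n.+1 ^ a * / INR m.+1 ^ b).
Proof.
rewrite /zeta_bar_partial big_add1; apply: Rsum_ext => n _.
rewrite big_add1; apply: Rsum_ext => m _; rewrite [RHS]Rmult_assoc -Rinv_mult //.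
Qed.

Lemma is_lim_tail (a : nat -> R) (m : nat) : ex_series a ->
  is_lim_seq (fun N => \Rsum_(m <= n < N) a n) (Series a - \Rsum_(0 <= n < m) a n).
Proof.
move=> ha; have h := is_lim_seq_minus' _ _ _ _ (ex_series_Rsum ha) (is_lim_seq_const (\Rsum_(0 <= n < m) a n)).
apply: (is_lim_seq_ext_loc _ _ _ _ h); exists m => N /leP hN.
by rewrite (@Rsum_cat 0 m N) //; ring.
Qed.

(** With the alternating sum placed inside, its tail beyond [m] is at most its first term, so the
    outer terms are dominated by [1 / m^2] even when both exponents are one. *)
Lemma is_lim_zeta_bar (a b : nat) : (0 < a)%N -> (0 < b)%N ->
  is_lim_seq (zeta_bar_partial a b) (zeta_bar a b).
Proof.
move=> ha hb.
have hex : ex_series (fun n => (-1) ^ n.+1 * / INR n.+1 ^ a).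
  have := @ex_series_opp R_AbsRing R_NormedModule _ (ex_series_eta ha).
  apply: ex_series_ext => n; rewrite /opp /= -/(INR n.+1); ring.
have h : is_lim_seq (zeta_bar_partial a b) (Series (fun m => / INR m.+1 ^ b *
    (Series (fun n => (-1) ^ n.+1 * / INR n.+1 ^ a) - \Rsum_(0 <= n < m.+1) ((-1) ^ n.+1 * / INR n.+1 ^ a)))).
  apply: (is_lim_seq_ext (fun N => \Rsum_(0 <= m < N) (/ INR m.+1 ^ b *
     (\Rsum_(m.+1 <= n < N) ((-1) ^ n.+1 * / INR n.+1 ^ a))))).
    move=> N; rewrite zeta_bar_partialE Rsum_triangle; apply: Rsum_ext => m _.
    by rewrite Rsum_scal; apply: Rsum_ext => n _; ring.
  apply: (@tannery_finite (fun N m => / INR m.+1 ^ b *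
     (\Rsum_(m.+1 <= n < N) ((-1) ^ n.+1 * / INR n.+1 ^ a))) _ (fun m => / INR m.+1 ^ 2)).
  - exact: ex_series_inv_pow.
  - move=> N m _.
    have h1 := @INR_ge1 m.+1 (ltn0Sn _); have h2 := @INR_ge1 m.+2 (ltn0Sn _).
    have hbd : Rabs (\Rsum_(m.+1 <= n < N) ((-1) ^ n.+1 * / INR n.+1 ^ a)) <= / INR m.+1.
      have -> : \Rsum_(m.+1 <= n < N) ((-1) ^ n.+1 * / INR n.+1 ^ a) =
          - \Rsum_(m.+1 <= n < N) ((-1) ^ n * / INR n.+1 ^ a).
        by rewrite Rsum_opp; apply: Rsum_ext => n _; rewrite -tech_pow_Rmult; ring.
      rewrite Rabs_Ropp.
      apply: Rle_trans (@alternating_bound (fun n => / INR n.+1 ^ a) m.+1 N _ _) _.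
      + move=> k; apply/Rlt_le/Rinv_0_lt_compat/pow_lt; apply: lt_0_INR; lia.
      + move=> k; apply: (inv_pow_decr _ _).2; split; [exact: INR_ge1 | apply: le_INR; lia].
      apply: Rle_trans (inv_pow_le h2 ha).2 _; rewrite pow_1.
      by apply: Rinv_le_contravar; [lra | apply: le_INR; lia].
    rewrite Rabs_mult; have h3 := inv_pow_le h1 hb; rewrite pow_1 in h3.
    rewrite Rabs_pos_eq; last lra.
    have -> : / INR m.+1 ^ 2 = / INR m.+1 * / INR m.+1 by field; lra.
    by apply: Rmult_le_compat; [lra | exact: Rabs_pos | lra | exact: hbd].
  by move=> m; apply: is_lim_scal; exact: is_lim_tail.
by rewrite /zeta_bar (is_lim_seq_unique _ _ h).
Qed.

Lemma zeta_bar_one (l : nat) : (0 < l)%N ->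
  zeta_bar (2 * l).+1 1 = - wseries (wt l) harm.
Proof.
move=> hl; apply: (is_lim_seq_uniq (is_lim_zeta_bar (ltn0Sn _) (ltn0Sn 0))).
have := is_lim_opp (@is_lim_weighted 1 (wt l) harm (wt_le hl) _).
rewrite -/(wseries _ _) => h; have {}h := h _.
have hb n : Rabs (harm n) <= 1 * INR n.+1.
  by have := harm_le n; rewrite S_INR => hh; rewrite Rabs_pos_eq; lra.
apply: is_lim_seq_ext (h hb) => N; rewrite zeta_bar_partialE Rsum_opp; apply: Rsum_ext => n _.
rewrite /wt /harm -Rsum_scal -(tech_pow_Rmult (-1)).
have -> : \Rsum_(0 <= m < n) / INR m.+1 ^ 1 = \Rsum_(0 <= m < n) / INR m.+1 by apply: Rsum_ext => m _; rewrite pow_1.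
by ring.
Qed.

Lemma harm_diff (n : nat) :
  \Rsum_(0 <= m < n) / (2 * INR n.+1 - INR m.+1) = harm (2 * n).+1 - harm n.+1.
Proof.
have h d k : harm (k + d) - harm k = \Rsum_(0 <= m < d) / INR (k + d - m)%N.
  elim: d k => [|d IH] k; first by rewrite addn0 Rsum0; ring.
  rewrite big_nat_recl // subn0 addnS harmS.
  have -> : \Rsum_(0 <= i < d) / INR ((k + d).+1 - i.+1)%N = harm (k + d) - harm k by rewrite IH.
  by ring.
rewrite (_ : (2 * n).+1 = (n.+1 + n)%N); last by lia.
rewrite h; apply: Rsum_ext => m /andP [_ hm]; congr (/ _).
rewrite (_ : (n.+1 + n - m)%N = (2 * n.+1 - m.+1)%N); last by lia.
by rewrite minus_INR ?mult_INR //; lia.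
Qed.

(** Apply [partial_fraction] with [x = 2 n] and [y = m]; the powers of two make [x] twice the larger
    index. Summing over [n > m] gives the [odd_shift] of [eta_convolution2], summing over [m < n] a
    finite harmonic sum. *)
Lemma zeta_bar_convolution (l : nat) : (0 < l)%N ->
  \Rsum_(0 <= p < (2 * l).+1) (/ 2 ^ p.+1 * zeta_bar p.+1 ((2 * l).+1 - p)) =
  wseries (wt l) odd_shift + wseries (wt2 l) (fun n => harm (2 * n).+1 - harm n.+1).
Proof.
move=> hl.
have h1 : is_lim_seq (fun N => \Rsum_(0 <= p < (2 * l).+1) (/ 2 ^ p.+1 * zeta_bar_partial p.+1 ((2 * l).+1 - p) N))
   (\Rsum_(0 <= p < (2 * l).+1) (/ 2 ^ p.+1 * zeta_bar p.+1 ((2 * l).+1 - p))).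
  by apply: is_lim_Rsum => p hp; apply: is_lim_scal; apply: is_lim_zeta_bar => //; rewrite subn_gt0.
have hb n : Rabs (harm (2 * n).+1 - harm n.+1) <= 2 * INR n.+1.
  have := harm_le (2 * n).+1; have := harm_le n.+1.
  have : INR (2 * n).+1 <= 2 * INR n.+1 by rewrite -INR_doubleS; apply: le_INR; lia.
  by move=> *; apply: Rabs_le; have := pos_INR n.+1; lra.
have h2 := @is_lim_weighted 2 (wt2 l) _ (wt2_le hl) hb.
have h3 : is_lim_seq (fun N => \Rsum_(0 <= m < N) (wt l m *
    (\Rsum_(0 <= j < N - m.+1) ((-1) ^ j * / INR (2 * j + m.+3)%N))))
    (wseries (wt l) odd_shift).
  apply: (is_lim_weighted_dom (wt_le hl)) => [M n|n]; first exact: odd_shift_sum_bound.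
  apply/(is_lim_seq_incr_n _ n.+1); have := @is_lim_odd_shift n; apply: is_lim_seq_ext => M.
  by rewrite addnK.
apply: (is_lim_seq_uniq h1); apply: is_lim_seq_ext (is_lim_seq_plus' _ _ _ _ h3 h2) => N.
have hx n : 0 < INR n.+1 by apply: lt_0_INR; lia.
have hxy n m : (m < n)%N -> 0 < 2 * INR n.+1 - INR m.+1.
  by move=> hm; have : INR m.+1 <= INR n.+1 by [apply: le_INR; lia]; have := hx n; lra.
transitivity (\Rsum_(0 <= n < N) \Rsum_(0 <= m < n) ((-1) ^ n.+1 *
    ((/ INR m.+1 ^ (2 * l).+1 - / (2 * INR n.+1) ^ (2 * l).+1) / (2 * INR n.+1 - INR m.+1)))); last first.
  transitivity (\Rsum_(0 <= p < (2 * l).+1) \Rsum_(0 <= n < N) \Rsum_(0 <= m < n)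
     ((-1) ^ n.+1 * (/ (2 * INR n.+1) ^ p.+1 * / INR m.+1 ^ ((2 * l).+1 - p)))); last first.
    apply: Rsum_ext => p _; rewrite zeta_bar_partialE Rsum_scal; apply: Rsum_ext => n _.
    rewrite Rsum_scal; apply: Rsum_ext => m _; rewrite (Rpow_mult_distr 2) Rinv_mult; ring.
  rewrite [RHS]exchange_big_nat; apply: Rsum_ext => n _.
  rewrite [RHS]exchange_big_nat; apply: Rsum_ext => m /andP [_ hm].
  have := hxy n m hm; have := hx n; have := hx m => ha hb' hc.
  by rewrite -partial_fraction ?Rsum_scal //; lra.
symmetry; transitivity ((\Rsum_(0 <= n < N) \Rsum_(0 <= m < n)
     ((-1) ^ n.+1 * / INR m.+1 ^ (2 * l).+1 * / (2 * INR n.+1 - INR m.+1))) +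
   (\Rsum_(0 <= n < N) \Rsum_(0 <= m < n) (wt2 l n * / (2 * INR n.+1 - INR m.+1)))).
  rewrite -Rsum_plus; apply: Rsum_ext => n _; rewrite -Rsum_plus; apply: Rsum_ext => m _.
  by rewrite /wt2 /Rdiv -(tech_pow_Rmult (-1)); ring.
congr (_ + _); last by apply: Rsum_ext => n _; rewrite -harm_diff Rsum_scal.
rewrite Rsum_triangle; apply: Rsum_ext => m _.
rewrite -{1}[m.+1]add0n big_addn Rsum_scal; apply: Rsum_ext => j _.
rewrite /wt (_ : (j + m.+1).+1 = (j + m.+2)%N); last by lia.
have -> : 2 * INR (j + m.+2)%N - INR m.+1 = INR (2 * j + m.+3)%N.
  have : INR ((2 * j + m.+3) + m.+1)%N = INR (2 * (j + m.+2))%N by congr INR; lia.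
  by rewrite plus_INR mult_INR [INR 2]/=; lra.
by rewrite pow_add -!(tech_pow_Rmult (-1)); ring.
Qed.

(** * Cancellation of the coefficients *)

(** The coefficients grow logarithmically at most; a linear bound is easier to obtain and suffices
    against weights of cubic decay. *)
Definition linear_growth (f : nat -> R) : Prop := exists C, forall n, Rabs (f n) <= C * INR n.+1.

Lemma linear_growth_plus (f g : nat -> R) :
  linear_growth f -> linear_growth g -> linear_growth (fun n => f n + g n).
Proof.
move=> [C hC] [D hD]; exists (C + D) => n; apply: Rle_trans (Rabs_triang _ _) _.
by have := hC n; have := hD n; lra.
Qed.

Lemma linear_growth_scal (c : R) (f : nat -> R) :
  linear_growth f -> linear_growth (fun n => c * f n).
Proof.
move=> [C hC]; exists (Rabs c * C) => n; rewrite Rabs_mult Rmult_assoc.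
by apply: Rmult_le_compat_l; [exact: Rabs_pos | exact: hC].
Qed.

Lemma linear_growth_bounded (C : R) (f : nat -> R) : (forall n, Rabs (f n) <= C) -> linear_growth f.
Proof.
move=> h; exists C => n; apply: Rle_trans (h n) _.
have h0 : 0 <= C by apply: Rle_trans (Rabs_pos _) (h n).
by have := @INR_ge1 n.+1 (ltn0Sn _); nra.
Qed.

Definition cubic_decay (a : nat -> R) : Prop := forall n, Rabs (a n) <= / INR n.+1 ^ 3.

Lemma is_lim_wseries (a f : nat -> R) : cubic_decay a -> linear_growth f ->
  is_lim_seq (fun M => \Rsum_(0 <= n < M) (a n * f n)) (wseries a f).
Proof. by move=> ha [C hC]; exact: is_lim_weighted ha hC. Qed.

Lemma wseries_plus (a f g : nat -> R) : cubic_decay a -> linear_growth f -> linear_growth g ->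
  wseries a (fun n => f n + g n) = wseries a f + wseries a g.
Proof.
move=> ha hf hg; apply: (is_lim_seq_uniq (is_lim_wseries ha (linear_growth_plus hf hg))).
apply: is_lim_seq_ext (is_lim_seq_plus' _ _ _ _ (is_lim_wseries ha hf) (is_lim_wseries ha hg)) => M.
by rewrite -Rsum_plus; apply: Rsum_ext => n _; ring.
Qed.

Lemma wseries_scal (a f : nat -> R) (c : R) : wseries a (fun n => c * f n) = c * wseries a f.
Proof. by rewrite /wseries -Series_scal_l; apply: Series_ext => n; ring. Qed.

Lemma wseries_wt2 (l : nat) (f : nat -> R) :
  wseries (wt2 l) f = / 2 ^ (2 * l).+1 * wseries (wt l) f.
Proof.
rewrite /wseries -Series_scal_l; apply: Series_ext => n.
by rewrite /wt2 /wt Rpow_mult_distr Rinv_mult; ring.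
Qed.

Lemma is_lim_double (u : nat -> R) (x : R) :
  is_lim_seq u x -> is_lim_seq (fun M => u (2 * M)%N) x.
Proof.
move=> /is_lim_seq_eps h; apply/is_lim_seq_eps => e he; have [N hN] := h e he.
by exists N => n hn; apply: hN; lia.
Qed.

Lemma Rsum_double (f : nat -> R) (M : nat) :
  \Rsum_(0 <= n < 2 * M) f n = \Rsum_(0 <= h < M) (f (2 * h)%N + f (2 * h).+1).
Proof.
elim: M => [|M IH]; first by rewrite muln0 !Rsum0.
rewrite (_ : (2 * M.+1)%N = (2 * M).+2); last by lia.
by rewrite !Rsum_S IH Rplus_assoc.
Qed.

Lemma linear_growth_alt_inv : linear_growth (fun n => (-1) ^ n * / INR n.+1).
Proof.
apply: (@linear_growth_bounded 1) => n; rewrite Rabs_mult pow_1_abs Rmult_1_l.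
have h := @INR_ge1 n.+1 (ltn0Sn _).
rewrite Rabs_pos_eq; last by apply/Rlt_le/Rinv_0_lt_compat; lra.
by rewrite -Rinv_1; apply: Rinv_le_contravar; lra.
Qed.

Lemma linear_growth_even_inv : linear_growth (fun n => ((-1) ^ n - 1) * / INR n.+1).
Proof.
have h0 : linear_growth (fun n => / INR n.+1).
  have [C hC] := linear_growth_alt_inv; exists C => n.
  by have := hC n; rewrite Rabs_mult pow_1_abs Rmult_1_l.
have [C hC] := linear_growth_plus linear_growth_alt_inv (linear_growth_scal (-1) h0).
by exists C => n; have := hC n; rewrite (_ : _ + _ = ((-1) ^ n - 1) * / INR n.+1); last by ring.
Qed.

Lemma wseries_zeta (l : nat) : (0 < l)%N ->
  wseries (wt l) (fun n => (-1) ^ n * / INR n.+1) = zeta (2 * l).+2.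
Proof.
move=> hl; apply: Series_ext => n; rewrite /wt.
transitivity (((-1) ^ n * (-1) ^ n) * (/ INR n.+1 ^ (2 * l).+1 * / INR n.+1)); first by ring.
by rewrite pow_m1_sq Rmult_1_l -Rinv_mult Rmult_comm.
Qed.

(** Only odd [n] contribute, where [2 (n + 1)] is a multiple of four: this is the origin of the
    square of [2^-(2l+1)] in the coefficient of [zeta (2 l + 2)]. *)
Lemma wseries_zeta4 (l : nat) : (0 < l)%N ->
  wseries (wt2 l) (fun n => ((-1) ^ n - 1) * / INR n.+1) =
  / 2 ^ (2 * l).+1 * / 2 ^ (2 * l).+1 * zeta (2 * l).+2.
Proof.
move=> hl.
apply: (is_lim_seq_uniq (is_lim_double (is_lim_wseries (wt2_le hl) linear_growth_even_inv))).
have := @is_lim_scal _ (/ 2 ^ (2 * l).+1 * / 2 ^ (2 * l).+1) _ (ex_series_Rsum (@ex_series_inv_pow (2 * l).+2 _)).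
move=> h; apply: is_lim_seq_ext (h isT) => M; rewrite Rsum_double Rsum_scal; apply: Rsum_ext => h' _.
rewrite /wt2 -!(tech_pow_Rmult (-1)) pow_m1_even INR_doubleS Rminus_eq_0 Rmult_0_l Rmult_0_r Rplus_0_l.
have hn := not_0_INR h'.+1 (Nat.neq_succ_0 h').
rewrite (Rpow_mult_distr 2 (2 * _)) (Rpow_mult_distr 2 (INR _)) -(tech_pow_Rmult (INR _)).
have h1 : INR h'.+1 ^ (2 * l).+1 <> 0 by exact: pow_nonzero.
have h2 : 2 ^ (2 * l).+1 <> 0 by apply: pow_nonzero; lra.
by field.
Qed.

Lemma linear_growth_cosec : linear_growth (fun n => cosec_value n.+1).
Proof. by exists 4 => n; exact: cosec_value_bound. Qed.

Lemma linear_growth_cosec2 : linear_growth (fun n => cosec_value (2 * n.+1)).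
Proof.
by exists 8 => n; have := cosec_value_bound (2 * n.+1); rewrite mult_INR [INR 2]/=; lra.
Qed.

Lemma linear_growth_alt_shift (g : nat -> nat) : linear_growth (fun n => alt_shift (g n)).
Proof. by apply: (@linear_growth_bounded 1) => n; exact: alt_shift_bound. Qed.

Lemma linear_growth_harm : linear_growth harm.
Proof. by exists 1 => n; have := harm_le n; rewrite S_INR => h; rewrite Rabs_pos_eq; lra. Qed.

Lemma linear_growth_harm_diff : linear_growth (fun n => harm (2 * n).+1 - harm n.+1).
Proof.
exists 2 => n; have := harm_le (2 * n).+1; have := harm_le n.+1.
have : INR (2 * n).+1 <= 2 * INR n.+1 by rewrite -INR_doubleS; apply: le_INR; lia.
by move=> *; apply: Rabs_le; have := pos_INR n.+1; lra.
Qed.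

Lemma linear_growth1 : linear_growth (fun _ => 1).
Proof. by apply: (@linear_growth_bounded 1) => n; rewrite Rabs_R1; lra. Qed.

(** With [coef2] and [coef_odd], the coefficients of the three weights in the difference of the two
    sides of [S_value_convolutions]. They are nested sums of scalar multiples, one of them of the
    constant [1], to be split by [wseries_plus] and [wseries_scal]. *)
Definition coef (n : nat) : R :=
  -2 * cosec_value n.+1 + (2 * alt_shift n.+1 + (2 * harm n +
     (2 * ln 2 * 1 + 2 * ((-1) ^ n * / INR n.+1)))).

Definition coef2 (n : nat) : R :=
  2 * cosec_value (2 * n.+1) + (-2 * alt_shift (2 * n.+1) + (-2 * harm n +
     (-2 * (harm (2 * n).+1 - harm n.+1) + (-2 * ln 2 * 1 + (-5 * ((-1) ^ n * / INR n.+1) +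
      3 * (((-1) ^ n - 1) * / INR n.+1)))))).

Definition coef_odd (n : nat) : R := 2 * alt_shift n.

Lemma linear_growth_coef : linear_growth coef.
Proof.
repeat apply: linear_growth_plus; apply: linear_growth_scal.
- exact: linear_growth_cosec.
- exact: linear_growth_alt_shift.
- exact: linear_growth_harm.
- exact: linear_growth1.
- exact: linear_growth_alt_inv.
Qed.

Lemma linear_growth_coef2 : linear_growth coef2.
Proof.
repeat apply: linear_growth_plus; apply: linear_growth_scal.
- exact: linear_growth_cosec2.
- exact: linear_growth_alt_shift.
- exact: linear_growth_harm.
- exact: linear_growth_harm_diff.
- exact: linear_growth1.
- exact: linear_growth_alt_inv.
- exact: linear_growth_even_inv.
Qed.

Lemma alt_shift_sign (n : nat) : (-1) ^ n * alt_shift n = - ln 2 - alt_harm n.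
Proof. by rewrite /alt_shift -Rmult_assoc pow_m1_sq Rmult_1_l. Qed.

(** [N = 2 h + 1] occurs in [wt] at the index [2 h], with sign plus, and in [wt_odd] at the index
    [h], with sign [(-1) ^ h]. *)
Lemma coef_odd_index (h : nat) : coef (2 * h) + (-1) ^ h * coef_odd h = 0.
Proof.
rewrite /coef /coef_odd (_ : (-1) ^ h * (2 * alt_shift h) = 2 * ((-1) ^ h * alt_shift h)); last by ring.
rewrite alt_shift_sign cosec_value_odd /alt_shift alt_harmS alt_harm_even -(tech_pow_Rmult (-1)) pow_m1_even.
field; exact: not_0_INR.
Qed.

(** [N = 2 (h + 1)] occurs in [wt] at the index [2 h + 1], with sign minus, and in [wt2] at the
    index [h], with sign [(-1) ^ h]. *)
Lemma coef_even_index (h : nat) : - coef (2 * h).+1 + (-1) ^ h * coef2 h = 0.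
Proof.
rewrite /coef /coef2 (_ : (2 * h).+2 = (2 * h.+1)%N); last by lia.
rewrite cosec_value_even /alt_shift alt_harm_even pow_m1_even -(tech_pow_Rmult (-1)) pow_m1_even.
rewrite (_ : (2 * h.+1)%N = (2 * h).+2); last by lia.
rewrite !harmS INR_doubleS.
have hn := not_0_INR h.+1 (Nat.neq_succ_0 h); have hn2 := not_0_INR (2 * h).+1 (Nat.neq_succ_0 _).
(* The identity holds modulo [((-1)^h)^2 = 1], so the left side is exhibited as a multiple of that
   relation. *)
transitivity (((-1) ^ h * (-1) ^ h - 1) * (- 2 / INR h.+1)); last by rewrite pow_m1_sq; ring.
by field.
Qed.

(* Every part of the formula has the form [sum_N q_N / N^(2l+1)], and the
   coefficients cancel for each [N] separately. *)
Lemma euler_sums_balance (l : nat) : (0 < l)%N ->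
  wseries (wt l) coef + wseries (wt2 l) coef2 + wseries (wt_odd l) coef_odd = 0.
Proof.
move=> hl.
have h1 := is_lim_double (is_lim_wseries (wt_le hl) linear_growth_coef).
have h2 := is_lim_wseries (wt2_le hl) linear_growth_coef2.
have h3 := is_lim_wseries (wt_odd_le hl) (linear_growth_scal 2 (linear_growth_alt_shift id)).
apply: (is_lim_seq_uniq (is_lim_seq_plus' _ _ _ _ (is_lim_seq_plus' _ _ _ _ h1 h2) h3)).
apply: is_lim_seq_ext (is_lim_seq_const 0) => M.
rewrite Rsum_double -!Rsum_plus Rsum_const0 // => h _.
rewrite -/(coef_odd h) /wt /wt2 /wt_odd -(tech_pow_Rmult (-1)) pow_m1_even INR_doubleS addn1.
transitivity ((coef (2 * h) + (-1) ^ h * coef_odd h) * / INR (2 * h).+1 ^ (2 * l).+1 +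
  (- coef (2 * h).+1 + (-1) ^ h * coef2 h) * / (2 * INR h.+1) ^ (2 * l).+1); first by ring.
by rewrite coef_odd_index coef_even_index; ring.
Qed.

Lemma wseries_coef (l : nat) : (0 < l)%N ->
  wseries (wt l) coef = -2 * wseries (wt l) (fun n => cosec_value n.+1) +
   2 * wseries (wt l) (fun n => alt_shift n.+1) + 2 * wseries (wt l) harm +
   2 * ln 2 * eta (2 * l).+1 + 2 * zeta (2 * l).+2.
Proof.
move=> hl; have hw := wt_le hl.
have g1 := linear_growth_scal (-2) linear_growth_cosec.
have g2 := linear_growth_scal 2 (linear_growth_alt_shift succn).
have g3 := linear_growth_scal 2 linear_growth_harm.
have g4 := linear_growth_scal (2 * ln 2) linear_growth1.
have g5 := linear_growth_scal 2 linear_growth_alt_inv.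
have g45 := linear_growth_plus g4 g5; have g35 := linear_growth_plus g3 g45.
have g25 := linear_growth_plus g2 g35.
rewrite (wseries_plus hw g1 g25) (wseries_plus hw g2 g35) (wseries_plus hw g3 g45) (wseries_plus hw g4 g5).
rewrite !wseries_scal wseries_zeta //.
have -> : wseries (wt l) (fun=> 1) = eta (2 * l).+1.
  by apply: Series_ext => n; rewrite Rmult_1_r.
by ring.
Qed.

Lemma wseries_coef2 (l : nat) : (0 < l)%N ->
  wseries (wt2 l) coef2 = 2 * wseries (wt2 l) (fun n => cosec_value (2 * n.+1)) -
   2 * wseries (wt2 l) (fun n => alt_shift (2 * n.+1)) - 2 * wseries (wt2 l) harm -
   2 * wseries (wt2 l) (fun n => harm (2 * n).+1 - harm n.+1) -
   2 * ln 2 * (/ 2 ^ (2 * l).+1 * eta (2 * l).+1) -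
   5 * (/ 2 ^ (2 * l).+1 * zeta (2 * l).+2) +
   3 * (/ 2 ^ (2 * l).+1 * / 2 ^ (2 * l).+1 * zeta (2 * l).+2).
Proof.
move=> hl; have hw := wt2_le hl.
have g1 := linear_growth_scal 2 linear_growth_cosec2.
have g2 := linear_growth_scal (-2) (linear_growth_alt_shift (fun n => 2 * n.+1)%N).
have g3 := linear_growth_scal (-2) linear_growth_harm.
have g4 := linear_growth_scal (-2) linear_growth_harm_diff.
have g5 := linear_growth_scal (-2 * ln 2) linear_growth1.
have g6 := linear_growth_scal (-5) linear_growth_alt_inv.
have g7 := linear_growth_scal 3 linear_growth_even_inv.
have g67 := linear_growth_plus g6 g7; have g57 := linear_growth_plus g5 g67.
have g47 := linear_growth_plus g4 g57; have g37 := linear_growth_plus g3 g47.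
have g27 := linear_growth_plus g2 g37.
rewrite (wseries_plus hw g1 g27) (wseries_plus hw g2 g37) (wseries_plus hw g3 g47).
rewrite (wseries_plus hw g4 g57) (wseries_plus hw g5 g67) (wseries_plus hw g6 g7).
rewrite !wseries_scal wseries_zeta4 // (wseries_wt2 l (fun _ => 1)).
rewrite (wseries_wt2 l (fun n => (-1) ^ n * / INR n.+1)) wseries_zeta //.
have -> : wseries (wt l) (fun=> 1) = eta (2 * l).+1.
  by apply: Series_ext => n; rewrite Rmult_1_r.
by ring.
Qed.

Lemma osc_prim_wseries (l : nat) : (0 < l)%N ->
  S_value l + (\Rsum_(0 <= j < l) (kernel_coef_sum l j * (2 * (lambda (2 * j.+1).+1 + secant_poly j)))) =
  -2 * wseries (wt l) (fun n => cosec_value n.+1) +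
   2 * wseries (wt2 l) (fun n => cosec_value (2 * n.+1)).
Proof.
move=> hl; apply: (is_lim_seq_uniq (is_lim_osc_prim_PI2 hl)).
have h1 := @is_lim_scal _ (-2) _ (is_lim_wseries (wt_le hl) linear_growth_cosec).
have h2 := @is_lim_scal _ 2 _ (is_lim_wseries (wt2_le hl) linear_growth_cosec2).
apply: is_lim_seq_ext (is_lim_seq_plus' _ _ _ _ h1 h2) => K.
rewrite !Rsum_scal -Rsum_plus; apply: Rsum_ext => n _.
by rewrite /osc_prim /wt /wt2 /cosec_value -(tech_pow_Rmult (-1)) /Rdiv; ring.
Qed.

(** The two occurrences of [wseries (wt l) odd_shift] cancel, and what is left is
    [euler_sums_balance]; the factors [2 - / 2 ^ (2 * l)] combine a [wt] part with a [wt2] part. *)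
Lemma S_value_convolutions (l : nat) : (0 < l)%N ->
  S_value l =
  - (\Rsum_(0 <= j < l) (kernel_coef_sum l j * (2 * (lambda (2 * j.+1).+1 + secant_poly j)))) +
  ((\Rsum_(0 <= p < (2 * l).+1) ((-1) ^ p * (eta p.+1 * eta ((2 * l).+1 - p)))) -
   2 * (\Rsum_(0 <= p < (2 * l).+1) ((-1) ^ p * (/ 2 ^ p.+1 * eta p.+1 * eta ((2 * l).+1 - p))))) -
  ln 2 * eta (2 * l).+1 * (2 - / 2 ^ (2 * l)) +
  2 * (\Rsum_(0 <= p < (2 * l).+1) ((-1) ^ p * (beta p.+1 * beta ((2 * l).+1 - p)))) +
  (3 * / 2 ^ (2 * l).+1 - 2) * (1 - / 2 ^ (2 * l).+1) * zeta (2 * l).+2 +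
  (2 - / 2 ^ (2 * l)) * zeta_bar (2 * l).+1 1 +
  2 * (\Rsum_(0 <= p < (2 * l).+1) (/ 2 ^ p.+1 * zeta_bar p.+1 ((2 * l).+1 - p))).
Proof.
move=> hl; have := euler_sums_balance hl; have := osc_prim_wseries hl.
rewrite wseries_coef // wseries_coef2 // (wseries_scal _ alt_shift).
rewrite eta_convolution // eta_convolution2 // beta_convolution // zeta_bar_one // zeta_bar_convolution //.
rewrite (wseries_wt2 l harm).
have -> : / 2 ^ (2 * l) = 2 * / 2 ^ (2 * l).+1.
  by rewrite -(tech_pow_Rmult 2); field; apply: pow_nonzero; lra.
move: (\Rsum_(_ <= _ < _) _) => s h1 h2; lra.
Qed.

(** * The formula *)

Lemma eta_zeta (s : nat) : (1 < s)%N -> eta s = (1 - 2 * / 2 ^ s) * zeta s.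
Proof.
move=> hs; have hz := ex_series_Rsum (ex_series_inv_pow hs).
apply: (is_lim_seq_uniq (is_lim_double (ex_series_Rsum (ex_series_eta (ltnW hs))))).
have := is_lim_seq_minus' _ _ _ _ (is_lim_double hz) (@is_lim_scal _ (2 * / 2 ^ s) _ hz).
rewrite -/(zeta s) (_ : (1 - _) * _ = zeta s - 2 * / 2 ^ s * zeta s); last by ring.
apply: is_lim_seq_ext => M; rewrite !Rsum_double Rsum_scal -Rsum_minus; apply: Rsum_ext => h _.
rewrite -(tech_pow_Rmult (-1)) pow_m1_even INR_doubleS Rpow_mult_distr Rinv_mult; ring.
Qed.

Lemma lambda_zeta (s : nat) : (1 < s)%N -> lambda s = (1 - / 2 ^ s) * zeta s.
Proof.
move=> hs; have hz := ex_series_Rsum (ex_series_inv_pow hs).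
apply: (is_lim_seq_uniq (ex_series_Rsum (ex_series_lambda hs))).
have := is_lim_seq_minus' _ _ _ _ (is_lim_double hz) (@is_lim_scal _ (/ 2 ^ s) _ hz).
rewrite -/(zeta s) (_ : (1 - _) * _ = zeta s - / 2 ^ s * zeta s); last by ring.
apply: is_lim_seq_ext => M; rewrite !Rsum_double Rsum_scal -Rsum_minus; apply: Rsum_ext => h _.
rewrite INR_doubleS Rpow_mult_distr Rinv_mult addn1; ring.
Qed.

Lemma powerRZ2_neg (n : nat) : 2 ^Z (- Z.of_nat n) = / 2 ^ n.
Proof. by rewrite powerRZ_neg' pow_powerRZ. Qed.

Lemma powerRZ2_1sub (n : nat) : 2 ^Z (1 - Z.of_nat n) = 2 * / 2 ^ n.
Proof. by rewrite powerRZ_add; [rewrite -/(Z.sub _ _) powerRZ2_neg powerRZ_1 | lra]. Qed.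

(** * Reindexing the constrained sums of the formula *)

Lemma Rsum_pick (a b c : nat) (P : pred nat) (F : nat -> R) :
  (a <= c < b)%N -> (forall i, (a <= i < b)%N -> P i = (i == c)) ->
  \Rsum_(a <= i < b | P i) F i = F c.
Proof.
move=> /andP [h1 h2] hP; rewrite big_mkcond /= (@Rsum_cat a c b) //; last exact: ltnW.
rewrite (big_ltn h2) (@Rsum_const0 a c) ?(@Rsum_const0 c.+1 b).
- by rewrite hP ?h1 // eqxx Rplus_0_l Rplus_0_r.
- move=> i /andP [hi hi2]; rewrite hP; last by rewrite hi2 andbT (leq_trans h1) // ltnW.
  by rewrite gtn_eqF.
- move=> i /andP [hi hi2]; rewrite hP; last by rewrite hi (ltn_trans hi2).
  by rewrite ltn_eqF.
Qed.

Lemma Rsum_mkcond (a b : nat) (P : pred nat) (F : nat -> R) :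
  \Rsum_(a <= i < b | P i) F i = \Rsum_(a <= i < b) (if P i then F i else 0).
Proof. exact: big_mkcond. Qed.

(** The inner sum over [r + 2k = N]. For odd [N] it contains [beta] at even integers and stays a
    [secant_poly]; for even [N] it contains [beta] at odd integers and is a value of [lambda]. *)
Definition sec_conv (N : nat) : R :=
  \Rsum_(0 <= k < (N./2).+1) ((-1) ^ k * divpow (2 * k).+1 (PI / 2) * beta (N - 2 * k).+1).

Lemma sum_antidiagonal (N b : nat) (F : nat -> nat -> R) : (N < b)%N ->
  \Rsum_(0 <= r < b) \Rsum_(0 <= k < b | r + 2 * k == N) F r k =
  \Rsum_(0 <= k < (N./2).+1) F (N - 2 * k)%N k.
Proof.
move=> hN.
transitivity (\Rsum_(0 <= r < b) \Rsum_(0 <= k < b) (if (r + 2 * k == N)%N then F r k else 0)).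
  by apply: Rsum_ext => r _; rewrite Rsum_mkcond.
rewrite exchange_big_nat (@Rsum_cat 0 (N./2).+1 b) //; last by lia.
rewrite [X in _ + X]Rsum_const0 ?Rplus_0_r; last first.
  move=> k hk; apply: Rsum_const0 => r hr; case: eqP => // e; exfalso; lia.
apply: Rsum_ext => k hk; rewrite -Rsum_mkcond; apply: Rsum_pick; first by lia.
by move=> i hi; apply/eqP/eqP; lia.
Qed.

Lemma sec_conv_odd (j : nat) : sec_conv (2 * j).+1 = - secant_poly j.
Proof.
rewrite /sec_conv /secant_poly (_ : ((2 * j).+1)./2 = j); last by lia.
rewrite Rsum_opp; apply: Rsum_ext => k hk.
rewrite (_ : ((2 * j).+1 - 2 * k).+1 = (2 * (j.+1 - k))%N) -?(tech_pow_Rmult (-1)); [ring | lia].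
Qed.

Lemma sec_conv_even (j : nat) : sec_conv (2 * j) = lambda (2 * j.+1).
Proof.
rewrite /sec_conv lambda_even (_ : (2 * j)./2 = j); last by lia.
by apply: Rsum_ext => k hk; rewrite -mulnBr.
Qed.

Lemma Rsum_rev (n : nat) (F : nat -> R) :
  \Rsum_(0 <= i < n) F i = \Rsum_(0 <= i < n) F (n - i.+1)%N.
Proof. by rewrite big_nat_rev. Qed.

(** The terms with even [P] come from the powers of [PI / 2], those with odd [P] from the [lambda]
    part of the integrals; together they form one alternating sum over [P]. *)
Definition mixed_term (l P : nat) : R := 4 * (1 - / 2 ^ P) * eta P * lambda ((2 * l).+2 - P).

(* The two sums with the powers of [PI / 2], the second one being the term [p = 0]
   of the first. *)
Lemma pi_power_sums (l : nat) (hl : (1 <= l)%N) :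
  (\Rsum_(1 <= p < 2 * l) \Rsum_(0 <= r < 2 * l)
       \Rsum_(0 <= k < 2 * l | p + r + 2 * k == 2 * l - 1)
         (2 * (-1) ^ (k + p) * beta (r + 1)
          * ((1 - 2 ^Z (- Z.of_nat p)) * (2 - 2 ^Z (- Z.of_nat p)) * zeta (p + 1))
          * (1 / INR (fact (2 * k + 1)) * (PI / 2) ^ (2 * k + 1))))
  + (\Rsum_(0 <= r < 2 * l) \Rsum_(0 <= k < 2 * l | r + 2 * k == 2 * l - 1)
         (2 * ln 2 * beta (r + 1)
          * ((-1) ^ k / INR (fact (2 * k + 1)) * (PI / 2) ^ (2 * k + 1)))) =
  - (\Rsum_(0 <= j < l) (kernel_coef_sum l j * (2 * secant_poly j))) -
  \Rsum_(0 <= i < l) mixed_term l (2 * i).+2.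
Proof.
(* At [p = 0] the general expression has the limit [ln 2], the pole of [zeta] at one being cancelled
   by the zero of [1 - 2^-p]. *)
pose c p := if p is 0 then ln 2 else (1 - / 2 ^ p) * (2 - / 2 ^ p) * zeta p.+1.
pose inner p := 2 * (-1) ^ p * c p * sec_conv (2 * l - 1 - p).
have hsec p : (2 * l - 1 - p < 2 * l)%N by lia.
have -> : \Rsum_(0 <= r < 2 * l) \Rsum_(0 <= k < 2 * l | r + 2 * k == 2 * l - 1)
         (2 * ln 2 * beta (r + 1)
          * ((-1) ^ k / INR (fact (2 * k + 1)) * (PI / 2) ^ (2 * k + 1))) = inner 0%N.
  rewrite sum_antidiagonal; last by lia.
  rewrite /inner subn0 /c /sec_conv Rsum_scal; apply: Rsum_ext => k hk.
  by rewrite /divpow !addn1 /Rdiv [(-1) ^ 0]/=; ring.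
have -> : \Rsum_(1 <= p < 2 * l) \Rsum_(0 <= r < 2 * l)
       \Rsum_(0 <= k < 2 * l | p + r + 2 * k == 2 * l - 1)
         (2 * (-1) ^ (k + p) * beta (r + 1)
          * ((1 - 2 ^Z (- Z.of_nat p)) * (2 - 2 ^Z (- Z.of_nat p)) * zeta (p + 1))
          * (1 / INR (fact (2 * k + 1)) * (PI / 2) ^ (2 * k + 1))) = \Rsum_(1 <= p < 2 * l) inner p.
  apply: Rsum_ext => p hp.
  transitivity (\Rsum_(0 <= r < 2 * l) \Rsum_(0 <= k < 2 * l | r + 2 * k == 2 * l - 1 - p)
     (2 * (-1) ^ p * c p * ((-1) ^ k * divpow (2 * k).+1 (PI / 2) * beta r.+1))).
    apply: Rsum_ext => r _; apply: eq_big => [k|k _]; first by apply/eqP/eqP; lia.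
    rewrite powerRZ2_neg /c; case: p hp => [//|p] hp.
    by rewrite /divpow !addn1 pow_add /Rdiv; ring.
  by rewrite sum_antidiagonal // /inner /sec_conv Rsum_scal.
rewrite Rplus_comm (_ : inner 0%N + _ = \Rsum_(0 <= p < 2 * l) inner p); last first.
  by rewrite [RHS]big_ltn //; lia.
(* Even [p] leave an odd index in [sec_conv] and odd [p] an even one. The reversal pairs
   [p = 2 (l - j - 1)] with [kernel_coef_sum l j]. *)
rewrite Rsum_double Rsum_plus Rsum_rev; congr (_ + _).
  rewrite Rsum_opp; apply: Rsum_ext => j hj; rewrite /inner pow_m1_even.
  rewrite (_ : (2 * l - 1 - 2 * (l - j.+1))%N = (2 * j).+1) ?sec_conv_odd; last by lia.
  suff -> : kernel_coef_sum l j = c (2 * (l - j.+1))%N by ring.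
  rewrite /kernel_coef_sum; case e : (l - j.+1)%N => [|m].
    by rewrite muln0 eta1 /=; field.
  rewrite eta_zeta; last by lia.
  rewrite (_ : (2 * m.+1)%N = (2 * m).+2) /c -?(tech_pow_Rmult 2 (2 * m).+2); last by lia.
  by field; apply: pow_nonzero; lra.
rewrite Rsum_opp; apply: Rsum_ext => i hi; rewrite /inner -(tech_pow_Rmult (-1)) pow_m1_even.
rewrite (_ : (2 * l - 1 - (2 * i).+1)%N = (2 * (l - i.+1))%N) ?sec_conv_even; last by lia.
rewrite /mixed_term (_ : ((2 * l).+2 - (2 * i).+2)%N = (2 * (l - i.+1).+1)%N); last by lia.
rewrite eta_zeta // /c -(tech_pow_Rmult 2 (2 * i).+1).
by field; apply: pow_nonzero; lra.
Qed.

Lemma lambda_sum (l : nat) :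
  \Rsum_(0 <= j < l) (kernel_coef_sum l j * (2 * lambda (2 * j.+1).+1)) =
  \Rsum_(0 <= i < l) mixed_term l (2 * i).+1.
Proof.
rewrite Rsum_rev; apply: Rsum_ext => i hi; rewrite /kernel_coef_sum /mixed_term.
rewrite (_ : (l - (l - i.+1).+1)%N = i); last by lia.
rewrite (_ : (2 * (l - i.+1).+1).+1 = ((2 * l).+2 - (2 * i).+1)%N); last by lia.
by ring.
Qed.

(** With [a = 2^-p] and [b = 2^-q], the identity [4 (1 - a) (1 - b) - (1 - 2 a) (1 - 2 b) = 3 - 2 a
    - 2 b] merges the mixed products and the products of [eta]. The end terms, where an argument is
    one, contain [eta 1 = ln 2] and make up the multiple of [ln 2 * zeta (2 l + 1)]. *)
Lemma eta_sums (l : nat) (hl : (1 <= l)%N) :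
  (\Rsum_(0 <= i < l) mixed_term l (2 * i).+2) - (\Rsum_(0 <= i < l) mixed_term l (2 * i).+1) +
  ((\Rsum_(0 <= p < (2 * l).+1) ((-1) ^ p * (eta p.+1 * eta ((2 * l).+1 - p)))) -
   2 * (\Rsum_(0 <= p < (2 * l).+1) ((-1) ^ p * (/ 2 ^ p.+1 * eta p.+1 * eta ((2 * l).+1 - p))))) -
  ln 2 * eta (2 * l).+1 * (2 - / 2 ^ (2 * l)) =
  (\Rsum_(2 <= p < 2 * l + 1) \Rsum_(2 <= q < 2 * l + 1 | p + q == 2 * l + 2)
         ((-1) ^ p * (1 - 2 ^Z (1 - Z.of_nat p))
          * (3 - 2 ^Z (1 - Z.of_nat p) - 2 ^Z (1 - Z.of_nat q))
          * zeta p * zeta q)) +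
  (2 ^Z (1 - Z.of_nat (2 * l)) - 3) * ln 2 * zeta (2 * l + 1).
Proof.
pose t p := (-1) ^ p * (1 - 2 * / 2 ^ p.+1) * eta p.+1 * eta ((2 * l).+1 - p).
pose h p := - (-1) ^ p * mixed_term l p.+1.
have -> : (\Rsum_(0 <= p < (2 * l).+1) ((-1) ^ p * (eta p.+1 * eta ((2 * l).+1 - p)))) -
   2 * (\Rsum_(0 <= p < (2 * l).+1) ((-1) ^ p * (/ 2 ^ p.+1 * eta p.+1 * eta ((2 * l).+1 - p)))) =
   \Rsum_(0 <= p < (2 * l).+1) t p.
  by rewrite Rsum_scal -Rsum_minus; apply: Rsum_ext => p _; rewrite /t; ring.
have -> : (\Rsum_(0 <= i < l) mixed_term l (2 * i).+2) - (\Rsum_(0 <= i < l) mixed_term l (2 * i).+1) =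
   \Rsum_(0 <= p < 2 * l) h p.
  rewrite Rsum_double -Rsum_minus; apply: Rsum_ext => i _.
  by rewrite /h -(tech_pow_Rmult (-1)) pow_m1_even; ring.
have -> : \Rsum_(2 <= p < 2 * l + 1) \Rsum_(2 <= q < 2 * l + 1 | p + q == 2 * l + 2)
         ((-1) ^ p * (1 - 2 ^Z (1 - Z.of_nat p))
          * (3 - 2 ^Z (1 - Z.of_nat p) - 2 ^Z (1 - Z.of_nat q))
          * zeta p * zeta q) = \Rsum_(1 <= p < 2 * l) (h p + t p).
  rewrite addn1 big_add1; apply: Rsum_ext => p hp.
  rewrite (@Rsum_pick _ _ ((2 * l).+1 - p)); first last.
  - by move=> i hi; apply/eqP/eqP; lia.
  - by lia.
  rewrite /h /t /mixed_term (_ : ((2 * l).+2 - p.+1)%N = ((2 * l).+1 - p)%N); last by lia.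
  rewrite !powerRZ2_1sub lambda_zeta ?eta_zeta; try by lia.
  by rewrite -(tech_pow_Rmult (-1)); ring.
rewrite Rsum_S (_ : \Rsum_(0 <= p < 2 * l) h p = h 0%N + \Rsum_(1 <= p < 2 * l) h p); last first.
  by rewrite big_ltn //; lia.
rewrite (_ : \Rsum_(0 <= p < 2 * l) t p = t 0%N + \Rsum_(1 <= p < 2 * l) t p); last first.
  by rewrite big_ltn //; lia.
rewrite Rsum_plus.
have -> : t 0%N = 0 by rewrite /t pow_1; field.
have -> : h 0%N = - 2 * ln 2 * (1 - / 2 ^ (2 * l).+1) * zeta (2 * l).+1.
  by rewrite /h /mixed_term eta1 subSS subn0 lambda_zeta /=; [field; apply: pow_nonzero; lra | lia].
have -> : t (2 * l)%N = (1 - 2 * / 2 ^ (2 * l).+1) * eta (2 * l).+1 * ln 2.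
  by rewrite /t pow_m1_even subSnn eta1; ring.
rewrite powerRZ2_1sub addn1 eta_zeta; last by lia.
rewrite -(tech_pow_Rmult 2).
by field; apply: pow_nonzero; lra.
Qed.

Unset Implicit Arguments.

Theorem corollary25 (l : nat) (hl : (1 <= l)%N) :
  S_value l =
    (\Rsum_(1 <= p < 2 * l) \Rsum_(0 <= r < 2 * l)
       \Rsum_(0 <= k < 2 * l | p + r + 2 * k == 2 * l - 1)
         (2 * (-1) ^ (k + p) * beta (r + 1)
          * ((1 - 2 ^Z (- Z.of_nat p)) * (2 - 2 ^Z (- Z.of_nat p)) * zeta (p + 1))
          * (1 / INR (fact (2 * k + 1)) * (PI / 2) ^ (2 * k + 1))))
  + (\Rsum_(0 <= p < 2 * l + 1) \Rsum_(0 <= r < 2 * l + 1 | p + r == 2 * l)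
         (2 * (-1) ^ p * beta (r + 1) * beta (p + 1)))
  + (\Rsum_(2 <= p < 2 * l + 1) \Rsum_(2 <= q < 2 * l + 1 | p + q == 2 * l + 2)
         ((-1) ^ p * (1 - 2 ^Z (1 - Z.of_nat p))
          * (3 - 2 ^Z (1 - Z.of_nat p) - 2 ^Z (1 - Z.of_nat q))
          * zeta p * zeta q))
  + (\Rsum_(0 <= r < 2 * l) \Rsum_(0 <= k < 2 * l | r + 2 * k == 2 * l - 1)
         (2 * ln 2 * beta (r + 1)
          * ((-1) ^ k / INR (fact (2 * k + 1)) * (PI / 2) ^ (2 * k + 1))))
  + (3 * 2 ^Z (- Z.of_nat (2 * l) - 1) - 2) * (1 - 2 ^Z (- Z.of_nat (2 * l) - 1))
      * zeta (2 * l + 2)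
  + (2 ^Z (1 - Z.of_nat (2 * l)) - 3) * ln 2 * zeta (2 * l + 1)
  + (2 - 2 ^Z (- Z.of_nat (2 * l))) * zeta_bar (2 * l + 1) 1
  + 2 * (\Rsum_(1 <= p < 2 * l + 2) \Rsum_(1 <= q < 2 * l + 2 | p + q == 2 * l + 2)
         (1 / 2 ^ p * zeta_bar p q)).
Proof.
have hT2 : \Rsum_(0 <= p < 2 * l + 1) \Rsum_(0 <= r < 2 * l + 1 | p + r == 2 * l)
         (2 * (-1) ^ p * beta (r + 1) * beta (p + 1)) =
    2 * (\Rsum_(0 <= p < (2 * l).+1) ((-1) ^ p * (beta p.+1 * beta ((2 * l).+1 - p)))).
  rewrite addn1 Rsum_scal; apply: Rsum_ext => p hp; rewrite (@Rsum_pick _ _ (2 * l - p)).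
  - rewrite (_ : (2 * l - p + 1)%N = ((2 * l).+1 - p)%N) ?addn1; [ring | lia].
  - by lia.
  - by move=> i hi; apply/eqP/eqP; lia.
have hT8 : \Rsum_(1 <= p < 2 * l + 2) \Rsum_(1 <= q < 2 * l + 2 | p + q == 2 * l + 2)
         (1 / 2 ^ p * zeta_bar p q) =
    \Rsum_(0 <= p < (2 * l).+1) (/ 2 ^ p.+1 * zeta_bar p.+1 ((2 * l).+1 - p)).
  rewrite addn2 big_add1; apply: Rsum_ext => p hp; rewrite (@Rsum_pick _ _ ((2 * l).+1 - p)).
  - by rewrite /Rdiv Rmult_1_l.
  - by lia.
  - by move=> i hi; apply/eqP/eqP; lia.
have hT5 : 2 ^Z (- Z.of_nat (2 * l) - 1) = / 2 ^ (2 * l).+1.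
  by rewrite -powerRZ2_neg; congr (_ ^Z _); lia.
have hz : zeta (2 * l + 2) = zeta (2 * l).+2 by rewrite addn2.
have hzb : zeta_bar (2 * l + 1) 1 = zeta_bar (2 * l).+1 1 by rewrite addn1.
rewrite hT2 hT8 hT5 (powerRZ2_neg (2 * l)) hz hzb.
have := S_value_convolutions hl; have := pi_power_sums hl; have := eta_sums hl.
have -> : \Rsum_(0 <= j < l) (kernel_coef_sum l j * (2 * (lambda (2 * j.+1).+1 + secant_poly j))) =
  (\Rsum_(0 <= i < l) mixed_term l (2 * i).+1) + \Rsum_(0 <= j < l) (kernel_coef_sum l j * (2 * secant_poly j)).
  by rewrite -lambda_sum -Rsum_plus; apply: Rsum_ext => j _; ring.
lra.
Qed.
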